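(* Let $w$ be a regular transition kernel and $G$ a densely defined operator in $\mathsf{L}^2(Z)$. Suppose that $G$ satisfies the following three requirements: (1) $G$ is the infinitesimal generator of a strongly continuous contraction semigroup $P=(P_t)_{t\ge0}$ on $\mathsf{L}^2(Z)$; (2) $G$ is $S_w$-admissible and amenable; (3) there exists a constant $b$ such that, for all $\xi\in\mathcal{D}=\mathrm{span}\{Z_\sigma\mid\sigma\in\Gamma\}$, $$2\Re\langle N\xi,G\xi\rangle+\sum_{j,k=0}^\infty w(j,k)\langle\partial_j^*\partial_k\xi,N\partial_j^*\partial_k\xi\rangle\le b\,\langle\xi,N\xi\rangle .$$ Then the minimal QDS $\mathcal{T}=(\mathcal{T}_t)_{t\ge0}$ constructed from $w$, $G$ and $(\partial_j^*\partial_k)_{j,k\ge0}$ is conservative, i.e. $\mathcal{T}_t(I)=I$ for every $t\ge0$.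
   Context: $\mathbb{N}$ is the set of nonnegative integers and $\Gamma$ the set of all finite subsets of $\mathbb{N}$; $\mathbf{1}_\sigma$ is the indicator function of $\sigma\in\Gamma$ and $\#(\sigma)$ its cardinality. $(\Omega,\mathscr{F},\mathbb{P})$ is a probability space and $Z=(Z_n)_{n\ge0}$ an independent sequence of random variables with $\mathbb{P}\{Z_n=\theta_n\}=p_n$, $\mathbb{P}\{Z_n=-1/\theta_n\}=q_n$, where $0<p_n<1$, $q_n=1-p_n$, $\theta_n=\sqrt{q_n/p_n}$, and $\mathscr{F}$ is the $\sigma$-field generated by $Z$. $\mathsf{L}^2(Z)=L^2(\Omega,\mathscr{F},\mathbb{P})$ (complex-valued), with inner product $\langle\xi,\eta\rangle=\mathbb{E}[\overline{\xi}\eta]$. Put $Z_\emptyset=1$ and $Z_\sigma=\prod_{i\in\sigma}Z_i$; $\{Z_\sigma\mid\sigma\in\Gamma\}$ is an orthonormal basis of $\mathsf{L}^2(Z)$ (the canonical ONB). For $k\in\mathbb{N}$, $\partial_k$ is the bounded operator on $\mathsf{L}^2(Z)$ with $\partial_kZ_\sigma=\mathbf{1}_\sigma(k)Z_{\sigma\setminus\{k\}}$, and its adjoint satisfies $\partial_k^*Z_\sigma=[1-\mathbf{1}_\sigma(k)]Z_{\sigma\cup\{k\}}$, for all $\sigma\in\Gamma$. The number operator $N$ is $N\xi=\sum_{\sigma\in\Gamma}\#(\sigma)\langle Z_\sigma,\xi\rangle Z_\sigma$ with $\mathrm{Dom}\,N=\{\xi\mid\sum_{\sigma}(\#(\sigma))^2|\langle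 Z_\sigma,\xi\rangle|^2<\infty\}$. A transition kernel is a nonnegative function $w\colon\mathbb{N}\times\mathbb{N}\to\mathbb{R}$ with $\sup_{k\ge0}\sum_{j=0}^\infty w(j,k)<\infty$; it is regular if $\inf_{j\ge0}w(j,j)>0$. A double series $\sum_{j,k=0}^\infty\xi_{jk}$ in $\mathsf{L}^2(Z)$ converges naturally if $\sum_{j=0}^n\sum_{k=0}^n\xi_{jk}$ converges as $n\to\infty$ (the limit being its sum). The 2D-weighted number operator is $S_w\xi=\sum_{j,k=0}^\infty w(j,k)\partial_k^*\partial_j\partial_j^*\partial_k\xi$, with $\mathrm{Dom}\,S_w$ the set of all $\xi$ for which this double series converges naturally. A densely defined operator $G$ is $S_w$-admissible if both $G$ and its adjoint $G^*$ have the same domain as $S_w$ and $G+G^*=-S_w$ on $\mathrm{Dom}\,S_w$. An operator $A$ with $\mathcal{D}\subset\mathrm{Dom}\,A$ is amenable if for all $\xi\in\mathrm{Dom}\,A$ the sequence $(A\xi_n)_{n\ge1}$ converges in $\mathsf{L}^2(Z)$, where $\xi_n=\sum_{\sigma\in\Gamma_{n]}}\langle Z_\sigma,\xi\rangle Z_\sigma$ and $\Gamma_{n]}=\{\sigma\in\Gamma\mid\sigma=\emptyset\text{ or }\max\sigma\le n\}$. $\mathfrak{B}(\mathsf{H})$ denotes the bounded operators on a complex separable Hilbert space $\mathsf{H}$, with operator norm $\|\cdot\|_\infty$. A quantum dynamical semigroup (QDS) on $\mathfrak{B}(\mathsf{H})$ is a family $(\mathcal{T}_t)_{t\ge0}$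 of linear maps on $\mathfrak{B}(\mathsf{H})$ such that: (i) $\mathcal{T}_0(X)=X$; (ii) $\mathcal{T}_{t+s}(X)=\mathcal{T}_t(\mathcal{T}_s(X))$; (iii) $\mathcal{T}_t(I)\le I$; (iv) each $\mathcal{T}_t$ is completely positive, i.e. $\sum_{i,j=1}^nY_i^*\mathcal{T}_t(X_i^*X_j)Y_j\ge0$ for all finite sequences $(X_i),(Y_i)$; (v) if a sequence $X_n\to X$ weakly then $\mathcal{T}_t(X_n)\to\mathcal{T}_t(X)$ weakly; (vi) $\lim_{t\to0^+}\mathrm{Tr}(\rho\mathcal{T}_t(X))=\mathrm{Tr}(\rho X)$ for all trace class $\rho$ and all $X$. A conservative QDS is called a quantum Markov semigroup (QMS). If $w$ is a transition kernel and $G$ is an $S_w$-admissible generator of a strongly continuous contraction semigroup, the minimal QDS constructed from $w$, $G$ and $(\partial_j^*\partial_k)_{j,k\ge0}$ is the (existing) QDS $\mathcal{T}$ on $\mathfrak{B}(\mathsf{L}^2(Z))$ satisfying $$\langle\xi,\mathcal{T}_t(X)\eta\rangle=\langle\xi,X\eta\rangle+\int_0^t\Big[\langle\xi,\mathcal{T}_s(X)G\eta\rangle+\langle G\xi,\mathcal{T}_s(X)\eta\rangle+\sum_{j,k=0}^\infty w(j,k)\langle\partial_j^*\partial_k\xi,\mathcal{T}_s(X)\partial_j^*\partial_k\eta\rangle\Big]ds$$ for all $\xi,\eta\in\mathrm{Dom}\,G$ and $X\in\mathfrak{B}(\mathsf{L}^2(Z))$, and minimal in the sense that any other QDS $\mathcal{S}$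 satisfying the same equation satisfies $\mathcal{T}_t(X)\le\mathcal{S}_t(X)\le\|X\|_\infty I$ for all positive $X$ and all $t\ge0$. *)

(* Defs.v *)
From HB Require Import structures.
From mathcomp Require Import all_boot all_order all_algebra finmap.
From mathcomp Require Import ring_quotient complex.
From mathcomp Require Import all_classical all_reals all_analysis.
From mathcomp Require Import summability.

Set Implicit Arguments.
Unset Strict Implicit.
Unset Printing Implicit Defensive.
Import Order.TTheory GRing.Theory Num.Theory numFieldNormedType.Exports.

Local Open Scope classical_set_scope.
Local Open Scope ring_scope.

HB.instance Definition _ (R : realType) := NormedModule.copy R[i] R[i]^o.

(* [inner] is conjugate-linear in its first argument and linear in the second,
   unlike the [{dot _ for _}] forms of sesquilinear.v. *)
HB.mixin Record NormedModule_isInner (R : realType) H & NormedModule R[i] H := {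
  inner : H -> H -> R[i];
  innerC : forall x y, inner y x = (inner x y)^*;
  innerDr : forall x y z, inner x (y + z) = inner x y + inner x z;
  innerZr : forall a x y, inner x (a *: y) = a * inner x y;
  inner_norm : forall x, inner x x = `|x| ^+ 2 }.

#[short(type=innerModType)]
HB.structure Definition InnerModule (R : realType) :=
  {H of NormedModule_isInner R H & NormedModule R[i] H}.

Section norm_of_inner_product.
Context {R : realType} {H : lmodType R[i]} (dot : H -> H -> R[i]).
Hypotheses (dotC : forall x y, dot y x = (dot x y)^*)
  (dotDr : forall x y z, dot x (y + z) = dot x y + dot x z)
  (dotZr : forall a x y, dot x (a *: y) = a * dot x y)
  (dot_ge0 : forall x, 0 <= dot x x) (dot_eq0 : forall x, dot x x = 0 -> x = 0).

Lemma dotDl x y z : dot (x + y) z = dot x z + dot y z.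
Proof. by rewrite dotC dotDr rmorphD /= -!dotC. Qed.

Lemma dotZl a x y : dot (a *: x) y = a^* * dot x y.
Proof. by rewrite dotC dotZr rmorphM /= -dotC. Qed.

Lemma dot_CauchySchwarz x y : `|dot x y| ^+ 2 <= dot x x * dot y y.
Proof.
have [y0|ny0] := eqVneq (dot y y) 0.
  by rewrite (dot_eq0 y0) -(scale0r 0) !dotZr !mul0r normr0 expr0n mulr0.
have y_gt0 : 0 < dot y y by rewrite lt_def ny0 dot_ge0.
have := dot_ge0 (x + - (dot y x / dot y y) *: y).
rewrite dotDr !dotDl !dotZr !dotZl; set a := dot y x / dot y y.
have aE : a * dot y y = dot y x by rewrite /a divfK.
have -> : (- a)^* = - a^* by rewrite rmorphN.
rewrite !mulNr !mulrN opprK (mulrCA a) aE addrCA addrA.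
rewrite -addrA subrK addrC subr_ge0 -(ler_pM2r y_gt0) mulrAC aE.
by rewrite normCK -dotC mulrC.
Qed.

Lemma dot_sqrtZ a x : sqrtC (dot (a *: x) (a *: x)) = `|a| * sqrtC (dot x x).
Proof. by rewrite dotZr dotZl mulrA -normCK rootCMl ?exprn_ge0// sqrCK. Qed.

Lemma dot_sqrt_eq0 x : sqrtC (dot x x) = 0 -> x = 0.
Proof. by move=> /eqP; rewrite sqrtC_eq0 => /eqP /dot_eq0. Qed.

Lemma dot_triangle x y :
  sqrtC (dot (x + y) (x + y)) <= sqrtC (dot x x) + sqrtC (dot y y).
Proof.
have s0 z : 0 <= sqrtC (dot z z) by rewrite sqrtC_ge0.
rewrite -ler_sqr ?nnegrE ?addr_ge0// sqrrD !sqrtCK.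
rewrite dotDr !dotDl addrA lerD2r -!addrA lerD2l.
have : `|dot x y| <= sqrtC (dot x x) * sqrtC (dot y y).
  rewrite -ler_sqr ?nnegrE ?mulr_ge0// exprMn !sqrtCK.
  exact: dot_CauchySchwarz.
move=> /(le_trans (leif_Re_Creal (dot x y)).1).
by rewrite ReE ler_pdivrMr// mulr_natr addrC (dotC x y).
Qed.

End norm_of_inner_product.

Notation cRe := (@complex.Re _).
Notation cIm := (@complex.Im _).

Section complex_parts.
Context {R : realType}.
Implicit Types x y : R[i].

Lemma cReD x y : cRe (x + y) = cRe x + cRe y.
Proof. by case: x y => ? ? []. Qed.
Lemma cImD x y : cIm (x + y) = cIm x + cIm y.
Proof. by case: x y => ? ? []. Qed.
Lemma cReM x y : cRe (x * y) = cRe x * cRe y - cIm x * cIm y.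
Proof. by case: x y => ? ? []. Qed.
Lemma cImM x y : cIm (x * y) = cRe x * cIm y + cIm x * cRe y.
Proof. by case: x y => ? ? []. Qed.
Lemma cReJ x : cRe x^* = cRe x. Proof. by case: x. Qed.
Lemma cImJ x : cIm x^* = - cIm x. Proof. by case: x. Qed.
Lemma cReIm_inj x y : cRe x = cRe y -> cIm x = cIm y -> x = y.
Proof. by case: x y => ? ? [? ?] /= -> ->. Qed.

End complex_parts.

Section complex_integral.
Context d (T : measurableType d) (R : realType).
Variables (mu : {measure set T -> \bar R}) (D : set T).
Implicit Types f g : T -> R[i].

Definition cintegrable f :=
  mu.-integrable D (fun t => (cRe (f t))%:E) /\
  mu.-integrable D (fun t => (cIm (f t))%:E).

Definition cintegral f : R[i] :=
  Complex (\int[mu]_(t in D) cRe (f t)) (\int[mu]_(t in D) cIm (f t)).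

Hypothesis mD : measurable D.

Lemma cintegralD f g : cintegrable f -> cintegrable g ->
  cintegral (fun t => f t + g t) = cintegral f + cintegral g.
Proof.
move=> [fr fi] [gr gi]; apply: cReIm_inj; rewrite ?cReD ?cImD/= -RintegralD//;
by apply: eq_Rintegral => t _; rewrite ?cReD ?cImD.
Qed.

Lemma cintegralZl a f : cintegrable f ->
  cintegral (fun t => a * f t) = a * cintegral f.
Proof.
have iZ (r : R) (h : T -> R) : mu.-integrable D (fun t => (h t)%:E) ->
    mu.-integrable D (EFin \o (fun t => r * h t)).
  by move=> /(integrableZl mD r); apply: eq_integrable => // t _; rewrite EFinM.
move=> [fr fi]; apply: cReIm_inj; rewrite ?cReM ?cImM/=.
  rewrite -!RintegralZl// -RintegralB//; try exact: iZ.
  by apply: eq_Rintegral => t _; rewrite cReM.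
rewrite -!RintegralZl// -RintegralD//; try exact: iZ.
by apply: eq_Rintegral => t _; rewrite cImM.
Qed.

Lemma cintegralJ f : cintegrable f ->
  cintegral (fun t => (f t)^*) = (cintegral f)^*.
Proof.
move=> [fr fi]; apply: cReIm_inj; rewrite ?cReJ ?cImJ/=.
  by apply: eq_Rintegral => t _; rewrite cReJ.
rewrite -mulN1r -RintegralZl//.
by apply: eq_Rintegral => t _; rewrite cImJ mulN1r.
Qed.

Lemma ae_eq_cintegral f g : cintegrable f -> cintegrable g ->
  {ae mu, forall t, D t -> f t = g t} -> cintegral f = cintegral g.
Proof.
move=> [fr fi] [gr gi] fg.
congr (Complex (fine _) (fine _)); apply: ae_eq_integral => //.
- by have [] := integrableP _ _ _ fr.
- by have [] := integrableP _ _ _ gr.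
- by apply: filterS fg => t fgt Dt; rewrite fgt.
- by have [] := integrableP _ _ _ fi.
- by have [] := integrableP _ _ _ gi.
- by apply: filterS fg => t fgt Dt; rewrite fgt.
Qed.

End complex_integral.

Section complex_L2_functions.
Context d (T : measurableType d) (R : realType) (P : probability T R).

(* |f|^2 is integrable iff (Re f)^2 and (Im f)^2 are. *)
Definition Lfun2C : {pred T -> R[i]} :=
  [pred f | (cRe \o f \in Lfun P 2%:E) && (cIm \o f \in Lfun P 2%:E)].

Lemma Lfun2C_submod_closed : submod_closed Lfun2C.
Proof.
have [F0 FZD] := @Lfun_submod_closed _ _ R P 2%:E (lee1n 2).
split=> [|a f g /andP[f1 f2] /andP[g1 g2]].
  by apply/andP; split; exact: F0.
apply/andP; split.
  rewrite (_ : _ \o _ =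
    cRe a *: (cRe \o f) + ((- cIm a) *: (cIm \o f) + (cRe \o g : T -> R))).
    exact/FZD/FZD.
  apply/funext => x; rewrite -[LHS]/(cRe (a * f x + g x)) cReD cReM.
  by rewrite -addrA -mulNr.
rewrite (_ : _ \o _ =
  cRe a *: (cIm \o f) + (cIm a *: (cRe \o f) + (cIm \o g : T -> R))).
  exact/FZD/FZD.
apply/funext => x; rewrite -[LHS]/(cIm (a * f x + g x)) cImD cImM.
by rewrite -addrA.
Qed.

HB.instance Definition _ := GRing.isSubmodClosed.Build R[i] (T -> R[i]) Lfun2C
  Lfun2C_submod_closed.

Record L2fun := MkL2fun {
  L2fun_val :> T -> R[i];
  L2fun_valP : L2fun_val \in Lfun2C }.

HB.instance Definition _ := [isSub for L2fun_val].
HB.instance Definition _ := [Choice of L2fun by <:].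
HB.instance Definition _ := [SubChoice_isSubLmodule of L2fun by <:].

Definition ae_zero : {pred L2fun} :=
  [pred f : L2fun | `[< {ae P, forall x, f x = 0} >]].

Lemma ae_zero_submod_closed : submod_closed ae_zero.
Proof.
split=> [|a f g /asboolP f0 /asboolP g0].
  exact/asboolP/aeW.
apply/asboolP; apply: filterS2 f0 g0 => x fx gx.
by rewrite -[LHS]/(a * f x + g x) fx gx mulr0 addr0.
Qed.

HB.instance Definition _ := GRing.isSubmodClosed.Build R[i] L2fun ae_zero
  ae_zero_submod_closed.

Definition L2 := {ideal_quot ae_zero}.
HB.instance Definition _ := GRing.Zmodule.on L2.

Definition L2class (f : L2fun) : L2 := (\pi f)%qT.
Definition L2repr (x : L2) : L2fun := repr x.

Lemma L2reprK : cancel L2repr L2class. Proof. exact: reprK. Qed.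

Lemma L2class_is_additive : zmod_morphism L2class.
Proof. by move=> f g; rewrite /L2class raddfB. Qed.
HB.instance Definition _ :=
  GRing.isZmodMorphism.Build L2fun L2 L2class L2class_is_additive.

Lemma L2class_eqP (f g : L2fun) :
  L2class f = L2class g <-> {ae P, forall x, f x = g x}.
Proof.
transitivity (f - g \in ae_zero).
  by rewrite Quotient.idealrBE; split => /eqP.
split=> [/asboolP|] fg; last apply/asboolP; apply: filterS fg => x.
  by move=> fg; apply: subr0_eq.
by move=> fg; rewrite -[LHS]/(f x - g x) fg subrr.
Qed.

Definition L2scale (a : R[i]) (x : L2) : L2 := L2class (a *: L2repr x).

Lemma L2scale_class a f : L2scale a (L2class f) = L2class (a *: f).
Proof.
apply/L2class_eqP; have /L2class_eqP : L2class (L2repr (L2class f)) = L2class f.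
  exact: L2reprK.
by move=> fe; apply: filterS fe => x fx; congr (a * _).
Qed.

Lemma L2scaleA a b x : L2scale a (L2scale b x) = L2scale (a * b) x.
Proof. by rewrite -(L2reprK x) !L2scale_class scalerA. Qed.
Lemma L2scale1 : left_id 1 L2scale.
Proof. by move=> x; rewrite -(L2reprK x) L2scale_class scale1r. Qed.
Lemma L2scaleDr : right_distributive L2scale +%R.
Proof.
move=> a x y.
by rewrite -(L2reprK x) -(L2reprK y) -raddfD !L2scale_class scalerDr raddfD.
Qed.
Lemma L2scaleDl x : {morph L2scale^~ x : a b / a + b}.
Proof.
by move=> a b; rewrite -(L2reprK x) !L2scale_class scalerDl raddfD.
Qed.
HB.instance Definition _ := GRing.Zmodule_isLmodule.Build R[i] L2
  L2scaleA L2scale1 L2scaleDr L2scaleDl.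

Lemma cintegrable_L2fun (f g : L2fun) :
  cintegrable P setT (fun t => (f t)^* * g t).
Proof.
have /andP[fr fi] := L2fun_valP f; have /andP[gr gi] := L2fun_valP g.
have int2 (h k : T -> R) : h \in Lfun P 2%:E -> k \in Lfun P 2%:E ->
    P.-integrable setT (fun t => (h t * k t)%:E).
  by move=> hL kL; exact/Lfun1_integrable/Lfun2_mul_Lfun1.
split.
  apply: (eq_integrable _ (fun t => (cRe (f t) * cRe (g t))%:E +
                                    (cIm (f t) * cIm (g t))%:E)%E) => //.
    by move=> t _; rewrite cReM cReJ cImJ mulNr opprK.
  by apply: integrableD => //; exact: int2.
apply: (eq_integrable _ (fun t => (cRe (f t) * cIm (g t))%:E -
                                  (cIm (f t) * cRe (g t))%:E)%E) => //.
  by move=> t _; rewrite cImM cReJ cImJ mulNr.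
by apply: integrableB => //; exact: int2.
Qed.

Definition L2dot (x y : L2) : R[i] :=
  cintegral P setT (fun t => (L2repr x t)^* * L2repr y t).

Lemma L2repr_class f : {ae P, forall t, L2repr (L2class f) t = f t}.
Proof. by apply/L2class_eqP; rewrite L2reprK. Qed.

Lemma L2dot_class f g : L2dot (L2class f) (L2class g) =
  cintegral P setT (fun t => (f t)^* * g t).
Proof.
apply: ae_eq_cintegral => //; try exact: cintegrable_L2fun.
apply: filterS2 (L2repr_class f) (L2repr_class g) => t ft gt _.
by rewrite ft gt.
Qed.

Lemma L2dotC x y : L2dot y x = (L2dot x y)^*.
Proof.
rewrite /L2dot -cintegralJ//; last exact: cintegrable_L2fun.
by congr cintegral; apply/funext => t; rewrite rmorphM /= conjCK mulrC.
Qed.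

Lemma L2dotDr x y z : L2dot x (y + z) = L2dot x y + L2dot x z.
Proof.
rewrite -(L2reprK x) -(L2reprK y) -(L2reprK z) -raddfD !L2dot_class.
rewrite -cintegralD//; try exact: cintegrable_L2fun.
by congr cintegral; apply/funext => t; rewrite -mulrDr.
Qed.

Lemma L2dotZr a x y : L2dot x (a *: y) = a * L2dot x y.
Proof.
rewrite -(L2reprK x) -(L2reprK y) [a *: _]L2scale_class !L2dot_class.
rewrite -cintegralZl//; last exact: cintegrable_L2fun.
by congr cintegral; apply/funext => t; rewrite [RHS]mulrCA.
Qed.

Lemma L2dot_selfE x : L2dot x x =
  Complex (\int[P]_t (cRe (L2repr x t) ^+ 2 + cIm (L2repr x t) ^+ 2)) 0.
Proof.
apply: cReIm_inj => /=.
  by apply: eq_Rintegral => t _; rewrite cReM cReJ cImJ mulNr opprK.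
rewrite (@eq_Rintegral _ _ _ _ _ (cst 0)) ?Rintegral_cst ?mul0r// => t _.
by rewrite cImM cReJ cImJ mulNr mulrC subrr.
Qed.

Lemma L2dot_ge0 x : 0 <= L2dot x x.
Proof.
rewrite L2dot_selfE lecE/= eqxx/=; apply: Rintegral_ge0 => t _.
by rewrite addr_ge0// sqr_ge0.
Qed.

Lemma L2dot_eq0 x : L2dot x x = 0 -> x = 0.
Proof.
set h := fun t => cRe (L2repr x t) ^+ 2 + cIm (L2repr x t) ^+ 2.
have h0 t : 0 <= h t by rewrite addr_ge0// sqr_ge0.
have hi : P.-integrable setT (EFin \o h).
  have [+ _] := cintegrable_L2fun (L2repr x) (L2repr x).
  apply: eq_integrable => // t _.
  by rewrite /= cReM cReJ cImJ mulNr opprK.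
rewrite L2dot_selfE => -[]; rewrite -/h => /eqP hx0.
have [mh _] := integrableP _ _ _ hi.
have : (\int[P]_t `|(h t)%:E| = 0)%E.
  rewrite -[RHS](_ : (\int[P]_t h t)%:E = 0%E); last by rewrite (eqP hx0).
  rewrite /Rintegral fineK; last exact: integrable_fin_num.
  by apply: eq_integral => t _; rewrite gee0_abs// lee_fin.
move=> /(ae_eq_integral_abs P measurableT mh) hz.
rewrite -(L2reprK x) -(raddf0 L2class); apply/L2class_eqP.
apply: filterS hz => t /(_ I) [] /eqP; rewrite paddr_eq0 ?sqr_ge0// !sqrf_eq0.
by move=> /andP[/eqP re0 /eqP im0]; exact: cReIm_inj.
Qed.

HB.instance Definition _ := Lmodule_isNormed.Build R[i] L2
  (dot_triangle L2dotC L2dotDr L2dotZr L2dot_ge0 L2dot_eq0)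
  (dot_sqrtZ L2dotC L2dotZr) (dot_sqrt_eq0 L2dot_eq0).

Lemma L2dot_norm (x : L2) : L2dot x x = `|x| ^+ 2.
Proof. exact/esym/sqrtCK. Qed.

HB.instance Definition _ := NormedModule_isInner.Build R L2
  L2dotC L2dotDr L2dotZr L2dot_norm.

End complex_L2_functions.

Section bounded_operators.
Context {R : realType} (H : innerModType R).

Definition bounded_op : {pred H -> H} := [pred X : H -> H |
  `[< linear X /\ exists2 M : R[i], 0 <= M & forall x, `|X x| <= M * `|x| >]].

Lemma bounded_op_submod_closed : submod_closed bounded_op.
Proof.
split=> [|a X Y /asboolP[lX [M M0 XM]] /asboolP[lY [N N0 YN]]]; apply/asboolP.
  split=> [b x y|]; first by rewrite /= scaler0 addr0.
  by exists 0 => // x; rewrite normr0 mul0r.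
split=> [b x y|].
  rewrite -[LHS]/(a *: X _ + Y _).
  rewrite -[RHS]/(b *: (a *: X x + Y x) + (a *: X y + Y y)).
  by rewrite lX lY !scalerDr !scalerA (mulrC a) addrACA.
exists (`|a| * M + N) => [|x]; first by rewrite addr_ge0// mulr_ge0.
rewrite -[(_ + _) x]/(a *: X x + Y x).
by rewrite (le_trans (ler_normD _ _))// normrZ mulrDl -mulrA lerD// ler_wpM2l.
Qed.

HB.instance Definition _ := GRing.isSubmodClosed.Build R[i] (H -> H) bounded_op
  bounded_op_submod_closed.

Record bop := MkBop { bop_val :> H -> H; bop_valP : bop_val \in bounded_op }.

HB.instance Definition _ := [isSub for bop_val].
HB.instance Definition _ := [Choice of bop by <:].
HB.instance Definition _ := [SubChoice_isSubLmodule of bop by <:].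

Lemma bop_id_bounded : idfun \in bounded_op.
Proof. by apply/asboolP; split=> //; exists 1 => // x; rewrite mul1r. Qed.

Definition bop1 : bop := MkBop bop_id_bounded.

Lemma bop_comp_bounded (X Y : bop) : X \o Y \in bounded_op.
Proof.
have /asboolP[lX [M M0 XM]] := bop_valP X.
have /asboolP[lY [N N0 YN]] := bop_valP Y.
apply/asboolP; split=> [a x y|]; first by rewrite /= lY lX.
exists (M * N) => [|x]; first exact: mulr_ge0.
by rewrite (le_trans (XM _))// -mulrA ler_wpM2l.
Qed.

Definition bop_comp (X Y : bop) : bop := MkBop (bop_comp_bounded X Y).

End bounded_operators.

Arguments bop1 {R H}.
Notation "X \ob Y" := (bop_comp X Y)
  (at level 40, left associativity) : ring_scope.


Section operator_order_and_trace.
Context {R : realType} {H : innerModType R}.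
Implicit Types (X Y A : bop H) (x y : H).

(* On a complete space, such as L^2, this set is a singleton. *)
Definition bop_adj X : bop H :=
  xget (0 : bop H) [set Y : bop H | forall x y, inner x (X y) = inner (Y x) y].

Definition bop_ge0 X := forall x, 0 <= inner x (X x).

Definition bop_le X Y := bop_ge0 (Y - X).

Definition opnorm X : R := sup [set cRe `|X x| | x in [set x : H | `|x| <= 1]].

Definition weak_cvg (X : nat -> bop H) Y :=
  forall x y, inner x (X n y) @[n --> \oo] --> inner x (Y y).

Definition lspan (I : Type) (e : I -> H) : set H :=
  [set x | exists (s : seq I) (c : I -> R[i]), x = \sum_(i <- s) c i *: e i].

Definition orthonormal_basis (I : choiceType) (e : I -> H) :=
  (forall i j, inner (e i) (e j) = (i == j)%:R) /\ dense (lspan e).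

(* [A] is the absolute value |X|. *)
Definition trace_class X := exists A, [/\ bop_ge0 A, A \ob A = bop_adj X \ob X &
  forall (I : choiceType) (e : I -> H), orthonormal_basis e ->
    cvg (partial_sum (fun i => inner (e i) (A (e i))) @ totally)].

Definition bop_trace X : R[i] :=
  xget (0 : R[i]) [set v : R[i] | forall (I : choiceType) (e : I -> H),
    orthonormal_basis e ->
    partial_sum (fun i => inner (e i) (X (e i))) @ totally --> v].

End operator_order_and_trace.

Section unbounded_operators.
Context {R : realType} {H : innerModType R}.

(* The values of [op_fun] outside [dom] are irrelevant. *)
Record operator := Operator { dom : set H; op_fun :> H -> H }.

Definition linear_operator (A : operator) := dom A 0 /\
  forall (a : R[i]) x y, dom A x -> dom A y ->
    dom A (a *: x + y) /\ A (a *: x + y) = a *: A x + A y.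

Definition densely_defined (A : operator) := dense (dom A).

Definition adjoint_rel (A : operator) x z :=
  forall y, dom A y -> inner x (A y) = inner z y.

Definition adjoint (A : operator) : operator := Operator
  [set x | exists z, adjoint_rel A x z] (fun x => xget 0 (adjoint_rel A x)).

Record contraction_semigroup (P : R -> bop H) : Prop := {
  semigroup0 : P 0 = bop1;
  semigroupD : forall s t : R, 0 <= s -> 0 <= t -> P (s + t) = P s \ob P t;
  semigroup_contraction : forall (t : R) x, 0 <= t -> `|P t x| <= `|x|;
  semigroup_strong_cvg : forall x, P t x @[t --> 0^'+] --> x }.

Definition generator (P : R -> bop H) (G : operator) := forall x y,
  dom G x /\ G x = y <-> (t^-1)%:C%C *: (P t x - x) @[t --> 0^'+] --> y.

End unbounded_operators.
Arguments operator {R} H.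

Section quantum_dynamical_semigroups.
Context {R : realType} {H : innerModType R}.
Implicit Types (T S : R -> bop H -> bop H).

(* Only the values [T t] with [0 <= t] are constrained. *)
Record qds T : Prop := {
  qds_linear : forall t : R, 0 <= t -> linear (T t);
  qds0 : forall X, T 0 X = X;
  qdsD : forall (t s : R) X, 0 <= t -> 0 <= s -> T (t + s) X = T t (T s X);
  qds_le1 : forall t : R, 0 <= t -> bop_le (T t bop1) bop1;
  qds_cp : forall (t : R) n (X Y : 'I_n -> bop H), 0 <= t ->
    bop_ge0 (\sum_(i < n) \sum_(j < n)
      bop_adj (Y i) \ob T t (bop_adj (X i) \ob X j) \ob Y j);
  qds_weak : forall (t : R) (X : nat -> bop H) Y, 0 <= t -> weak_cvg X Y ->
    weak_cvg (fun n => T t (X n)) (T t Y);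
  qds_trace_cvg : forall rho X, trace_class rho ->
    bop_trace (rho \ob T t X) @[t --> 0^'+] --> bop_trace (rho \ob X) }.

Definition conservative T := forall t : R, 0 <= t -> T t bop1 = bop1.

(* The sum over {0,...,n} x {0,...,n}; a double series converges naturally
   when these partial sums converge. *)
Definition square_sum (V : zmodType) (F : nat -> nat -> V) (n : nat) : V :=
  \sum_(j < n.+1) \sum_(k < n.+1) F j k.

Variables (w : nat -> nat -> R) (G : operator H) (L : nat -> nat -> bop H).

Definition jump_form (X : bop H) x y (n : nat) : R[i] :=
  square_sum (fun j k => (w j k)%:C%C * inner (L j k x) (X (L j k y))) n.

Definition qds_integrand T X x y (s : R) : R[i] :=
  inner x (T s X (G y)) + inner (G x) (T s X y) + limn (jump_form (T s X) x y).

(* The convergence of the double series and the integrability of the integrand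
   are part of the equation, as [limn] and [cintegral] are total functions. *)
Definition qds_equation T := forall x y X (t : R),
  dom G x -> dom G y -> 0 <= t ->
  [/\ forall s : R, 0 <= s -> cvgn (jump_form (T s X) x y),
      cintegrable lebesgue_measure `[0, t] (qds_integrand T X x y) &
      inner x (T t X y) = inner x (X y) +
        cintegral lebesgue_measure `[0, t] (qds_integrand T X x y)].

Definition minimal_qds T := [/\ qds T, qds_equation T &
  forall S, qds S -> qds_equation S -> forall X (t : R), bop_ge0 X -> 0 <= t ->
    bop_le (T t X) (S t X) /\ bop_le (S t X) ((opnorm X)%:C%C *: bop1)].

End quantum_dynamical_semigroups.

Section kernels.
Context {R : realType}.
Implicit Types w : nat -> nat -> R.

Definition transition_kernel w := (forall j k, 0 <= w j k) /\
  (ereal_sup (range (fun k => \sum_(0 <= j <oo) (w j k)%:E)) < +oo)%E.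

Definition regular_kernel w :=
  transition_kernel w /\ 0 < inf (range (fun j => w j j)).

End kernels.

Section bernoulli_noise.
Context d (T : measurableType d) (R : realType) (P : probability T R).
Implicit Types (Z : nat -> {RV P >-> R}) (p : nat -> R) (s : {fset nat}).

Definition independent_RVs Z := forall s (B : nat -> set R),
  (forall i, measurable (B i)) ->
  P (\bigcap_(i in [set` s]) Z i @^-1` B i) =
  (\prod_(i <- s) fine (P (Z i @^-1` B i)))%:E.

Definition sigma_generated_by Z := forall A : set T, measurable A ->
  <<s \bigcup_i preimage_set_system setT (Z i) measurable >> A.

Definition noise_theta p n : R := Num.sqrt ((1 - p n) / p n).

Record bernoulli_noise p Z : Prop := {
  noise_p : forall n, 0 < p n < 1;
  noise_theta_prob : forall n, P (Z n @^-1` [set noise_theta p n]) = (p n)%:E;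
  noise_Ntheta_prob : forall n,
    P (Z n @^-1` [set - (noise_theta p n)^-1]) = (1 - p n)%:E;
  noise_independent : independent_RVs Z;
  noise_sigma : sigma_generated_by Z }.

(* The class of [f] if [f] is square-integrable, and 0 otherwise. *)
Definition L2of (f : T -> R[i]) : L2 P := L2class (insubd (0 : L2fun P) f).

Definition chaos Z s : L2 P := L2of (fun t => (\prod_(i <- s) Z i t)%:C%C).

Definition annihilation_operators Z (D : nat -> bop (L2 P)) := forall k s,
  D k (chaos Z s) = (k \in s)%:R *: chaos Z (s `\ k)%fset.

Definition number_operator Z : operator (L2 P) := Operator
  [set x | (\esum_(s in [set: {fset nat}])
     (#|` s|%:R ^+ 2 * cRe `|inner (chaos Z s) x| ^+ 2)%:E < +oo)%E]
  (fun x => sum (fun s => (#|` s|%:R * inner (chaos Z s) x) *: chaos Z s)).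

Definition weighted_number_series (w : nat -> nat -> R) (D : nat -> bop (L2 P))
    (x : L2 P) : nat -> L2 P :=
  square_sum (fun j k => (w j k)%:C%C *:
    (bop_adj (D k) \ob D j \ob bop_adj (D j) \ob D k) x).

Definition weighted_number_operator w D : operator (L2 P) := Operator
  [set x | cvgn (weighted_number_series w D x)]
  (fun x => limn (weighted_number_series w D x)).

Definition admissible w D (G : operator (L2 P)) :=
  let S := weighted_number_operator w D in
  [/\ densely_defined G, dom G = dom S, dom (adjoint G) = dom S &
      forall x, dom S x -> G x + adjoint G x = - S x].

Definition chaos_truncation Z (x : L2 P) (n : nat) : L2 P :=
  \sum_(s <- fpowerset [fset i in iota 0 n.+1]%fset)
    inner (chaos Z s) x *: chaos Z s.

Definition amenable Z (A : operator (L2 P)) := lspan (chaos Z) `<=` dom A /\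
  forall x, dom A x -> cvgn (fun n => A (chaos_truncation Z x n)).

(* For [x] in the span of the basis the summands of the series are nonnegative,
   so that [\esum] is its sum in [0, +oo]. *)
Definition number_dissipative Z (w : nat -> nat -> R) (D : nat -> bop (L2 P))
    (G : operator (L2 P)) (b : R) :=
  let N := number_operator Z in
  let L j k := bop_adj (D j) \ob D k in
  forall x, lspan (chaos Z) x ->
  ((2 * cRe (inner (N x) (G x)))%:E +
    \esum_(jk in [set: nat * nat]) (w jk.1 jk.2 *
      cRe (inner (L jk.1 jk.2 x) (N (L jk.1 jk.2 x))))%:E
   <= (b * cRe (inner x (N x)))%:E)%E.

End bernoulli_noise.

(* Main.v *)
(** Put X_r = 1 - T_r(1), so that 0 <= X_r <= 1, and x_r(u) = <u, X_r u>.
    Write L_jk = d_j^* d_k.  As G + G^* = - S_w, the equation of the QDS says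
      x_r'(u) = 2 Re <X_r u, G u> + sum_jk w(j,k) x_r(L_jk u),  x_0 = 0,
    for u in Dom G, and x_r vanishes by a maximum principle.  Let n be the
    quadratic form of the number operator and a(r) = eps (1 + lam r), and
    suppose that x_r <= mu |.|^2 + a(r) n for r <= t0.  For u in Dom G the
    function
      s |-> x_{t-s}(P_s u) - mu' |P_s u|^2 - a(t-s) n(P_s u)
    is then nondecreasing as soon as mu - mu' <= eps / c, where c bounds the
    column sums of w: this uses hypothesis (3), and <u, S_w u> <= c n(u).  It is
    nonpositive at s = t, hence at s = 0, so mu can be replaced by mu'.  Starting
    from mu = 1 one reaches mu = 0 after finitely many steps, and letting eps go
    to 0 gives X_r = 0 for r <= t0, whence for all r by the semigroup property.

    Regularity of w gives n(u) <= C |u| |G u| on Dom G, so that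
    n(P_h u - u) = o(h) as h -> 0; therefore n(P_s u) is differentiable from the
    right for every u in Dom G, and no closed graph argument is needed. *)
From HB Require Import structures.
Require Import Defs.
From mathcomp Require Import all_boot all_order all_algebra finmap.
From mathcomp Require Import complex ring lra.
From mathcomp Require Import all_classical all_reals all_analysis.
From mathcomp Require Import measurable_realfun summability.

Set Implicit Arguments.
Unset Strict Implicit.
Unset Printing Implicit Defensive.
Import Order.TTheory GRing.Theory Num.Theory numFieldNormedType.Exports.

Local Open Scope classical_set_scope.
Local Open Scope ring_scope.

(** The number operator, S_w and the double series are replaced throughout by cutoffs: the bounded
    operators [number_op m] and [weighted_op n], diagonal in the chaos basis, and jump sums over
    finite squares. The quadratic forms concerned increase with the cutoff. Truncating the jump
    series of X_r costs at most the tail of <u, S_w u>, because X_r <= 1; a finite sum is moreover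
    continuous in r, which the whole series is not known to be.

    For this reason the function of s above is not differentiated: the cutoffs give lower bounds for
    its right increments, and a Dini argument concludes.

    The number of steps from mu = 1 to mu = 0 grows like c / eps, but each step keeps the same a(r),
    so the final bound a(r) n(u) <= 2 eps n(u) does not depend on it. Since L_jk u may lie outside
    Dom G, a step proved on Dom G is extended to all vectors with finite number form before the next
    one begins. *)

Section complex_parts_extra.
Context {R : realType}.
Implicit Types x y : R[i].

Lemma cReN x : cRe (- x) = - cRe x. Proof. by case: x. Qed.
Lemma cReB x y : cRe (x - y) = cRe x - cRe y.
Proof. by rewrite cReD cReN. Qed.
Lemma cRe_rM (a : R) x : cRe (a%:C%C * x) = a * cRe x.
Proof. by rewrite cReM /= mul0r subr0. Qed.
Lemma cRe_sum I (r : seq I) (Q : pred I) (F : I -> R[i]) :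
  cRe (\sum_(i <- r | Q i) F i) = \sum_(i <- r | Q i) cRe (F i).
Proof. by apply: (big_morph _ cReD). Qed.

Lemma conj_realC (a : R) : (a%:C%C)^* = a%:C%C.
Proof. by apply: cReIm_inj; rewrite ?cReJ ?cImJ /= ?oppr0. Qed.

Lemma cRe_norm_le x : `|cRe x|%:C%C <= `|x|.
Proof. exact: normc_ge_Re. Qed.

Lemma normrC_real (x : R[i]) : `|x| = (cRe `|x|)%:C%C.
Proof. by rewrite RRe_real// ger0_real. Qed.

Lemma gt0C (e : R[i]) : 0 < e -> e = (cRe e)%:C%C /\ 0 < cRe e.
Proof. by case: e => a b; rewrite ltcE/= => /andP[/eqP -> ->]. Qed.

Lemma ge0C (e : R[i]) : 0 <= e -> e = (cRe e)%:C%C /\ 0 <= cRe e.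
Proof. by case: e => a b; rewrite lecE/= => /andP[/eqP -> ->]. Qed.

End complex_parts_extra.

(** * Bounded operators on complex inner product spaces *)

Section real_inner_product.
Context {R : realType} {H : innerModType R}.
Implicit Types x y z : H.

(** [inner] and the norm take values in R[i], which is only partially ordered. Their real parts make
    H a real inner product space, where estimates are inequalities in R. *)
Definition rdot x y : R := cRe (inner x y).
Definition nr x : R := cRe `|x|.

Lemma normE x : `|x| = (nr x)%:C%C.
Proof. by have [] := ge0C (normr_ge0 x). Qed.
Lemma nr_ge0 x : 0 <= nr x.
Proof. by have [] := ge0C (normr_ge0 x). Qed.

Lemma rdotC x y : rdot x y = rdot y x.
Proof. by rewrite /rdot innerC cReJ. Qed.
Lemma rdotDr x y z : rdot x (y + z) = rdot x y + rdot x z.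
Proof. by rewrite /rdot innerDr cReD. Qed.
Lemma rdotDl x y z : rdot (x + y) z = rdot x z + rdot y z.
Proof. by rewrite rdotC rdotDr !(rdotC z). Qed.
Lemma innerDl x y z : inner (x + y) z = inner x z + inner y z.
Proof. by rewrite innerC innerDr rmorphD /= -!innerC. Qed.
Lemma innerZl a x y : inner (a *: x) y = a^* * inner x y.
Proof. by rewrite innerC innerZr rmorphM /= -innerC. Qed.
Lemma inner0r x : inner x 0 = 0.
Proof. by rewrite -(scale0r 0) innerZr mul0r. Qed.
Lemma inner0l x : inner 0 x = 0.
Proof. by rewrite innerC inner0r rmorph0. Qed.
Lemma innerNr x y : inner x (- y) = - inner x y.
Proof. by rewrite -scaleN1r innerZr mulN1r. Qed.
Lemma innerBr x y z : inner x (y - z) = inner x y - inner x z.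
Proof. by rewrite innerDr innerNr. Qed.
Lemma inner_sumr I (r : seq I) (Q : pred I) (F : I -> H) x :
  inner x (\sum_(i <- r | Q i) F i) = \sum_(i <- r | Q i) inner x (F i).
Proof. by apply: (big_morph _ (innerDr x) (inner0r x)). Qed.
Lemma inner_suml I (r : seq I) (Q : pred I) (F : I -> H) x :
  inner (\sum_(i <- r | Q i) F i) x = \sum_(i <- r | Q i) inner (F i) x.
Proof.
by apply: (big_morph (inner^~ x) _ (inner0l x)) => y z; rewrite innerDl.
Qed.
Lemma rdot_sumr I (r : seq I) (Q : pred I) (F : I -> H) x :
  rdot x (\sum_(i <- r | Q i) F i) = \sum_(i <- r | Q i) rdot x (F i).
Proof. by rewrite /rdot inner_sumr cRe_sum. Qed.
Lemma rdot0r x : rdot x 0 = 0.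
Proof. by rewrite /rdot inner0r. Qed.
Lemma rdotZr (a : R) x y : rdot x (a%:C%C *: y) = a * rdot x y.
Proof. by rewrite /rdot innerZr cRe_rM. Qed.
Lemma rdotZl (a : R) x y : rdot (a%:C%C *: x) y = a * rdot x y.
Proof. by rewrite rdotC rdotZr rdotC. Qed.
Lemma rdotNr x y : rdot x (- y) = - rdot x y.
Proof. by rewrite /rdot innerNr cReN. Qed.
Lemma rdotNl x y : rdot (- x) y = - rdot x y.
Proof. by rewrite rdotC rdotNr rdotC. Qed.
Lemma rdotBr x y z : rdot x (y - z) = rdot x y - rdot x z.
Proof. by rewrite rdotDr rdotNr. Qed.
Lemma rdotBl x y z : rdot (x - y) z = rdot x z - rdot y z.
Proof. by rewrite rdotDl rdotNl. Qed.

Lemma rdot_nr x : rdot x x = nr x ^+ 2.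
Proof.
rewrite /rdot inner_norm normE.
by rewrite !expr2 cReM /= mul0r subr0.
Qed.

Lemma nr_eq0 x : nr x = 0 -> x = 0.
Proof. by move=> x0; apply/eqP; rewrite -normr_eq0 normE x0. Qed.

Lemma nr0 : nr 0 = 0 :> R. Proof. by rewrite /nr normr0. Qed.
Lemma nrN x : nr (- x) = nr x. Proof. by rewrite /nr normrN. Qed.
Lemma nrB x y : nr (x - y) = nr (y - x). Proof. by rewrite /nr distrC. Qed.
Lemma nrD x y : nr (x + y) <= nr x + nr y.
Proof.
have := ler_normD x y.
by rewrite !normE -!raddfD/= lecR.
Qed.
Lemma nrZ a x : nr (a *: x) = cRe `|a| * nr x.
Proof. by rewrite /nr normrZ normE normrC_real cRe_rM. Qed.
Lemma nrZr (a : R) x : nr (a%:C%C *: x) = `|a| * nr x.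
Proof. by rewrite nrZ normc_def /= expr0n /= addr0 sqrtr_sqr. Qed.

Lemma nr_sq_expand x y : nr (x + y) ^+ 2 = nr x ^+ 2 + 2 * rdot x y + nr y ^+ 2.
Proof. by rewrite -!rdot_nr rdotDr !rdotDl (rdotC y x); ring. Qed.

Lemma rdot_sq_le x y : rdot x y ^+ 2 <= nr x ^+ 2 * nr y ^+ 2.
Proof.
have [y0|y0] := eqVneq (nr y) 0.
  by rewrite (nr_eq0 y0) rdot0r nr0 expr0n /= mulr0.
have yp : 0 < nr y ^+ 2 by rewrite exprn_gt0// lt_def y0 nr_ge0.
have := sqr_ge0 (nr (x + (- (rdot x y / nr y ^+ 2))%:C%C *: y)).
rewrite nr_sq_expand rdotZr nrZr exprMn -normrX ger0_norm ?sqr_ge0//.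
have -> : nr x ^+ 2 + 2 * (- (rdot x y / nr y ^+ 2) * rdot x y) +
  (- (rdot x y / nr y ^+ 2)) ^+ 2 * nr y ^+ 2 =
  nr x ^+ 2 - rdot x y ^+ 2 / nr y ^+ 2 by field.
by rewrite subr_ge0 ler_pdivrMr.
Qed.

Lemma rdot_le x y : `|rdot x y| <= nr x * nr y.
Proof.
rewrite -(@ler_pXn2r _ 2)// ?nnegrE ?normr_ge0 ?mulr_ge0 ?nr_ge0//.
by rewrite exprMn -normrX ger0_norm ?sqr_ge0// rdot_sq_le.
Qed.

Lemma nr_cvgP (U : Type) (F : set_system U) {FF : Filter F} (f : U -> H) y :
  (f x @[x --> F] --> y) <->
  (forall e : R, 0 < e -> \forall x \near F, nr (f x - y) < e).
Proof.
split=> [/cvgrPdist_lt h e e0|h].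
  have := h e%:C%C; rewrite ltcR => /(_ e0); apply: filterS => x.
  by rewrite distrC normE ltcR.
apply/cvgrPdist_lt => e /gt0C[-> e0].
by apply: filterS (h _ e0) => x; rewrite distrC normE ltcR.
Qed.

Lemma dense_nr (A : set H) : dense A ->
  forall x (e : R), 0 < e -> exists2 y, A y & nr (x - y) < e.
Proof.
move=> Ad x e e0.
have e0' : (0 : R[i]) < e%:C%C by rewrite ltcR.
have [||y [yb Ay]] := Ad (ball x e%:C%C).
- by exists x; exact: ballxx.
- exact: ball_open.
- exists y => //.
  by move: yb; rewrite -ball_normE /= normE ltcR.
Qed.

Lemma nr_dense (A : set H) :
  (forall x (e : R), 0 < e -> exists2 y, A y & nr (x - y) < e) -> dense A.
Proof.
move=> h O [x Ox] oO.
have /nbhs_ballP[e /= /gt0C[eE e0] eO] : nbhs x O by exact: open_nbhs_nbhs.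
have [y Ay xy] := h x _ e0; exists y; split => //; apply: eO.
by rewrite -ball_normE /= normE eE ltcR.
Qed.

Lemma inner_ext x y : (forall z, rdot z x = rdot z y) -> x = y.
Proof.
move=> h; apply/eqP; rewrite -subr_eq0; apply/eqP/nr_eq0/eqP.
by rewrite -sqrf_eq0 -rdot_nr rdotBr h subrr.
Qed.

Lemma dense_ext (A : set H) x y : dense A -> (forall z, A z -> rdot z x = rdot z y) ->
  x = y.
Proof.
move=> Ad h; apply/eqP; rewrite -subr_eq0; apply/eqP/nr_eq0/eqP.
set v := x - y; rewrite eq_le nr_ge0 andbT leNgt; apply/negP => v0.
have [z Az zv] := dense_nr Ad v v0.
have zv0 : rdot z v = 0 by rewrite /v rdotBr h// subrr.
have : nr v ^+ 2 <= nr (v - z) * nr v.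
  by rewrite -rdot_nr -[rdot v v]subr0 -zv0 -rdotBl (le_trans (ler_norm _))// rdot_le.
by rewrite expr2 ler_pM2r// leNgt zv.
Qed.

End real_inner_product.

Section bop_theory.
Context {R : realType} {H : innerModType R}.
Implicit Types (A B : bop H) (x y z : H).

Lemma bop_linear A : linear A.
Proof. by have /asboolP[] := bop_valP A. Qed.
Lemma bopD A x y : A (x + y) = A x + A y.
Proof. by have := bop_linear A 1 x y; rewrite !scale1r. Qed.
Lemma bop0 A : A 0 = 0.
Proof. by apply: (addrI (A 0)); rewrite -bopD !addr0. Qed.
Lemma bopZ A a x : A (a *: x) = a *: A x.
Proof. by have := bop_linear A a x 0; rewrite !addr0 bop0 addr0. Qed.
Lemma bopN A x : A (- x) = - A x.
Proof. by rewrite -scaleN1r bopZ scaleN1r. Qed.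
Lemma bopB A x y : A (x - y) = A x - A y.
Proof. by rewrite bopD bopN. Qed.
Lemma bop_sumr A I (r : seq I) (Q : pred I) (F : I -> H) :
  A (\sum_(i <- r | Q i) F i) = \sum_(i <- r | Q i) A (F i).
Proof. by apply: (big_morph _ (bopD A) (bop0 A)). Qed.

Lemma bop_bounded A : exists2 M : R, 0 <= M & forall x, nr (A x) <= M * nr x.
Proof.
have /asboolP[_ [M /ge0C[-> M0] AM]] := bop_valP A; exists (cRe M) => // x.
by have := AM x; rewrite !normE -rmorphM /= lecR.
Qed.

Lemma bop_scaleE a A x : (a *: A) x = a *: A x. Proof. by []. Qed.
Lemma bop_subE A B x : (A - B) x = A x - B x. Proof. by []. Qed.
Lemma bop_sumE I (r : seq I) (Q : pred I) (F : I -> bop H) x :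
  (\sum_(i <- r | Q i) F i) x = \sum_(i <- r | Q i) F i x.
Proof. by apply: (big_morph (fun A : bop H => A x)). Qed.

(** With B = 0 this extends an identity from a dense set; with diagonal A and B it extends a
    comparison of eigenvalues. *)
Lemma bop_dense_le (V : set H) A B : dense V ->
  (forall x, V x -> nr (A x) <= nr (B x)) -> forall x, nr (A x) <= nr (B x).
Proof.
move=> Vd AB x; apply/ler_addgt0Pr => e e0.
have [M M0 AM] := bop_bounded A; have [N N0 BN] := bop_bounded B.
have MN : 0 < M + N + 1 by lra.
have [y Vy xy] := dense_nr Vd x (divr_gt0 e0 MN).
have h1 : nr (A x) <= nr (A y) + nr (A (x - y)).
  have -> : A x = A y + A (x - y) by rewrite -bopD addrC subrK.
  exact: nrD.
have h2 : nr (B y) <= nr (B x) + nr (B (x - y)).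
  have -> : B y = B x - B (x - y) by rewrite -bopB subKr.
  by rewrite (le_trans (nrD _ _))// nrN.
have h3 : nr (A (x - y)) + nr (B (x - y)) <= (M + N + 1) * nr (x - y).
  have := AM (x - y); have := BN (x - y); have := nr_ge0 (x - y); lra.
move: xy; rewrite ltr_pdivlMr// mulrC => xy.
have := AB _ Vy; lra.
Qed.

Lemma bop_ext A B : (forall x, A x = B x) -> A = B.
Proof. by move=> h; apply/val_inj/funext. Qed.

Lemma bop_dense_ext (I : Type) (e : I -> H) A B : dense (lspan e) ->
  (forall i, A (e i) = B (e i)) -> A = B.
Proof.
move=> ed AB; apply: bop_ext => x.
apply/eqP; rewrite -subr_eq0 -bop_subE; apply/eqP/nr_eq0/eqP.
rewrite eq_le nr_ge0 andbT.
suff h : forall y, lspan e y -> nr ((A - B) y) <= nr ((0 : bop H) y).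
  by apply: le_trans (bop_dense_le ed h x) _; rewrite -[(0 : bop H) x]/(0 : H) nr0.
have AB0 i : (A - B) (e i) = 0 by rewrite bop_subE AB subrr.
move=> _ [s [c ->]]; rewrite bop_sumr big1 ?nr0 ?nr_ge0// => i _.
by rewrite bopZ [X in _ *: X]AB0 scaler0.
Qed.

Definition is_adj A B := forall x y, inner x (A y) = inner (B x) y.

Lemma is_adj_uniq A B C : is_adj A B -> is_adj A C -> B = C.
Proof.
move=> AB AC; apply: bop_ext => x; apply: inner_ext => z.
by rewrite rdotC /rdot -AB AC -/(rdot _ _) rdotC.
Qed.

(** [bop_adj] is a choice with default 0, so it is an adjoint only once some adjoint has been
    exhibited. *)
Lemma bop_adjP A B : is_adj A B -> bop_adj A = B.
Proof.
move=> AB; apply: (@is_adj_uniq A) => //.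
by rewrite /bop_adj; apply: xgetPex; exists B.
Qed.

Lemma is_adj_sym A B : is_adj A B -> is_adj B A.
Proof. by move=> h x y; rewrite innerC -h -innerC. Qed.

Lemma is_adj_rdot A B x y : is_adj A B -> rdot x (A y) = rdot (B x) y.
Proof. by move=> h; rewrite /rdot h. Qed.

Lemma is_adj_lspan (I : Type) (e : I -> H) A B : dense (lspan e) ->
  (forall i j, inner (e i) (A (e j)) = inner (B (e i)) (e j)) -> is_adj A B.
Proof.
move=> ed AB.
have [M M0 AM] := bop_bounded A; have [N N0 BN] := bop_bounded B.
have hr x y : rdot x (A y) = rdot (B x) y.
  have hl u v : lspan e u -> lspan e v -> rdot u (A v) = rdot (B u) v.
    move=> [s [c ->]] [s' [c' ->]].
    rewrite /rdot !bop_sumr /= !inner_suml; congr cRe.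
    apply: eq_bigr => i _; rewrite !inner_sumr; apply: eq_bigr => j _.
    by rewrite !bopZ /= !innerZl !innerZr AB.
  apply/eqP; rewrite -subr_eq0 -normr_eq0 eq_le normr_ge0 andbT.
  apply/ler_addgt0Pr => eps eps0; rewrite add0r.
  (* If u and v are within d <= 1 of x and y, the four error terms below add up to at most d * K;
     the added ones keep K positive. *)
  set K := (M + N + 1) * (nr x + nr y + 1) + 1.
  have K0 : 0 < K.
    rewrite ltr_wpDl//; have := nr_ge0 x; have := nr_ge0 y => ? ?.
    by rewrite mulr_ge0//; lra.
  pose d := Num.min 1 (eps / K).
  have d0 : 0 < d by rewrite lt_min ltr01 divr_gt0.
  have [u eu ux] := dense_nr ed x d0; have [v ev vy] := dense_nr ed y d0.
  have -> : rdot x (A y) - rdot (B x) y =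
     rdot (x - u) (A y) + rdot u (A (y - v)) - (rdot (B (x - u)) y +
       rdot (B u) (y - v)).
    rewrite !bopB /= !rdotBl !rdotBr (hl u v)//; ring.
  have d1 : d <= 1 by rewrite ge_min lexx.
  have dK : d * K <= eps by rewrite -ler_pdivlMr// ge_min lexx orbT.
  have nu : nr u <= nr x + 1.
    rewrite -{1}(subKr x u); apply: le_trans (nrD _ _) _; rewrite nrN; lra.
  have a1 := rdot_le (x - u) (A y); have a2 := rdot_le u (A (y - v)).
  have a3 := rdot_le (B (x - u)) y; have a4 := rdot_le (B u) (y - v).
  have b1 : nr (x - u) * nr (A y) <= d * (M * nr y) by rewrite ler_pM ?nr_ge0// ltW.
  have b2 : nr u * nr (A (y - v)) <= (nr x + 1) * (M * d).
    by rewrite ler_pM ?nr_ge0// (le_trans (AM _))// ler_wpM2l// ltW.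
  have b3 : nr (B (x - u)) * nr y <= (N * d) * nr y.
    by rewrite ler_wpM2r ?nr_ge0// (le_trans (BN _))// ler_wpM2l// ltW.
  have b4 : nr (B u) * nr (y - v) <= (N * (nr x + 1)) * d.
    apply: ler_pM; rewrite ?nr_ge0//; last exact: ltW.
    by rewrite (le_trans (BN _))// ler_wpM2l.
  have : d * (M * nr y) + (nr x + 1) * (M * d) + (N * d) * nr y + (N * (nr x + 1)) * d
    <= d * K.
    rewrite /K; have := nr_ge0 x; have := nr_ge0 y => y0 x0.
    have -> : d * (M * nr y) + (nr x + 1) * (M * d) + (N * d) * nr y + (N * (nr x +
      1)) * d
     = d * ((M + N) * (nr x + nr y + 1)) by ring.
    rewrite ler_pM2l// mulrDl (mulrDl (M + N) 1); lra.
  move: a1 a2 a3 a4; rewrite !ler_norml => /andP[? ?] /andP[? ?] /andP[? ?] /andP[?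
    ?] ?.
  by apply/andP; split; lra.
move=> x y; apply: cReIm_inj; first exact: hr.
(* The real identity at i y is the identity of the imaginary parts at y. *)
have := hr x ('i%C *: y); rewrite bopZ /= /rdot !innerZr.
rewrite !cReM /= !mul0r !mul1r !sub0r => /eqP.
by rewrite eqr_opp => /eqP.
Qed.

(* Testing on i *: y recovers the imaginary part. *)
Lemma ge0_rdot_sym A : bop_ge0 A -> forall x y, rdot x (A y) = rdot (A x) y.
Proof.
move=> A0 x y.
have im0 z : cIm (inner z (A z)) = 0.
  by have := A0 z; rewrite lecE /= => /andP[/eqP <-].
have := im0 (x + 'i%C *: y); rewrite bopD bopZ !innerDr !innerDl !innerZr !innerZl.
rewrite [rdot (A x) y]rdotC /rdot.
have := im0 x; have := im0 y.
move: (inner x (A x)) (inner y (A y)) (inner x (A y)) (inner y (A x)).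
move=> [a a'] [b b'] [c c'] [d d'] /= -> -> /eqP.
move=> /eqP h; lra.
Qed.

End bop_theory.

Section span.
Context {R : realType} {H : innerModType R} (I : choiceType) (e : I -> H).

(** A sequence may repeat an index. Collecting coefficients over a finite set makes representations
    additive and lets orthonormality read them off. *)
Lemma lspan_fset x : lspan e x -> exists (A : {fset I}) (c : I -> R[i]),
  (forall i, i \notin A -> c i = 0) /\ x = \sum_(i <- A) c i *: e i.
Proof.
move=> [s [c ->]]; elim: s => [|a s [A [c' [c'0 IH]]]].
  by exists fset0, (fun=> 0); split=> //; rewrite big_nil big_seq_fset0.
exists (a |` A)%fset, (fun i => c' i + (if i == a then c a else 0)).
split=> [i|].
  by rewrite !inE negb_or => /andP[/negbTE -> /c'0 ->]; rewrite addr0.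
rewrite big_cons IH.
under [RHS]eq_bigr do rewrite scalerDl.
rewrite big_split /= addrC; congr (_ + _); last first.
  apply: big_fset_incl; first exact: fsubsetUr.
  by move=> i _ iA; rewrite c'0// scale0r.
rewrite (big_fsetD1 a) ?inE ?eqxx//= big_seq big1 ?addr0// => i.
by rewrite !inE => /andP[/negbTE -> _]; rewrite scale0r.
Qed.

Lemma fset_lspan (A : {fset I}) (c : I -> R[i]) :
  lspan e (\sum_(i <- A) c i *: e i).
Proof. by exists (enum_fset A), c. Qed.

Lemma lspan_base i : lspan e (e i).
Proof. by exists [:: i], (fun=> 1); rewrite big_seq1 scale1r. Qed.

Lemma lspan0 : lspan e 0.
Proof. by exists [::], (fun=> 0); rewrite big_nil. Qed.

Lemma lspanZ a x : lspan e x -> lspan e (a *: x).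
Proof.
move=> [s [c ->]]; exists s, (fun i => a * c i).
by rewrite scaler_sumr; apply: eq_bigr => i _; rewrite scalerA.
Qed.

Lemma lspanD x y : lspan e x -> lspan e y -> lspan e (x + y).
Proof.
move=> /lspan_fset[A [c [c0 ->]]] /lspan_fset[B [b [b0 ->]]].
rewrite (@big_fset_incl _ _ _ _ A (A `|` B)%fset) ?fsubsetUl//; last first.
  by move=> i _ iA; rewrite c0// scale0r.
rewrite (@big_fset_incl _ _ _ _ B (A `|` B)%fset) ?fsubsetUr//; last first.
  by move=> i _ iA; rewrite b0// scale0r.
rewrite -big_split /=; under eq_bigr do rewrite -scalerDl.
exact: fset_lspan.
Qed.

Lemma lspan_sum J (s : seq J) (Q : pred J) (F : J -> H) :
  (forall j, Q j -> lspan e (F j)) -> lspan e (\sum_(j <- s | Q j) F j).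
Proof.
by move=> h; apply: (big_ind (lspan e)) => //; [exact: lspan0|exact: lspanD].
Qed.

Lemma lspan_bop (A : bop H) : (forall i, lspan e (A (e i))) ->
  forall x, lspan e x -> lspan e (A x).
Proof.
move=> h x [s [c ->]]; rewrite bop_sumr; apply: lspan_sum => i _.
by rewrite bopZ; exact: lspanZ.
Qed.

Definition span_closure : set H :=
  [set x | forall r : R, 0 < r -> exists2 y, lspan e y & nr (x - y) < r].

Lemma span_closure_lim x :
  (forall r : R, 0 < r -> exists2 y, span_closure y & nr (x - y) < r) ->
  span_closure x.
Proof.
move=> h r r0; have r2 : 0 < r / 2 by rewrite divr_gt0.
have [y Vy xy] := h _ r2; have [z ez yz] := Vy _ r2; exists z => //.
by rewrite -(subrK y x) -addrA (le_lt_trans (nrD _ _))//; lra.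
Qed.

Lemma span_closureW x : lspan e x -> span_closure x.
Proof. by move=> ex r r0; exists x => //; rewrite subrr nr0. Qed.

Lemma span_closureD x y : span_closure x -> span_closure y -> span_closure (x + y).
Proof.
move=> Vx Vy r r0; have r2 : 0 < r / 2 by rewrite divr_gt0.
have [u eu xu] := Vx _ r2; have [v ev yv] := Vy _ r2.
exists (u + v); first exact: lspanD.
rewrite opprD addrACA (le_lt_trans (nrD _ _))//; lra.
Qed.

Lemma span_closure_bop (A : bop H) : (forall i, lspan e (A (e i))) ->
  forall x, span_closure x -> span_closure (A x).
Proof.
move=> h x Vx r r0; have [M M0 AM] := bop_bounded A.
have M1 : 0 < M + 1 by lra.
have [y ey xy] := Vx _ (divr_gt0 r0 M1); exists (A y); first exact: lspan_bop.
rewrite -bopB (le_lt_trans (AM _))//; move: xy; rewrite ltr_pdivlMr//.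
have := nr_ge0 (x - y); lra.
Qed.

Lemma span_closureZ a x : span_closure x -> span_closure (a *: x).
Proof.
move=> Vx; have := @span_closure_bop (a *: bop1) _ x Vx; apply=> i.
by rewrite bop_scaleE; exact/lspanZ/lspan_base.
Qed.

End span.

(** * The chaos basis of L^2 *)

Section square_integrable.
Context d (T : measurableType d) (R : realType) (P : probability T R).
Implicit Types f g : T -> R.

Lemma Lfun2_measurable f : f \in Lfun P 2%:E -> measurable_fun setT f.
Proof. by rewrite inE => /andP[/[!inE]/=]. Qed.

Lemma Lfun2P f : measurable_fun setT f ->
  P.-integrable setT (EFin \o (fun t => f t ^+ 2)) -> f \in Lfun P 2%:E.
Proof.
move=> mf /integrableP[_ fi]; rewrite inE; apply/andP; split; rewrite inE//=.
rewrite /finite_norm unlock poweR_lty//; apply: le_lt_trans fi.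
rewrite le_eqVlt; apply/orP; left; apply/eqP/eq_integral => t _ /=.
by rewrite powR_mulrn// -normrX.
Qed.

Lemma Lfun2_le f g : measurable_fun setT f -> g \in Lfun P 2%:E ->
  (forall t, `|f t| <= `|g t|) -> f \in Lfun P 2%:E.
Proof.
move=> mf gL fg; apply: Lfun2P => //.
apply: le_integrable (Lfun2_integrable_sqr gL) => //.
  by apply/measurable_EFinP; exact: measurable_funX.
move=> t _; rewrite /= lee_fin !normrX ler_pXn2r// ?nnegrE//.
Qed.

Lemma Lfun2_mulr (m f : T -> R) (K : R) : measurable_fun setT m ->
  (forall t, `|m t| <= K) -> f \in Lfun P 2%:E -> m \* f \in Lfun P 2%:E.
Proof.
move=> mm mK fL.
have fK : K \*o f \in Lfun P 2%:E.
  have := @Lfun_scale _ _ _ P f K 2 _ fL.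
  rewrite (_ : K \o* f = K \*o f); first by apply; rewrite ler1n.
  by apply/funext => t /=; rewrite mulrC.
apply: Lfun2_le fK _.
  by apply: measurable_funM => //; exact: Lfun2_measurable.
move=> t /=; rewrite !normrM ler_wpM2r//.
by rewrite (le_trans (mK t))// ler_norm.
Qed.

Lemma Lfun2_bounded f (K : R) : measurable_fun setT f -> (forall t, `|f t| <= K) ->
  f \in Lfun P 2%:E.
Proof.
move=> mf fK; apply: (@Lfun2_le f (cst K)) => //; first exact: Lfun_cst.
by move=> t; rewrite (le_trans (fK t))// ler_norm.
Qed.

Lemma Lfun2_mul_integrable f g : f \in Lfun P 2%:E -> g \in Lfun P 2%:E ->
  P.-integrable setT (EFin \o (fun t => f t * g t)).
Proof. by move=> fL gL; exact/Lfun1_integrable/Lfun2_mul_Lfun1. Qed.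

Lemma Lfun2D f g : f \in Lfun P 2%:E -> g \in Lfun P 2%:E ->
  f \+ g \in Lfun P 2%:E.
Proof.
move=> fL gL; have [F0 FZD] := @Lfun_submod_closed _ _ R P 2%:E (lee1n 2).
by have := FZD 1 f g fL gL; rewrite scale1r.
Qed.

Lemma Lfun2Z (a : R) f : f \in Lfun P 2%:E -> a \*o f \in Lfun P 2%:E.
Proof.
move=> fL; have [F0 FZD] := @Lfun_submod_closed _ _ R P 2%:E (lee1n 2).
by have := FZD a f 0 fL F0; rewrite addr0.
Qed.

Lemma L2r_mem f : f \in Lfun P 2%:E -> (fun t => (f t)%:C%C) \in Lfun2C P.
Proof.
move=> fL; apply/andP; split; first exact: fL.
have [F0 _] := @Lfun_submod_closed _ _ R P 2%:E (lee1n 2); exact: F0.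
Qed.

(** Through [L2of] this is 0 unless f is square integrable, whence the membership hypotheses of the
    laws below. *)
Definition L2r f : L2 P := L2of P (fun t => (f t)%:C%C).

Lemma L2rE f (fL : f \in Lfun P 2%:E) : L2r f = L2class (MkL2fun (L2r_mem fL)).
Proof.
rewrite /L2r /L2of; congr L2class; apply: val_inj.
by rewrite val_insubd (L2r_mem fL).
Qed.

Lemma L2r_ae f g : f \in Lfun P 2%:E -> g \in Lfun P 2%:E ->
  {ae P, forall t, f t = g t} -> L2r f = L2r g.
Proof.
move=> fL gL fg; rewrite (L2rE fL) (L2rE gL); apply/L2class_eqP.
by apply: filterS fg => t /= ->.
Qed.

Lemma inner_L2r f g : f \in Lfun P 2%:E -> g \in Lfun P 2%:E ->
  inner (L2r f) (L2r g) = (\int[P]_t (f t * g t))%:C%C.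
Proof.
move=> fL gL; rewrite (L2rE fL) (L2rE gL).
rewrite [LHS]L2dot_class; apply: cReIm_inj => /=.
  by apply: eq_Rintegral => t _; rewrite oppr0 mul0r subr0.
rewrite (@eq_Rintegral _ _ _ _ _ (cst 0)) ?Rintegral_cst ?mul0r// => t _.
by rewrite /= oppr0 mul0r mulr0 addr0.
Qed.

Lemma L2rD f g : f \in Lfun P 2%:E -> g \in Lfun P 2%:E ->
  L2r (f \+ g) = L2r f + L2r g.
Proof.
move=> fL gL; rewrite (L2rE fL) (L2rE gL) (L2rE (Lfun2D fL gL)) -raddfD /=.
by congr L2class; apply: val_inj; apply/funext => t /=; rewrite -[RHS]rmorphD.
Qed.

Lemma L2rZ a f : f \in Lfun P 2%:E -> L2r (a \*o f) = a%:C%C *: L2r f.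
Proof.
move=> fL; rewrite (L2rE fL) (L2rE (Lfun2Z a fL)).
rewrite [RHS]L2scale_class.
by congr L2class; apply: val_inj; apply/funext => t /=; rewrite -[RHS]rmorphM.
Qed.

Lemma L2r_reim (x : L2 P) : exists f g, [/\ f \in Lfun P 2%:E, g \in Lfun P 2%:E &
  x = L2r f + 'i%C *: L2r g].
Proof.
have /andP[fL gL] := L2fun_valP (L2repr x).
exists (cRe \o L2repr x), (cIm \o L2repr x); split => //.
rewrite -[LHS]L2reprK (L2rE fL) (L2rE gL) [_ *: _]L2scale_class -raddfD /=.
congr L2class; apply: val_inj; apply/funext => t /=.
rewrite -[RHS]/((cRe (L2repr x t))%:C%C + 'i%C * (cIm (L2repr x t))%:C%C).
exact: complexE.
Qed.

(** Dominated convergence for the squares, with F^2 as dominating function. *)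
Lemma nr_L2r_cvg0 (u : nat -> T -> R) F : (forall n, u n \in Lfun P 2%:E) ->
  F \in Lfun P 2%:E -> (forall n t, `|u n t| <= `|F t|) ->
  (forall t, u n t @[n --> \oo] --> 0) ->
  forall e : R, 0 < e -> \forall n \near \oo, nr (L2r (u n)) < e.
Proof.
move=> uL FL uF u0 e e0.
have : (\int[P]_t ((u n t) ^+ 2)%:E)%E @[n --> \oo] --> (\int[P]_t (cst 0%E t))%E.
  have [] // := @dominated_convergence _ _ _ P setT measurableT
    (fun n t => ((u n t) ^+ 2)%:E) (cst 0%E) (fun t => (F t ^+ 2)%:E).
  - move=> n; apply/measurable_EFinP/measurable_funX; exact: Lfun2_measurable.
  - apply: aeW => t _; apply/fine_cvgP; split; first exact: nearW.
    by have := cvgM (u0 t) (u0 t); rewrite mulr0; apply.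
  - exact: Lfun2_integrable_sqr.
  - apply: aeW => t n _; rewrite lee_fin normrX -[leRHS]ger0_norm ?sqr_ge0//.
    by rewrite normrX ler_pXn2r ?nnegrE.
rewrite integral0 => /fine_cvgP[_ /cvgrPdist_lt /(_ (e ^+ 2))].
rewrite exprn_gt0// => /(_ isT); apply: filterS => n.
rewrite sub0r normrN => h.
rewrite -(@ltr_pXn2r _ 2) ?nnegrE ?nr_ge0 ?(ltW e0)//.
rewrite -rdot_nr /rdot inner_L2r//=; apply: le_lt_trans h.
apply: le_trans (ler_norm _).
by rewrite /Rintegral le_eqVlt; apply/orP; left; apply/eqP; congr fine;
  apply: eq_integral => t _; rewrite expr2.
Qed.

End square_integrable.

Section multiplication.
Context d (T : measurableType d) (R : realType) (P : probability T R).

Lemma Lfun2_ae (f g : T -> R) : measurable_fun setT f -> g \in Lfun P 2%:E ->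
  {ae P, forall t, f t = g t} -> f \in Lfun P 2%:E.
Proof.
move=> mf gL fg; apply: Lfun2P => //; apply/integrableP; split.
  by apply/measurable_EFinP; exact: measurable_funX.
have /integrableP[mg gi] := Lfun2_integrable_sqr gL.
apply: le_lt_trans gi; rewrite le_eqVlt; apply/orP; left; apply/eqP.
apply: ae_eq_integral => //.
- by apply: measurableT_comp => //; apply/measurable_EFinP; exact: measurable_funX.
- by apply: measurableT_comp.
- by apply: filterS fg => t /= -> _.
Qed.

Section mulop.
Variables (m : T -> R) (K : R).
Hypotheses (mm : measurable_fun setT m) (mK : forall t, `|m t| <= K).

Lemma mulfun_mem (f : L2fun P) : (fun t => (m t)%:C%C * f t) \in Lfun2C P.
Proof.
have /andP[fr fi] := L2fun_valP f; apply/andP; split.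
- rewrite (_ : _ \o _ = m \* (cRe \o f)); first exact: Lfun2_mulr mK _.
  by apply/funext => t /=; rewrite cRe_rM.
- rewrite (_ : _ \o _ = m \* (cIm \o f)); first exact: Lfun2_mulr mK _.
  by apply/funext => t; rewrite [LHS]cImM /= mul0r addr0.
Qed.

Definition mulfun (x : L2 P) : L2 P := L2class (MkL2fun (mulfun_mem (L2repr x))).

Lemma mulfun_class f : mulfun (L2class f) = L2class (MkL2fun (mulfun_mem f)).
Proof.
apply/L2class_eqP; apply: filterS (L2repr_class f) => t /= ->.
by [].
Qed.

Lemma mulfun_linear : linear mulfun.
Proof.
move=> a x y; rewrite -(L2reprK x) -(L2reprK y) [a *: _]L2scale_class -raddfD.
rewrite !mulfun_class [a *: _]L2scale_class -raddfD; congr L2class.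
apply: val_inj; apply/funext => t /=.
rewrite -[LHS]/((m t)%:C%C * (a * L2repr x t + L2repr y t)).
by rewrite mulrDr mulrCA.
Qed.

Lemma mulfun_L2r f : f \in Lfun P 2%:E -> mulfun (L2r P f) = L2r P (m \* f).
Proof.
move=> fL; rewrite (L2rE fL) (L2rE (Lfun2_mulr mm mK fL)) mulfun_class.
by congr L2class; apply: val_inj; apply/funext => t /=; rewrite rmorphM.
Qed.

Lemma mulfun_bounded : mulfun \in @bounded_op R (L2 P).
Proof.
apply/asboolP; split; first exact: mulfun_linear.
have [N N0 KN] : exists2 N : R, 0 <= N & forall t, `|m t| <= N.
  by exists `|K| => // t; rewrite (le_trans (mK t))// ler_norm.
have bnd f : f \in Lfun P 2%:E -> nr (L2r P (m \* f)) <= N * nr (L2r P f).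
  move=> fL; have mfL := Lfun2_mulr mm mK fL.
  rewrite -(@ler_pXn2r _ 2) ?nnegrE ?mulr_ge0 ?nr_ge0// exprMn -!rdot_nr.
  rewrite /rdot !inner_L2r//= -RintegralZl//; last exact: Lfun2_mul_integrable.
  apply: le_Rintegral => //.
  - exact: Lfun2_mul_integrable.
  - rewrite (_ : _ \o _ = EFin \o (fun t => ((N \*o f) t * (N \*o f) t))).
      by apply: Lfun2_mul_integrable; exact: Lfun2Z.
    by apply/funext => t /=; congr EFin; ring.
  move=> t _ /=; rewrite -!expr2 exprMn ler_wpM2r ?sqr_ge0//.
  by rewrite -(ger0_norm (sqr_ge0 (m t))) normrX ler_pXn2r ?nnegrE.
(* The factor 2 comes from treating f and i g separately: they are orthogonal for [rdot], so each
   has norm at most that of f + i g. *)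
exists (2 * N)%:C%C; first by rewrite lecR; lra.
move=> x; rewrite !normE -rmorphM lecR.
have [f [g [fL gL ->]]] := L2r_reim x.
have mN : mulfun (L2r P f + 'i%C *: L2r P g) = mulfun (L2r P f) +
  'i%C *: mulfun (L2r P g).
  rewrite addrC mulfun_linear addrC//.
rewrite mN !mulfun_L2r//; set F := L2r P f; set G := L2r P g.
have i1 : cRe `|'i%C : R[i]| = 1 by rewrite normc_def /= expr0n/= add0r expr1n sqrtr1.
have FG : rdot F ('i%C *: G) = 0.
  by rewrite /rdot innerZr inner_L2r// cReM /= mul0r mulr0 subr0.
have := nr_sq_expand F ('i%C *: G); rewrite FG mulr0 addr0 nrZ i1 mul1r => e.
have Fle : nr F <= nr (F + 'i%C *: G).
  by rewrite -(@ler_pXn2r _ 2) ?nnegrE ?nr_ge0// e lerDl sqr_ge0.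
have Gle : nr G <= nr (F + 'i%C *: G).
  by rewrite -(@ler_pXn2r _ 2) ?nnegrE ?nr_ge0// e lerDr sqr_ge0.
apply: le_trans (nrD _ _) _; rewrite nrZ i1 mul1r.
move: (ler_wpM2l N0 Fle) (ler_wpM2l N0 Gle) (bnd _ fL) (bnd _ gL); rewrite -/F -/G.
move: (nr F) (nr G) (nr (F + _)) (nr (L2r P (m \* f))) (nr (L2r P (m \* g))).
by move=> x1 x2 x3 x4 x5; lra.
Qed.

Definition mulop : bop (L2 P) := MkBop mulfun_bounded.

Lemma mulop_L2r f : f \in Lfun P 2%:E -> mulop (L2r P f) = L2r P (m \* f).
Proof. exact: mulfun_L2r. Qed.

End mulop.
End multiplication.

(** * The two-point noise and the multiplication by it *)

Section two_point_noise.
Context d (T : measurableType d) (R : realType) (P : probability T R).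
Variables (p : nat -> R) (Z : nat -> {RV P >-> R}).
Hypothesis noise : bernoulli_noise p Z.

Local Notation theta := (noise_theta p).

Lemma theta_gt0 i : 0 < theta i.
Proof.
have /andP[p0 p1] := noise_p noise i.
by rewrite /noise_theta sqrtr_gt0 divr_gt0// subr_gt0.
Qed.

Lemma theta_sq i : theta i ^+ 2 = (1 - p i) / p i.
Proof.
have /andP[p0 p1] := noise_p noise i.
by rewrite /noise_theta sqr_sqrtr// divr_ge0 ?subr_ge0// ltW.
Qed.

Definition up_event i : set T := Z i @^-1` [set theta i].

Lemma measurable_up_event i : measurable (up_event i).
Proof. exact: (measurable_funPTI (Z i) (measurable_set1 _)). Qed.

(* [Z i] almost surely, but taking only two values everywhere. *)
Definition bnoise i (t : T) : R :=
  - (theta i)^-1 + (theta i + (theta i)^-1) * \1_(up_event i) t.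

Lemma bnoiseE i t : bnoise i t = if t \in up_event i then theta i else - (theta i)^-1.
Proof.
rewrite /bnoise indicE; case: ifP => _; first by rewrite mulr1 addrC addrK.
by rewrite mulr0 addr0.
Qed.

Lemma measurable_bnoise i : measurable_fun setT (bnoise i).
Proof.
apply: measurable_funD => //; apply: measurable_funM => //.
exact/measurable_indic/measurable_up_event.
Qed.

Lemma bnoise_bounded i t : `|bnoise i t| <= theta i + (theta i)^-1.
Proof.
have t0 := theta_gt0 i; have t1 : 0 < (theta i)^-1 by rewrite invr_gt0.
by rewrite bnoiseE; case: ifP => _; rewrite ?normrN gtr0_norm//; lra.
Qed.

(** The values theta and -1/theta are the roots of X^2 - (theta - 1/theta) X - 1. Hence
    multiplication by the noise preserves the span of the chaos. *)
Lemma bnoise_sq i t : bnoise i t ^+ 2 = 1 + (theta i - (theta i)^-1) * bnoise i t.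
Proof.
have t0 := theta_gt0 i.
by rewrite bnoiseE; case: ifP => _; field; rewrite gt_eqF.
Qed.

(** The two atoms are disjoint, having opposite signs, and their masses p and 1 - p exhaust the
    probability. *)
Lemma Z_ae i : {ae P, forall t, Z i t = bnoise i t}.
Proof.
have t0 := theta_gt0 i; have t1 : 0 < (theta i)^-1 by rewrite invr_gt0.
pose B := Z i @^-1` [set - (theta i)^-1].
have mB : measurable B by exact: (measurable_funPTI (Z i) (measurable_set1 _)).
have mA := measurable_up_event i.
exists (~` (up_event i `|` B)); split.
- by apply: measurableC; exact: measurableU.
- rewrite probability_setC//; last exact: measurableU.
  have -> : P (up_event i `|` B) = (P (up_event i) + P B)%E.
    apply: measureU => //; apply/seteqP; split => // t [h1 h2].
    have {}h1 : Z i t = _ := h1; have {}h2 : Z i t = _ := h2.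
    by move: h1; rewrite h2 => h; exfalso; lra.
  rewrite (noise_theta_prob noise) (noise_Ntheta_prob noise).
  rewrite [X in (_ - X)%E](_ : _ = 1%E) ?subee//.
  by rewrite -EFinD; congr EFin; ring.
- move=> t /= h; apply: contra_not h => -[|] h; have {}h : Z i t = _ := h.
    by rewrite bnoiseE ifT//; apply/mem_set; exact: h.
  rewrite bnoiseE ifF//; apply/negbTE/negP => /set_mem h'; have {}h' : Z i t = _ := h'.
  by move: h; rewrite h' => h; lra.
Qed.

Definition bchaos (s : {fset nat}) (t : T) : R := \prod_(i <- s) bnoise i t.

Lemma prod_bounded (s : seq nat) (g : nat -> T -> R) (K : nat -> R) :
  (forall i t, `|g i t| <= K i) ->
    forall t, `|\prod_(i <- s) g i t| <= \prod_(i <- s) K i.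
Proof.
move=> gK t; elim: s => [|i s ih]; first by rewrite !big_nil normr1.
by rewrite !big_cons normrM ler_pM.
Qed.

Lemma bchaos_L2 s : bchaos s \in Lfun P 2%:E.
Proof.
apply: (@Lfun2_bounded _ _ _ _ _ (\prod_(i <- s) (theta i + (theta i)^-1))).
  by apply: measurable_prod => i _; exact: measurable_bnoise.
by apply: prod_bounded => i t; exact: bnoise_bounded.
Qed.

Lemma chaosE s : chaos Z s = L2r P (bchaos s).
Proof.
have zae : {ae P, forall t, \prod_(i <- s) Z i t = bchaos s t}.
  rewrite /bchaos; elim: (enum_fset s) => [|i l ih].
    by apply: aeW => t; rewrite !big_nil.
  apply: filterS2 ih (Z_ae i) => t h1 h2.
  by rewrite !big_cons h1 h2.
apply: L2r_ae (zae); last exact: bchaos_L2.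
apply: Lfun2_ae (zae); last exact: bchaos_L2.
exact: measurable_prod.
Qed.

Definition noise_mul i : bop (L2 P) := mulop P (measurable_bnoise i) (bnoise_bounded i).

Lemma noise_mul_chaos_notin i s : i \notin s ->
  noise_mul i (chaos Z s) = chaos Z (i |` s)%fset.
Proof.
move=> is_; rewrite !chaosE mulop_L2r ?bchaos_L2//; congr L2r.
by apply/funext => t; rewrite /bchaos big_fsetU1.
Qed.

Lemma noise_mul_chaos_in i s : i \in s -> noise_mul i (chaos Z s) =
  chaos Z (s `\ i)%fset + (theta i - (theta i)^-1)%:C%C *: chaos Z s.
Proof.
move=> is_; rewrite !chaosE mulop_L2r ?bchaos_L2// -L2rZ ?bchaos_L2//.
rewrite -L2rD ?bchaos_L2//; last exact/Lfun2Z/bchaos_L2.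
congr L2r; apply/funext => t /=.
have -> : bchaos s t = bnoise i t * bchaos (s `\ i)%fset t.
  by rewrite /bchaos (big_fsetD1 i).
by rewrite mulrA -expr2 bnoise_sq; ring.
Qed.

Lemma noise_mul_chaos_setD1 i s : i \in s ->
  noise_mul i (chaos Z (s `\ i)%fset) = chaos Z s.
Proof.
by move=> is_; rewrite noise_mul_chaos_notin ?fsetD1K// !inE eqxx.
Qed.

End two_point_noise.

(** * Orthonormality and density of the chaos, and the creation operators *)

Section chaos_basis.
Context d (T : measurableType d) (R : realType) (P : probability T R).
Variables (p : nat -> R) (Z : nat -> {RV P >-> R}).
Hypothesis noise : bernoulli_noise p Z.

Local Notation theta := (noise_theta p).
Local Notation up_event := (up_event p Z).
Local Notation bnoise := (bnoise p Z).
Local Notation bchaos := (bchaos p Z).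

Lemma prob_up_event (s : {fset nat}) : P (\bigcap_(i in [set` s]) up_event i) =
  (\prod_(i <- s) p i)%:E.
Proof.
rewrite (noise_independent noise s (fun i => measurable_set1 (theta i))).
by congr EFin; apply: eq_bigr => i _; rewrite (noise_theta_prob noise).
Qed.

Lemma bounded_integrable (f : T -> R) (K : R) : measurable_fun setT f ->
  (forall t, `|f t| <= K) -> P.-integrable setT (EFin \o f).
Proof.
move=> mf fK; apply/Lfun1_integrable/Lfun_subset12.
  by rewrite fin_num_measure.
exact: Lfun2_bounded fK.
Qed.

(* The event indexed by [r] is what makes the induction on [l] go through. *)
Lemma expectation_prod_affine (l : seq nat) (r : {fset nat}) (b c : nat -> R) :
  uniq l -> (forall i, i \in l -> i \notin r) ->
  \int[P]_t (\1_(\bigcap_(i in [set` r]) up_event i) t *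
     \prod_(i <- l) (b i + c i * \1_(up_event i) t)) =
  \prod_(i <- r) p i * \prod_(i <- l) (b i + c i * p i).
Proof.
have mr (s : {fset nat}) : measurable (\bigcap_(i in [set` s]) up_event i).
  by apply: fin_bigcap_measurable => [|i _];
    [exact: finite_fset|exact: measurable_up_event].
pose K l := \prod_(i <- l) (`|b i| + `|c i|).
pose F l t := \prod_(i <- l) (b i + c i * \1_(up_event i) t).
have mF k : measurable_fun setT (F k).
  apply: measurable_prod => i _; apply: measurable_funD => //.
  by apply: measurable_funM => //; exact/measurable_indic/measurable_up_event.
have ind1 (A : set T) t : `|\1_A t : R| <= 1.
  by rewrite indicE; case: (_ \in _); rewrite ?normr1 ?normr0.
have FK k t : `|F k t| <= K k.
  apply: (@prod_bounded _ _ _ k (fun i t => b i + c i * \1_(up_event i) t)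
    (fun i => `|b i| + `|c i|)) => i {}t.
  by apply: le_trans (ler_normD _ _) _; rewrite lerD2l normrM ler_piMr.
have iF (s : {fset nat}) k : P.-integrable setT
    (EFin \o (fun t => \1_(\bigcap_(i in [set` s]) up_event i) t * F k t)).
  apply: (@bounded_integrable _ (K k)).
    by apply: measurable_funM => //; exact/measurable_indic/mr.
  by move=> t; rewrite normrM -[leRHS]mul1r ler_pM.
elim: l r => [|k l ih] r.
  move=> _ _; rewrite big_nil mulr1.
  under eq_Rintegral do rewrite big_nil mulr1.
  rewrite /Rintegral integral_indic// setIT.
  exact: (congr1 fine (prob_up_event r)).
move=> /= /andP[kl ul] lr; rewrite big_cons.
have kr : k \notin r by apply: lr; rewrite mem_head.
have lr1 i : i \in l -> i \notin r by move=> il; apply: lr; rewrite inE il orbT.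
have lr2 i : i \in l -> i \notin (k |` r)%fset.
  by move=> il; rewrite !inE negb_or lr1// andbT; apply: contraNneq kl => <-.
have e t : \1_(\bigcap_(i in [set` r]) up_event i) t * \prod_(i <- k :: l) (b i +
  c i * \1_(up_event i) t)
  = b k * (\1_(\bigcap_(i in [set` r]) up_event i) t * F l t) +
    c k * (\1_(\bigcap_(i in [set` (k |` r)%fset]) up_event i) t * F l t).
  rewrite big_cons -/(F l t).
  have -> : \bigcap_(i in [set` (k |` r)%fset]) up_event i =
    up_event k `&` \bigcap_(i in [set` r]) up_event i.
    apply/seteqP; split => [x h|x [h1 h2] i /=].
      by split=> [|i ir]; apply: h; rewrite /= !inE ?eqxx// ir orbT.
    by rewrite !inE => /orP[/eqP ->//|]; exact: h2.
  by rewrite indicI /=; ring.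
under eq_Rintegral do rewrite e.
have iFZ a (s : {fset nat}) k' : P.-integrable setT
    (EFin \o (fun t => a * (\1_(\bigcap_(i in [set` s]) up_event i) t * F k' t))).
  by have := integrableZl measurableT a (iF s k'); apply: eq_integrable.
rewrite RintegralD// !RintegralZl// ih// ih//.
by rewrite big_fsetU1//=; ring.
Qed.

Lemma chaos_orthonormal s t : inner (chaos Z s) (chaos Z t) = (s == t)%:R.
Proof.
rewrite !(chaosE noise) inner_L2r ?bchaos_L2//.
(* [v] and [u] are the values of a factor on the up event and off it; [b] and [c] write the product
   of the two factors at i as an affine function of the indicator. *)
pose v (m : bool) i : R := if m then theta i else 1.
pose u (m : bool) i : R := if m then - (theta i)^-1 else 1.
pose b i := u (i \in s) i * u (i \in t) i.
pose c i := v (i \in s) i * v (i \in t) i - b i.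
have e x : bchaos s x * bchaos t x = \1_(\bigcap_(i in [set` fset0]) up_event i) x *
   \prod_(i <- (s `|` t)%fset) (b i + c i * \1_(up_event i) x).
  rewrite (_ : \bigcap_(i in _) _ = setT); last first.
    by apply/seteqP; split => // y _ i /=; rewrite inE.
  rewrite indicE in_setT mul1r /bchaos.
  have ext (a : {fset nat}) : (a `<=` s `|` t)%fset -> \prod_(i <- a) bnoise i x =
      \prod_(i <- (s `|` t)%fset) (if i \in a then bnoise i x else 1).
    move=> sub; rewrite -(big_fset_incl _ sub).
      by apply: eq_fbigr => i ia _; rewrite ia.
    by move=> i _ /negbTE ->.
  rewrite (ext s) ?fsubsetUl// (ext t) ?fsubsetUr// -big_split /=.
  apply: eq_bigr => i _; rewrite bnoiseE indicE /c /b /u /v.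
  by do 3 case: (_ \in _) => /=; ring.
under eq_Rintegral do rewrite e.
have n0 i : i \in (s `|` t)%fset -> i \notin (fset0 : {fset nat}) by rewrite inE.
rewrite (expectation_prod_affine _ _ (fset_uniq _) n0).
rewrite big_seq_fset0 mul1r.
(* This expectation is E[1] or E[Z_i^2], both 1, unless i lies in exactly one of s and t, when it is
   E[Z_i] = 0. Eliminating p in favour of theta makes the identity rational. *)
have be i : b i + c i * p i = ((i \in s) == (i \in t))%:R.
  have /andP[p0 p1] := noise_p noise i; have t0 := theta_gt0 noise i.
  have t2 := theta_sq noise i.
  have pE : p i = (theta i ^+ 2 + 1)^-1.
    rewrite [X in X^-1](_ : _ = (p i)^-1) ?invrK// t2.
    by field; rewrite gt_eqF.
  have t3 : theta i ^+ 2 + 1 != 0 by rewrite gt_eqF// ltr_pwDr// sqr_ge0.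
  rewrite /c /b /u /v; do 2 case: (_ \in _) => /=; rewrite pE; field;
    by rewrite ?t3 ?gt_eqF.
under eq_bigr do rewrite be.
rewrite -[RHS]/((s == t)%:R) (_ : (s == t)%:R = ((s == t)%:R : R)%:C%C); last first.
  by case: (s == t).
congr (_%:C%C).
have [<-|st] := eqVneq s t.
  by rewrite big1// => i _; rewrite eqxx.
have [i ist] : exists i, (i \in s) != (i \in t).
  apply: contrapT => h; move/eqP: st; apply; apply/fsetP => i.
  by apply: contrapT => /eqP hi; apply: h; exists i.
rewrite (big_fsetD1 i) /=; last first.
  by rewrite inE; move: ist; case: (i \in s); case: (i \in t).
by rewrite (negbTE ist) mul0r.
Qed.

Local Notation noise_mul := (noise_mul noise).
Local Notation V := (span_closure (chaos Z)).

Lemma lspan_noise_mul i s : lspan (chaos Z) (noise_mul i (chaos Z s)).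
Proof.
have [is_|is_] := boolP (i \in s).
  rewrite noise_mul_chaos_in//; apply: lspanD; first exact: lspan_base.
  exact/lspanZ/lspan_base.
by rewrite noise_mul_chaos_notin//; exact: lspan_base.
Qed.

(* Stable events form a sigma-algebra, so the density of the chaos needs no pi-system. *)
Definition stable_event (A : set T) := measurable A /\
  forall f, f \in Lfun P 2%:E -> V (L2r P f) -> V (L2r P (\1_A \* f)).

Lemma indic_le1 (A : set T) t : `|\1_A t : R| <= 1.
Proof. by rewrite indicE; case: (_ \in _); rewrite ?normr1 ?normr0. Qed.

Lemma indic_mul_L2 (A : set T) (f : T -> R) : measurable A ->
  f \in Lfun P 2%:E -> \1_A \* f \in Lfun P 2%:E.
Proof.
move=> mA; apply: (@Lfun2_mulr _ _ _ _ _ _ 1); first exact: measurable_indic.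
exact: indic_le1.
Qed.

Lemma stable_event_sigma_algebra : sigma_algebra setT stable_event.
Proof.
have st0 : stable_event set0.
  split; first exact: measurable0.
  move=> f fL Vf; rewrite (_ : _ \* _ = (0 : R) \*o f).
    by rewrite (L2rZ 0 fL); exact: span_closureZ.
  by apply/funext => t; rewrite /= indic0 /= !mul0r.
have stC A : stable_event A -> stable_event (~` A).
  move=> [mA hA]; split=> [|f fL Vf]; first exact: measurableC.
  rewrite (_ : _ \* _ = f \+ ((-1 : R) \*o (\1_A \* f))).
    have AL := indic_mul_L2 mA fL.
    rewrite (L2rD fL (Lfun2Z (-1) AL)) (L2rZ (-1) AL).
    by apply: span_closureD; [exact: Vf|apply: span_closureZ; exact: hA].
  apply/funext => t /=; rewrite !indicE in_setC.
  by case: (t \in A) => /=; ring.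
have stI A B : stable_event A -> stable_event B -> stable_event (A `&` B).
  move=> [mA hA] [mB hB]; split=> [|f fL Vf]; first exact: measurableI.
  rewrite indicI (_ : _ \* f = \1_A \* (\1_B \* f)).
    by apply: hA; [exact: indic_mul_L2|exact: hB].
  by apply/funext => t /=; rewrite mulrA.
have stU A B : stable_event A -> stable_event B -> stable_event (A `|` B).
  by move=> hA hB; rewrite -(setCK (A `|` B)) setCU; apply/stC/stI; exact: stC.
split; [exact: st0|by move=> A hA; rewrite setTD; exact: stC|move=> F hF].
pose A n := \big[setU/set0]_(i < n) F i.
have hA n : stable_event (A n).
  rewrite /A; elim/big_ind : _; [exact: st0|exact: stU|by move=> i _; exact: hF].
have mF : measurable (\bigcup_n F n) by apply: bigcup_measurable => n _; case: (hF n).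
split; first exact: mF.
move=> f fL Vf; apply: span_closure_lim => r r0.
(* The finite unions A n are stable, and this difference tends to 0 in L^2, being dominated by
   |f|. *)
pose u n t := \1_(\bigcup_n F n) t * f t - \1_(A n) t * f t.
have uE n : u n = (\1_(\bigcup_n F n) \* f) \+ ((-1 : R) \*o (\1_(A n) \* f)).
  by apply/funext => t /=; rewrite mulN1r.
have uL n : u n \in Lfun P 2%:E.
  rewrite uE; apply: Lfun2D; first exact: indic_mul_L2.
  by apply/Lfun2Z/indic_mul_L2 => //; case: (hA n).
have AF n t : A n t -> (\bigcup_n F n) t.
  by rewrite /A -bigcup_mkord => -[k _ Fk]; exists k.
have ufb n t : `|u n t| <= `|f t|.
  rewrite /u -mulrBl normrM ler_piMl// !indicE.
  have [tA|tA] := pselect (A n t).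
    by rewrite (mem_set tA) (mem_set (AF n t tA)) subrr normr0.
  rewrite (memNset tA) subr0; case: (_ \in _); rewrite ?normr1 ?normr0//.
have u0 t : u n t @[n --> \oo] --> 0.
  have [[k _ Fk]|nF] := pselect ((\bigcup_n F n) t).
    apply: cvg_near_cst; exists k.+1 => // n /= kn.
    rewrite /u -mulrBl !indicE (mem_set (_ : (\bigcup_n F n) t)); last by exists k.
    rewrite (mem_set (_ : A n t)) ?subrr ?mul0r//.
    by rewrite /A -bigcup_mkord; exists k.
  apply: cvg_near_cst; apply: nearW => n.
  by rewrite /u !indicE (memNset nF) memNset ?mul0r ?subr0// => /AF.
have := nr_L2r_cvg0 uL fL ufb u0 r0.
move=> [n _ /(_ n (leqnn n)) h]; exists (L2r P (\1_(A n) \* f)).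
  by case: (hA n) => _; apply.
have mA : measurable (A n) by case: (hA n).
move: h; rewrite uE L2rD; [|exact: indic_mul_L2|exact/Lfun2Z/indic_mul_L2].
by rewrite L2rZ ?indic_mul_L2// rmorphN1 scaleN1r.
Qed.

Lemma stable_event_generator i B : measurable B -> stable_event (Z i @^-1` B).
Proof.
move=> mB; split=> [|f fL Vf]; first exact: (measurable_funPTI (Z i) mB).
have t0 := theta_gt0 noise i; have t1 : 0 < (theta i)^-1 by rewrite invr_gt0.
pose x : R := \1_B (theta i); pose y : R := \1_B (- (theta i)^-1).
(* The line z |-> b + a z interpolates the indicator of B at theta and -1/theta; so almost surely
   the indicator of Z_i in B is b + a Z_i. *)
pose a := (x - y) / (theta i + (theta i)^-1); pose b := y + a * (theta i)^-1.
have zL : bnoise i \* f \in Lfun P 2%:E.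
  by apply: Lfun2_mulr (bnoise_bounded noise i) fL; exact: measurable_bnoise.
have -> : L2r P (\1_(Z i @^-1` B) \* f) = L2r P ((b \*o f) \+ (a \*o (bnoise i \* f))).
  apply: L2r_ae.
  - by apply: indic_mul_L2 => //; exact: (measurable_funPTI (Z i) mB).
  - by apply: Lfun2D; exact: Lfun2Z.
  apply: filterS (Z_ae noise i) => t /= Zt.
  have -> : \1_(Z i @^-1` B) t = \1_B (bnoise i t) :> R by rewrite -Zt.
  rewrite bnoiseE /b /a; case: ifP => _; rewrite -/x -/y; field;
    by rewrite !gt_eqF// ?addr_gt0 ?ltr_pwDr ?mulr_gt0.
rewrite (L2rD (Lfun2Z b fL) (Lfun2Z a zL)) (L2rZ b fL) (L2rZ a zL).
apply: span_closureD; apply: span_closureZ; first exact: Vf.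
rewrite -(mulop_L2r (measurable_bnoise p Z i) (bnoise_bounded noise i) fL).
by apply: span_closure_bop Vf => s; exact: lspan_noise_mul.
Qed.

Lemma stable_event_measurable A : measurable A -> stable_event A.
Proof.
move=> mA; have := noise_sigma noise mA; apply.
split; first exact: stable_event_sigma_algebra.
by move=> _ [i _ [B mB <-]]; rewrite setTI; exact: stable_event_generator.
Qed.

(** Stability of A is applied to the constant 1, which is the chaos of the empty set. *)
Lemma span_closure_indic A : measurable A -> V (L2r P \1_A).
Proof.
move=> mA; have [_] := stable_event_measurable mA.
have c1 : (cst 1 : T -> R) \in Lfun P 2%:E by exact: Lfun_cst.
move=> /(_ (cst 1) c1); rewrite (_ : \1_A \* cst 1 = \1_A); last first.
  by apply/funext => t /=; rewrite mulr1.
apply; apply: span_closureW; rewrite (_ : L2r P (cst 1) = chaos Z fset0).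
  exact: lspan_base.
by rewrite (chaosE noise); congr L2r; apply/funext => t; rewrite /bchaos big_seq_fset0.
Qed.

Lemma indic_L2 (A : set T) : measurable A -> (\1_A : T -> R) \in Lfun P 2%:E.
Proof. by move=> mA; apply: (@Lfun2_bounded _ _ _ _ _ 1) => //; exact: indic_le1. Qed.

Lemma span_closure_fsum (I : eqType) (l : seq I) (A : I -> set T) (c : I -> R) :
  (forall i, i \in l -> measurable (A i)) ->
  (fun t => \sum_(i <- l) c i * \1_(A i) t) \in Lfun P 2%:E /\
  V (L2r P (fun t => \sum_(i <- l) c i * \1_(A i) t)).
Proof.
elim: l => [_|i l ih mA].
  have -> : (fun t => \sum_(i <- [::]) c i * \1_(A i) t) = (0 : R) \*o \1_(@setT T).
    by apply/funext => t; rewrite big_nil /= mul0r.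
  split; first exact/Lfun2Z/indic_L2.
  by rewrite L2rZ ?indic_L2//; exact/span_closureZ/span_closure_indic.
have mi : measurable (A i) by apply: mA; rewrite mem_head.
have [|lL lV] := ih; first by move=> j jl; apply: mA; rewrite inE jl orbT.
have -> : (fun t => \sum_(j <- i :: l) c j * \1_(A j) t) =
    (c i \*o \1_(A i)) \+ (fun t => \sum_(j <- l) c j * \1_(A j) t).
  by apply/funext => t; rewrite big_cons.
have iL := Lfun2Z (c i) (indic_L2 mi).
split; first exact: Lfun2D.
rewrite (L2rD iL lL) (L2rZ (c i) (indic_L2 mi)); apply: span_closureD; last exact: lV.
exact/span_closureZ/span_closure_indic.
Qed.

Import HBSimple HBNNSimple.

Lemma span_closure_ge0 f : f \in Lfun P 2%:E -> (forall t, 0 <= f t) -> V (L2r P f).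
Proof.
move=> fL f0; have mf := Lfun2_measurable fL.
have mEf : measurable_fun setT (EFin \o f) by exact/measurable_EFinP.
pose g n := nnsfun_approx measurableT mEf n.
have gL n : (g n : T -> R) \in Lfun P 2%:E /\ V (L2r P (g n)).
  have -> : (g n : T -> R) = fun t =>
      \sum_(y <- fset_set (range (g n))) y * \1_(g n @^-1` [set y]) t.
    apply/funext => t; rewrite [LHS]fimfunE fsbig_finite//=.
  by apply: span_closure_fsum => y _.
have gf n t : 0 <= g n t <= f t.
  rewrite fun_ge0/= -lee_fin /g nnsfun_approxE.
  by apply: le_approx => // x _; rewrite lee_fin.
pose u n t := f t - g n t.
have uE n : u n = f \+ ((-1 : R) \*o g n).
  by apply/funext => t /=; rewrite mulN1r.
have uL n : u n \in Lfun P 2%:E by rewrite uE; apply/Lfun2D/Lfun2Z => //; case: (gL n).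
have ub n t : `|u n t| <= `|f t|.
  have /andP[g0 gft] := gf n t.
  by rewrite !ger0_norm// ?subr_ge0// lerBlDr lerDl.
have u0 t : u n t @[n --> \oo] --> 0.
  have f0' x : setT x -> (0 <= (EFin \o f) x)%E by rewrite lee_fin.
  have /fine_cvgP[_] := cvg_nnsfun_approx measurableT mEf f0' (x := t) I.
  rewrite -/g => gft; rewrite -(subrr (f t)); apply: cvgB => //; exact: cvg_cst.
apply: span_closure_lim => r r0.
have [n _ /(_ n (leqnn n)) h] := nr_L2r_cvg0 uL fL ub u0 r0.
have [g1 g2] := gL n; exists (L2r P (g n)) => //.
by move: h; rewrite uE L2rD ?Lfun2Z// L2rZ// rmorphN1 scaleN1r.
Qed.

(** Indicators of events lie in the closure of the span; simple functions, their increasing limits,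
    differences of nonnegative functions, and real plus i times imaginary parts follow. *)
Lemma chaos_dense : dense (lspan (chaos Z)).
Proof.
have Vr f : f \in Lfun P 2%:E -> V (L2r P f).
  move=> fL; have mf := Lfun2_measurable fL.
  have nL : Num.norm \o f \in Lfun P 2%:E.
    apply: Lfun2_le fL _; first exact: measurableT_comp.
    by move=> t /=; rewrite normr_id.
  have h : (2^-1 : R) \*o ((Num.norm \o f) \+ f) \in Lfun P 2%:E.
    by apply/Lfun2Z/Lfun2D.
  (* Positive part minus negative part. *)
  have -> : f = ((2^-1 : R) \*o ((Num.norm \o f) \+ f)) \+
     ((-1 : R) \*o ((2^-1 : R) \*o ((Num.norm \o f) \+ ((-1 : R) \*o f)))).
    by apply/funext => t /=; field.
  have h' : (2^-1 : R) \*o ((Num.norm \o f) \+ ((-1 : R) \*o f)) \in Lfun P 2%:E.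
    by apply/Lfun2Z/Lfun2D => //; exact: Lfun2Z.
  rewrite (L2rD h (Lfun2Z (-1) h')) (L2rZ (-1) h').
  apply: span_closureD; first apply: span_closure_ge0 => // t /=.
    by rewrite mulr_ge0// -lerBlDr sub0r -normrN ler_norm.
  apply/span_closureZ/span_closure_ge0 => // t /=.
  by rewrite mulr_ge0// mulN1r subr_ge0 ler_norm.
apply: nr_dense => x; have [f [g [fL gL ->]]] := L2r_reim x.
by apply: span_closureD; [exact: Vr|apply/span_closureZ; exact: Vr].
Qed.

(* Multiplication by [Z k] sends Z_(s \ k) to Z_s when k is in s, so [noise_mul k \ob D k]
   is the projection on the Z_s with k in s, and the adjoint of [D k] is
   M (1 - M D), where M is the multiplication; no completeness of L^2 is needed. *)
Lemma annihilation_adjoint (D : nat -> bop (L2 P)) k : annihilation_operators Z D ->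
  is_adj (D k) (noise_mul k - noise_mul k \ob noise_mul k \ob D k).
Proof.
move=> annD; apply: is_adj_lspan chaos_dense _ => s t.
rewrite annD bop_subE -[(_ \ob _) _]/(noise_mul k (noise_mul k (D k (chaos Z s))))
  annD !bopZ.
rewrite innerZr chaos_orthonormal.
have [ks|ks] := boolP (k \in s).
  rewrite scale1r noise_mul_chaos_setD1// subrr inner0l.
  have [st|_] := eqVneq s (t `\ k)%fset; last by rewrite mulr0.
  by move: ks; rewrite st !inE eqxx.
rewrite scale0r subr0 noise_mul_chaos_notin// chaos_orthonormal -natrM mulnb;
  congr (nat_of_bool _)%:R.
have [kt|kt] /= := boolP (k \in t).
  apply/eqP/eqP => [->|<-]; first by rewrite fsetD1K.
  by rewrite fsetU1K.
by apply/esym/negbTE; apply: contraNneq kt => <-; rewrite !inE eqxx.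
Qed.

Lemma annihilation_adjE (D : nat -> bop (L2 P)) k : annihilation_operators Z D ->
  is_adj (D k) (bop_adj (D k)).
Proof. by move=> annD; rewrite (bop_adjP (annihilation_adjoint k annD));
  exact: annihilation_adjoint. Qed.

Lemma creation_chaos (D : nat -> bop (L2 P)) k s : annihilation_operators Z D ->
  bop_adj (D k) (chaos Z s) = (k \notin s)%:R *: chaos Z (k |` s)%fset.
Proof.
move=> annD; rewrite (bop_adjP (annihilation_adjoint k annD)) bop_subE.
rewrite -[(_ \ob _) _]/(noise_mul k (noise_mul k (D k (chaos Z s)))) annD !bopZ.
have [ks|ks] := boolP (k \in s).
  by rewrite scale1r noise_mul_chaos_setD1// subrr scale0r.
by rewrite scale0r subr0 scale1r noise_mul_chaos_notin.
Qed.

End chaos_basis.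

(** * Operators in the chaos basis *)

Section orthonormal_family.
Context {R : realType} {H : innerModType R}.
Variable e : {fset nat} -> H.
Hypotheses (eO : forall s t, inner (e s) (e t) = (s == t)%:R)
  (eD : dense (lspan e)).
Implicit Types (x y : H) (n : nat) (A B : bop H) (s : {fset nat}).

Lemma inner_fset_sum (U : {fset {fset nat}}) (c : {fset nat} -> R[i]) s :
  inner (e s) (\sum_(t <- U) c t *: e t) = if s \in U then c s else 0.
Proof.
rewrite inner_sumr; have [sU|sU] := boolP (s \in U).
  rewrite (big_fsetD1 s)//= innerZr eO eqxx mulr1 big_seq big1 ?addr0// => t.
  by rewrite !inE => /andP[ts _]; rewrite innerZr eO eq_sym (negbTE ts) mulr0.
rewrite big_seq big1// => t tU; rewrite innerZr eO; case: eqVneq => [st|];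
  last by rewrite mulr0.
by move: sU; rewrite st tU.
Qed.

Lemma nr_sq_fset_sum (U : {fset {fset nat}}) (c : {fset nat} -> R[i]) :
  nr (\sum_(t <- U) c t *: e t) ^+ 2 = \sum_(t <- U) cRe ((c t)^* * c t).
Proof.
rewrite -rdot_nr /rdot inner_suml cRe_sum; apply: eq_fbigr => t tU _.
by rewrite innerZl inner_fset_sum tU.
Qed.

(** The index set written Gamma with subscript n] in the definition of amenability. [trunc] is the
    orthogonal projection on its span and, for the chaos basis, unfolds to [chaos_truncation]. *)
Definition box n : {fset {fset nat}} := fpowerset [fset i in iota 0 n.+1]%fset.

Definition trunc n x : H := \sum_(s <- box n) inner (e s) x *: e s.

Lemma trunc_adj n x y : inner (trunc n x) y = inner x (trunc n y).
Proof.
rewrite inner_suml inner_sumr; apply: eq_bigr => s _.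
by rewrite innerZl innerZr -innerC mulrC.
Qed.

Lemma rtrunc_adj n x y : rdot (trunc n x) y = rdot x (trunc n y).
Proof. by rewrite /rdot trunc_adj. Qed.

Lemma trunc_idem n x : trunc n (trunc n x) = trunc n x.
Proof.
rewrite {1}/trunc; apply: eq_fbigr => s sb _.
by rewrite inner_fset_sum sb.
Qed.

Lemma truncB n x y : trunc n (x - y) = trunc n x - trunc n y.
Proof.
rewrite /trunc -sumrB; apply: eq_bigr => s _.
by rewrite innerBr scalerBl.
Qed.

Lemma trunc_orth n x : rdot (trunc n x) (x - trunc n x) = 0.
Proof. by rewrite rdotBr !rtrunc_adj trunc_idem subrr. Qed.

Lemma nr_trunc_le n x : nr (trunc n x) <= nr x.
Proof.
rewrite -(@ler_pXn2r _ 2) ?nnegrE ?nr_ge0//.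
rewrite -[in leRHS](subrK (trunc n x) x) addrC nr_sq_expand trunc_orth.
by rewrite mulr0 addr0 lerDl sqr_ge0.
Qed.

Lemma trunc_span n x : lspan e (trunc n x).
Proof. exact: fset_lspan. Qed.

Lemma mem_box s : exists n0, forall n, (n0 <= n)%N -> s \in box n.
Proof.
exists (\max_(i <- s) i)%N => n sn; rewrite fpowersetE; apply/fsubsetP => i si.
apply/imfsetP; exists i => //=;
  rewrite -[_ :: _]/(iota 0 n.+1) mem_iota add0n /= ltnS (leq_trans _ sn)//.
exact: leq_bigmax_seq.
Qed.

Lemma trunc_fix x : lspan e x -> exists n0, forall n, (n0 <= n)%N -> trunc n x = x.
Proof.
move=> [l [c ->]]; elim: l => [|s l [n1 h1]].
  exists 0%N => n _; rewrite big_nil /trunc big1// => s _.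
  by rewrite inner0r scale0r.
have [n2 h2] := mem_box s; exists (maxn n1 n2) => n.
rewrite geq_max => /andP[n1n n2n]; rewrite big_cons.
have -> : trunc n (c s *: e s + \sum_(j <- l) c j *: e j) =
   trunc n (c s *: e s) + trunc n (\sum_(j <- l) c j *: e j).
  by rewrite /trunc -big_split /=; apply: eq_bigr => t _; rewrite innerDr scalerDl.
rewrite h1//; congr (_ + _); rewrite /trunc (big_fsetD1 s) ?h2//=.
rewrite innerZr eO eqxx mulr1 big_seq big1 ?addr0// => t.
by rewrite !inE => /andP[ts _]; rewrite innerZr eO (negbTE ts) mulr0 scale0r.
Qed.

Lemma trunc_cvg x (r : R) : 0 < r -> \forall n \near \oo, nr (trunc n x - x) < r.
Proof.
move=> r0; have [y ey xy] := dense_nr eD x (divr_gt0 r0 (ltr0n R 2)).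
have [n0 h] := trunc_fix ey; exists n0 => // n /= n0n.
have -> : trunc n x - x = trunc n (x - y) - (x - y) by rewrite truncB h// opprB addrA
  subrK.
rewrite (le_lt_trans (nrD _ _))// nrN.
have := nr_trunc_le n (x - y); lra.
Qed.

Section diagonal.
Variables (A : bop H) (a : {fset nat} -> R).
Hypothesis Aa : forall s, A (e s) = (a s)%:C%C *: e s.

Lemma diag_adj : is_adj A A.
Proof.
apply: is_adj_lspan eD _ => s t; rewrite !Aa innerZr innerZl eO conj_realC.
by case: eqVneq => [->//|_]; rewrite !mulr0.
Qed.

Lemma diag_inner s x : inner (e s) (A x) = (a s)%:C%C * inner (e s) x.
Proof. by rewrite diag_adj Aa innerZl conj_realC. Qed.

Lemma diag_trunc n x : A (trunc n x) = trunc n (A x).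
Proof.
rewrite bop_sumr; apply: eq_bigr => s _.
by rewrite bopZ Aa scalerA diag_inner mulrC.
Qed.

Lemma diag_nr_sq (U : {fset {fset nat}}) (c : {fset nat} -> R[i]) :
  nr (A (\sum_(t <- U) c t *: e t)) ^+ 2 = \sum_(t <- U) a t ^+ 2 * cRe ((c t)^* * c t).
Proof.
rewrite bop_sumr; under eq_bigr do rewrite bopZ Aa scalerA.
rewrite nr_sq_fset_sum; apply: eq_bigr => t _.
rewrite [(_ * _)^*]rmorphM /= conj_realC mulrACA.
have -> : (a t)%:C%C * (a t)%:C%C = (a t ^+ 2)%:C%C by rewrite expr2 [RHS]rmorphM.
by rewrite mulrC cRe_rM.
Qed.

End diagonal.

(** On the span both norms are finite sums weighted by squared eigenvalues; density does the
    rest. *)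
Lemma diag_le A B (a b : {fset nat} -> R) :
  (forall s, A (e s) = (a s)%:C%C *: e s) -> (forall s, B (e s) = (b s)%:C%C *: e s) ->
  (forall s, 0 <= a s <= b s) -> forall x, nr (A x) <= nr (B x).
Proof.
move=> Aa Bb ab; apply: bop_dense_le eD _ => x /lspan_fset[U [c [_ ->]]].
rewrite -(@ler_pXn2r _ 2) ?nnegrE ?nr_ge0//.
rewrite (diag_nr_sq Aa) (diag_nr_sq Bb); apply: ler_sum => s _.
apply: ler_wpM2r; last by have /andP[? ?] := ab s; rewrite ler_pXn2r ?nnegrE//; lra.
by case: (c s) => u v /=; rewrite mulNr opprK -!expr2 addr_ge0 ?sqr_ge0.
Qed.

End orthonormal_family.

Section number.
Context {R : realType} {H : innerModType R}.
Variables (e : {fset nat} -> H) (D C : nat -> bop H).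
Hypotheses (eO : forall s t, inner (e s) (e t) = (s == t)%:R)
  (eD : dense (lspan e))
  (De : forall k s, D k (e s) = (k \in s)%:R *: e (s `\ k)%fset)
  (Ce : forall k s, C k (e s) = (k \notin s)%:R *: e (k |` s)%fset)
  (DC : forall k, is_adj (D k) (C k)).
Implicit Types (x y : H) (m n : nat) (s : {fset nat}).

(** Bounded cutoff of the number operator: its eigenvalue at e s counts the elements of s below
    m. *)
Definition number_op m : bop H := \sum_(k < m) (C k \ob D k).
Definition number_form m x : R := \sum_(k < m) nr (D k x) ^+ 2.

Lemma creation_annihilation_basis k s : C k (D k (e s)) = (k \in s)%:R *: e s.
Proof.
rewrite De bopZ Ce !inE eqxx /= scale1r.
by case: (boolP (k \in s)) => ks; rewrite ?scale0r// fsetD1K.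
Qed.

Lemma number_op_basis m s : number_op m (e s) = (\sum_(k < m) (nat_of_ord k \in
  s)%:R)%:C%C *: e s.
Proof.
rewrite bop_sumE rmorph_sum scaler_suml; apply: eq_bigr => k _.
by rewrite -[LHS]/(C k (D k (e s))) creation_annihilation_basis; case: (_ \in _).
Qed.

Lemma rdot_creation_annihilation k x y : rdot x (C k (D k y)) = rdot (D k x) (D k y).
Proof. by rewrite (is_adj_rdot _ _ (is_adj_sym (DC k))). Qed.

Lemma rdot_number_op m x y : rdot x (number_op m y) = \sum_(k < m) rdot (D k x) (D k y).
Proof.
rewrite bop_sumE rdot_sumr; apply: eq_bigr => k _; exact: rdot_creation_annihilation.
Qed.

Lemma number_formE m x : number_form m x = rdot x (number_op m x).
Proof. by rewrite rdot_number_op; apply: eq_bigr => k _; rewrite rdot_nr. Qed.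

Lemma number_form_ge0 m x : 0 <= number_form m x.
Proof. by apply: sumr_ge0 => k _; rewrite sqr_ge0. Qed.

Lemma number_form_mono m m' x : (m <= m')%N -> number_form m x <= number_form m' x.
Proof.
move=> /subnK <-; rewrite addnC; elim: (m' - m)%N => [|j ih]; first by rewrite addn0.
by rewrite addnS /number_form big_ord_recr /= (le_trans ih)// lerDl sqr_ge0.
Qed.

Lemma number_form_expand m x y :
  number_form m (x + y) = number_form m x + 2 * rdot (number_op m x) y +
    number_form m y.
Proof.
rewrite (rdotC (number_op m x)) rdot_number_op mulr_sumr -!big_split /=.
by apply: eq_bigr => k _; rewrite bopD nr_sq_expand rdotC.
Qed.

(** [number_op m] commutes with the projection, so no cross term appears between [trunc e n x] and
    its complement. *)
Lemma number_form_trunc_le m n x : number_form m (trunc e n x) <= number_form m x.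
Proof.
rewrite -[in leRHS](subrK (trunc e n x) x) addrC number_form_expand.
rewrite (diag_trunc eO eD (number_op_basis m)) rtrunc_adj truncB (trunc_idem eO)
  subrr rdot0r.
by rewrite mulr0 addr0 lerDl number_form_ge0.
Qed.

(** D_j C_j is the projection on the e s with j not in s, and |C_j x|^2 = <x, D_j C_j x>. *)
Lemma nr_creation_le j x : nr (C j x) <= nr x.
Proof.
have DCe s : (D j \ob C j) (e s) = (((j \notin s)%:R : R))%:C%C *: e s.
  rewrite -[LHS]/(D j (C j (e s))) Ce bopZ De !inE eqxx /= scale1r.
  by case: (boolP (j \in s)) => js /=; rewrite ?scale0r// fsetU1K.
have le1 : nr (D j (C j x)) <= nr x.
  have := @diag_le _ _ _ eO eD (D j \ob C j) bop1 _ (fun=> 1) DCe _ _ x; apply.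
    by move=> s; rewrite scale1r.
  by move=> s; rewrite ler0n lern1 leq_b1.
rewrite -(@ler_pXn2r _ 2) ?nnegrE ?nr_ge0// -rdot_nr.
rewrite -(is_adj_rdot _ _ (DC j)) (le_trans (ler_norm _))// (le_trans (rdot_le _ _))//.
by rewrite expr2 ler_wpM2l ?nr_ge0.
Qed.

(** D_k is a partial isometry: D_k C_k D_k = D_k. *)
Lemma nr_creation_annihilation k x : nr (C k (D k x)) = nr (D k x).
Proof.
have DCD : D k \ob C k \ob D k = D k.
  apply: bop_dense_ext eD _ => s;
    rewrite -[LHS]/(D k (C k (D k (e s)))) creation_annihilation_basis bopZ De.
  by case: (k \in s); rewrite ?scale1r// !scale0r.
apply/eqP; rewrite -(@eqrXn2 _ 2) ?nr_ge0// -rdot_nr -(is_adj_rdot _ _ (DC k)).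
by rewrite -[D k (C k (D k x))]/((D k \ob C k \ob D k) x) DCD rdot_nr.
Qed.

Definition number_sum x : H := sum (fun s => (#|` s|%:R * inner (e s) x) *: e s).

Lemma sum_finite_support (U : {fset {fset nat}}) (f : {fset nat} -> H) :
  (forall s, s \notin U -> f s = 0) -> sum f = \sum_(s <- U) f s.
Proof.
have FF : ProperFilter (@totally {fset nat}) := totally_filter.
move=> f0; apply: cvg_lim; first exact: norm_hausdorff.
apply: cvg_near_cst; exists U => // W /= UW.
rewrite /partial_sum -(big_seq_fsetE _ _ predT) /=; apply/esym/big_fset_incl => //.
by move=> s _; exact: f0.
Qed.

(** A vector of the span involves finitely many indices, and a cutoff above all of them counts every
    element. *)
Lemma number_sum_span x : lspan e x ->
  exists K, forall m, (K <= m)%N -> number_sum x = number_op m x.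
Proof.
move=> /lspan_fset[U [c [c0 xE]]].
(* The successor makes every index of every s in U strictly smaller than m. *)
exists (\max_(s <- U) \max_(i <- s) i.+1)%N => m Um.
have -> : number_sum x = \sum_(s <- U) (#|` s|%:R * inner (e s) x) *: e s.
  apply: sum_finite_support => s sU.
  by rewrite xE (inner_fset_sum eO) (negbTE sU) mulr0 scale0r.
rewrite {2}xE bop_sumr; apply: eq_fbigr => s sU _.
rewrite xE (inner_fset_sum eO) sU bopZ number_op_basis scalerA mulrC;
  congr (_ * _ *: _).
have sm i : i \in s -> (i < m)%N.
  move=> si; apply: leq_trans Um.
  have h1 : (\max_(i <- s) i.+1 <= \max_(s <- U) \max_(i <- s) i.+1)%N.
    exact: (@leq_bigmax_seq _ _ _ (fun s : {fset nat} => \max_(i <- s) i.+1)%N).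
  apply: leq_trans h1; exact: (@leq_bigmax_seq _ _ _ (fun i => i.+1)).
rewrite -natr_sum rmorph_nat; congr (_%:R).
rewrite -(big_mkord predT (fun k => nat_of_bool (k \in s))) /=.
have -> : (\sum_(0 <= k < m) (k \in s) = \sum_(0 <= k < m | k \in s) 1)%N.
  by rewrite [in RHS]big_mkcond; apply: eq_bigr => k _; case: (k \in s).
rewrite sum1_count -size_filter; apply/perm_size/uniq_perm; rewrite ?fset_uniq//.
  exact/filter_uniq/iota_uniq.
move=> i; rewrite mem_filter mem_index_iota /=.
by case: (boolP (i \in s)) => //= si; rewrite sm.
Qed.

End number.

Section convergence.
Context {R : realType} {H : innerModType R}.
Implicit Types (x y : H).

Lemma nr_cvg0P (U : Type) (F : set_system U) {FF : Filter F} (f : U -> H) y :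
  (f x @[x --> F] --> y) <-> (nr (f x - y) @[x --> F] --> 0).
Proof.
split=> [/nr_cvgP h|/cvgrPdist_lt h].
  apply/cvgrPdist_lt => r r0; apply: filterS (h r r0) => u.
  by rewrite sub0r normrN ger0_norm ?nr_ge0.
apply/nr_cvgP => r r0; apply: filterS (h r r0) => u.
by rewrite sub0r normrN ger0_norm ?nr_ge0.
Qed.

Lemma nr_dist x y : `|nr x - nr y| <= nr (x - y).
Proof.
have h1 : nr x <= nr (x - y) + nr y by rewrite -{1}(subrK y x) nrD.
have h2 : nr y <= nr (x - y) + nr x by rewrite nrB -{1}(subrK x y) nrD.
by rewrite ler_norml; apply/andP; split; lra.
Qed.

Lemma bop_cvg (U : Type) (F : set_system U) {FF : Filter F} (A : bop H) (f : U -> H) y :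
  (f x @[x --> F] --> y) -> A (f x) @[x --> F] --> A y.
Proof.
move=> /nr_cvg0P h; apply/nr_cvg0P; have [M M0 AM] := bop_bounded A.
have Mh : M * nr (f x - y) @[x --> F] --> 0.
  by rewrite -(mulr0 M); apply: cvgM => //; exact: cvg_cst.
apply: (squeeze_cvgr _ (cvg_cst 0) Mh); apply: nearW => u.
by rewrite nr_ge0 /= -bopB AM.
Qed.

Lemma nr_cvg (U : Type) (F : set_system U) {FF : Filter F} (f : U -> H) y :
  (f x @[x --> F] --> y) -> nr (f x) @[x --> F] --> nr y.
Proof.
move=> /nr_cvg0P /cvgrPdist_lt h; apply/cvgrPdist_lt => r r0.
apply: filterS (h r r0) => u; apply: le_lt_trans.
by rewrite distrC sub0r normrN (le_trans (nr_dist _ _))// ler_norm.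
Qed.

Lemma rdot_cvg (U : Type) (F : set_system U) {FF : Filter F} (f g : U -> H) x y :
  (f u @[u --> F] --> x) -> (g u @[u --> F] --> y) ->
  rdot (f u) (g u) @[u --> F] --> rdot x y.
Proof.
(* Polarization reduces joint continuity to continuity of the norm. *)
have polar a b : rdot a b = 2^-1 * (nr (a + b) ^+ 2 - nr a ^+ 2 - nr b ^+ 2).
  by rewrite nr_sq_expand; field.
move=> fx gy.
have sq (h : U -> H) z : (h u @[u --> F] --> z) ->
  nr (h u) ^+ 2 @[u --> F] --> nr z ^+ 2.
  by move=> /nr_cvg hz; rewrite expr2; apply: cvgM.
rewrite polar; under eq_fun do rewrite polar.
apply: cvgM; first exact: cvg_cst.
apply: cvgB; last exact: sq.
by apply: cvgB; apply: sq => //; exact: cvgD.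
Qed.

Lemma cvg_bigsum (I : Type) (s : seq I) (U : Type) (F : set_system U) {FF : Filter F}
    (f : I -> U -> R) (l : I -> R) : (forall i, f i u @[u --> F] --> l i) ->
  (\sum_(i <- s) f i u) @[u --> F] --> \sum_(i <- s) l i.
Proof.
move=> fl; elim: s => [|i s ih].
  by rewrite big_nil; under eq_fun do rewrite big_nil; exact: cvg_cst.
by rewrite big_cons; under eq_fun do rewrite big_cons; exact: cvgD.
Qed.

End convergence.

Section square_sums.
Context {R : realType}.
Implicit Types (F : nat -> nat -> R).

Lemma square_sum_ge0 F n : (forall j k, 0 <= F j k) -> 0 <= square_sum F n.
Proof. by move=> F0; apply: sumr_ge0 => j _; exact: sumr_ge0. Qed.

Lemma le_square_sum F F' n : (forall j k, F j k <= F' j k) ->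
  square_sum F n <= square_sum F' n.
Proof. by move=> FF; apply: ler_sum => j _; apply: ler_sum. Qed.

Lemma square_sumD F F' n :
  square_sum (fun j k => F j k + F' j k) n = square_sum F n + square_sum F' n.
Proof. by rewrite /square_sum -big_split /=; apply: eq_bigr => j _;
  rewrite big_split. Qed.

Lemma square_sumM F n (a : R) : square_sum (fun j k => a * F j k) n = a * square_sum
  F n.
Proof.
by rewrite /square_sum mulr_sumr; apply: eq_bigr => j _; rewrite mulr_sumr.
Qed.

Lemma square_sum_mono F n m : (forall j k, 0 <= F j k) -> (n <= m)%N ->
  square_sum F n <= square_sum F m.
Proof.
move=> F0 /subnK <-; rewrite addnC; elim: (m - n)%N => [|i ih]; first by rewrite addn0.
apply: le_trans ih _; rewrite addnS /square_sum [leRHS]big_ord_recr /=.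
rewrite ler_wpDr ?sumr_ge0//; apply: ler_sum => j _.
by rewrite [leRHS]big_ord_recr /= lerDl.
Qed.

Lemma square_sum_diag F n : (forall j k, 0 <= F j k) ->
  \sum_(k < n.+1) F k k <= square_sum F n.
Proof.
move=> F0; apply: ler_sum => j _.
by rewrite (bigD1 j)//= lerDl sumr_ge0.
Qed.

Lemma square_sum_term F n j k : (forall j k, 0 <= F j k) -> (j <= n)%N -> (k <= n)%N ->
  F j k <= square_sum F n.
Proof.
move=> F0; rewrite -ltnS => jn; rewrite -ltnS => kn.
rewrite /square_sum (bigD1 (Ordinal jn))//= (bigD1 (Ordinal kn))//= -addrA lerDl.
by rewrite addr_ge0// sumr_ge0// => i _; apply: sumr_ge0.
Qed.

Lemma cvg_square_sum n (U : Type) (F : set_system U) {FF : Filter F}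
    (f : nat -> nat -> U -> R) (l : nat -> nat -> R) :
  (forall j k, f j k u @[u --> F] --> l j k) ->
  square_sum (fun j k => f j k u) n @[u --> F] --> square_sum l n.
Proof. by move=> fl; apply: cvg_bigsum => j; apply: cvg_bigsum => k. Qed.

End square_sums.

(** * Comparison of the weighted number operator with the number operator *)

Section weighted.
Context {R : realType} {H : innerModType R}.
Variables (e : {fset nat} -> H) (D C : nat -> bop H) (w : nat -> nat -> R) (w0 c : R).
Hypotheses (eO : forall s t, inner (e s) (e t) = (s == t)%:R)
  (eD : dense (lspan e))
  (De : forall k s, D k (e s) = (k \in s)%:R *: e (s `\ k)%fset)
  (Ce : forall k s, C k (e s) = (k \notin s)%:R *: e (k |` s)%fset)
  (DC : forall k, is_adj (D k) (C k))
  (w_ge0 : forall j k, 0 <= w j k) (w0_gt0 : 0 < w0) (w0_le : forall j, w0 <= w j j)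
  (w_le : forall n k, \sum_(j < n) w j k <= c).
Implicit Types (x y : H) (m n : nat) (s : {fset nat}).

Definition weighted_op n : bop H := square_sum (fun j k =>
  (w j k)%:C%C *: (C k \ob D j \ob C j \ob D k)) n.

(** Three choices of q matter: the squared norm gives the form of S_w, a number form gives the
    series of hypothesis (3), and <y, X y> gives the jump part of the equation. *)
Definition jump_sum (q : H -> R) n x : R :=
  square_sum (fun j k => w j k * q (C j (D k x))) n.

Definition jump_energy := jump_sum (fun y => nr y ^+ 2).

Lemma weighted_opE n x : weighted_op n x = square_sum (fun j k =>
  (w j k)%:C%C *: C k (D j (C j (D k x)))) n.
Proof.
rewrite /weighted_op /square_sum bop_sumE; apply: eq_bigr => j _.
by rewrite bop_sumE.
Qed.

Lemma jump_energyE n x : jump_energy n x = rdot x (weighted_op n x).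
Proof.
rewrite weighted_opE /square_sum rdot_sumr; apply: eq_bigr => j _.
rewrite rdot_sumr; apply: eq_bigr => k _; rewrite rdotZr; congr (_ * _).
rewrite (is_adj_rdot _ _ (is_adj_sym (DC k))) (is_adj_rdot _ _ (DC j)).
by rewrite rdot_nr.
Qed.

Lemma jump_sum_ge0 (q : H -> R) n x : (forall y, 0 <= q y) -> 0 <= jump_sum q n x.
Proof. by move=> q0; apply: square_sum_ge0 => j k; rewrite mulr_ge0. Qed.

Lemma jump_energy_mono n m x : (n <= m)%N -> jump_energy n x <= jump_energy m x.
Proof. by apply: square_sum_mono => j k; rewrite mulr_ge0 ?sqr_ge0. Qed.

(** Only the diagonal terms are kept: there |L_kk x| = |D_k x| and w(k,k) >= w0. *)
Lemma jump_energy_lower n x : w0 * number_form D n.+1 x <= jump_energy n x.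
Proof.
apply: le_trans (square_sum_diag _ _); last first.
  by move=> j k; rewrite mulr_ge0 ?sqr_ge0.
rewrite mulr_sumr; apply: ler_sum => k _.
by rewrite (nr_creation_annihilation eD De Ce DC) ler_wpM2r ?sqr_ge0.
Qed.

(** Creation operators are contractions, so the sum over j only meets the column sums of w. *)
Lemma jump_energy_upper n x : jump_energy n x <= c * number_form D n.+1 x.
Proof.
rewrite /jump_energy /jump_sum /square_sum exchange_big /= mulr_sumr;
  apply: ler_sum => k _.
apply: (@le_trans _ _ (\sum_(j < n.+1) w j k * nr (D k x) ^+ 2)).
  apply: ler_sum => j _; rewrite ler_wpM2l// ler_pXn2r ?nnegrE ?nr_ge0//.
  exact: (nr_creation_le eO eD De Ce DC).
by rewrite -mulr_suml ler_wpM2r ?sqr_ge0.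
Qed.

Lemma jump_adj_jump_basis j k s : C k (D j (C j (D k (e s)))) =
  ((k \in s) && (j \notin (s `\ k)%fset))%:R *: e s.
Proof.
rewrite De !bopZ Ce !bopZ De.
have [ks|ks] /= := boolP (k \in s); last by rewrite !scale0r.
rewrite scale1r; have [js|js] /= := boolP (j \notin _); last by rewrite !scale0r.
have jj : (j \in (j |` (s `\ k))%fset)%:R = 1 :> R[i] by rewrite !inE eqxx.
have kk : (k \notin (s `\ k)%fset)%:R = 1 :> R[i] by rewrite !inE eqxx.
by rewrite (fsetU1K js) jj !scale1r Ce fsetD1K// kk scale1r.
Qed.

(** Both operators are diagonal. The eigenvalue of [weighted_op n] at e s sums w(j,k) over k in s
    and j not in s \ k, with j, k <= n; its terms j = k already give w0 times the number of such k.
    Unlike the form inequality, this controls the vector [number_op n.+1 x]. *)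
Lemma number_op_le_weighted_op n x : w0 * nr (number_op D C n.+1 x) <=
  nr (weighted_op n x).
Proof.
pose theta s := square_sum (fun j k => w j k * ((k \in s) && (j \notin (s `\
  k)%fset))%:R) n.
have Te s : weighted_op n (e s) = (theta s)%:C%C *: e s.
  rewrite weighted_opE /theta /square_sum rmorph_sum scaler_suml; apply: eq_bigr => j _.
  rewrite rmorph_sum scaler_suml; apply: eq_bigr => k _.
  rewrite [in RHS]rmorphM /= -scalerA; congr (_ *: _).
  by rewrite jump_adj_jump_basis; case: (_ && _).
have th0 s : 0 <= theta s by apply: square_sum_ge0 => j k; rewrite mulr_ge0// ler0n.
pose number s : R := \sum_(k < n.+1) (nat_of_ord k \in s)%:R.
have nt s : w0 * number s <= theta s.
  apply: le_trans (square_sum_diag _ _); last by move=> j k; rewrite mulr_ge0// ler0n.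
  rewrite mulr_sumr; apply: ler_sum => k _; rewrite !inE eqxx /= andbT.
  by rewrite ler_wpM2r// ler0n.
have Ne s : (w0%:C%C *: number_op D C n.+1) (e s) = (w0 * number s)%:C%C *: e s.
  by rewrite bop_scaleE (number_op_basis De Ce) scalerA -rmorphM.
have nt0 s : 0 <= w0 * number s <= theta s.
  by rewrite nt andbT; apply: mulr_ge0; [exact: ltW|exact: sumr_ge0].
have := diag_le eO eD Ne Te nt0 x.
by rewrite bop_scaleE nrZr gtr0_norm.
Qed.

End weighted.

Section numform_limit.
Context {R : realType} {H : innerModType R}.
Variable D : nat -> bop H.

(* As a real supremum, it is 0 when the number form of [x] is infinite. *)
Definition number_sup (x : H) : R := sup (range (fun m => number_form D m x)).

Lemma number_form_cvg x (B : R) : (forall m, number_form D m x <= B) ->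
  number_form D m x @[m --> \oo] --> number_sup x.
Proof.
move=> h; apply: nondecreasing_cvgn; first by move=> m m' mm; exact: number_form_mono.
by exists B => _ [m _ <-].
Qed.

Lemma number_form_le_sup x (B : R) m : (forall m, number_form D m x <= B) ->
  number_form D m x <= number_sup x.
Proof.
move=> h; apply: ub_le_sup; last by exists m.
by exists B => _ [k _ <-].
Qed.

Lemma number_sup_le x (B : R) : (forall m, number_form D m x <= B) -> number_sup x <= B.
Proof.
move=> h; apply: ge_sup; first by exists (number_form D 0 x), 0%N.
by move=> _ [k _ <-].
Qed.

Lemma number_sup_le_near x (B : R) : (\forall m \near \oo, number_form D m x <= B) ->
  number_sup x <= B.
Proof.
move=> [N _ h]; apply: number_sup_le => m.
apply: le_trans (h (maxn m N) _); last exact: leq_maxr.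
exact/number_form_mono/leq_maxl.
Qed.

Lemma number_sup_ge0 x (B : R) : (forall m, number_form D m x <= B) ->
  0 <= number_sup x.
Proof. by move=> h; apply: le_trans (number_form_le_sup 0 h);
  exact: number_form_ge0. Qed.

End numform_limit.

(** * The maximum principle *)

Section psd.
Context {R : realType} {H : innerModType R}.

Lemma psd_CS (A : bop H) x y : (forall x y, rdot x (A y) = rdot (A x) y) ->
  (forall x, 0 <= rdot x (A x)) ->
  rdot x (A y) ^+ 2 <= rdot x (A x) * rdot y (A y).
Proof.
move=> As A0.
have expand (s : R) : 0 <= rdot x (A x) + 2 * s * rdot x (A y) + s ^+ 2 * rdot y (A y).
  have := A0 (x + s%:C%C *: y); rewrite bopD bopZ rdotDl !rdotDr !rdotZl !rdotZr.
  by rewrite (As y x) (rdotC (A y)); lra.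
have [q0|qn0] := eqVneq (rdot y (A y)) 0.
  rewrite q0 mulr0; have [->|p0] := eqVneq (rdot x (A y)) 0; first by rewrite expr0n.
  (* With <y, A y> = 0 the form is affine in s and equals -1 at this s. *)
  have := expand (- (rdot x (A x) + 1) / (2 * rdot x (A y))).
  rewrite q0 mulr0 addr0 (_ : 2 * _ * _ = - (rdot x (A x) + 1)); last by field.
  by move=> h; exfalso; lra.
have q0 : 0 < rdot y (A y) by rewrite lt_def qn0 A0.
have := expand (- (rdot x (A y) / rdot y (A y))).
have -> : rdot x (A x) + 2 * - (rdot x (A y) / rdot y (A y)) * rdot x (A y) +
  (- (rdot x (A y) / rdot y (A y))) ^+ 2 * rdot y (A y) =
  rdot x (A x) - rdot x (A y) ^+ 2 / rdot y (A y) by field.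
by rewrite subr_ge0 ler_pdivrMr.
Qed.

End psd.

(** The first condition says that the lower right Dini derivative is nonnegative; the second forbids
    a downward jump when s is reached from the left. *)
Lemma dini_le (R : realType) (t : R) (g : R -> R) : 0 <= t ->
  (forall s (q : R), 0 <= s < t -> 0 < q ->
    \forall h \near 0^'+, g s - q * h <= g (s + h)) ->
  (forall s (q : R), 0 < s <= t -> 0 < q ->
    \forall h \near 0^'+, g (s - h) - q <= g s) ->
  g 0 <= g t.
Proof.
move=> t0 gr gl.
suff h (q : R) : 0 < q -> g 0 - q * t <= g t.
  apply/ler_addgt0Pr => e e0; have t1 : 0 < t + 1 by lra.
  have := h _ (divr_gt0 e0 t1).
  have : e / (t + 1) * t <= e by rewrite mulrAC ler_pdivrMr// ler_pM2l//; lra.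
  lra.
move=> q0.
(* The left condition puts the supremum of A into A; the right condition moves beyond it unless it
   equals t. *)
pose A := [set s : R | 0 <= s <= t /\ forall r : R, 0 <= r <= s -> g 0 - q * r <= g r].
have A0 : A 0.
  split; first by rewrite lexx.
  by move=> r; rewrite -eq_le => /eqP <-; rewrite mulr0 subr0.
have Aub : has_sup A by split; [exists 0|exists t => s [/andP[]]].
pose sg := sup A.
have sg0 : 0 <= sg by apply: ub_le_sup => //; case: Aub.
have sgt : sg <= t by apply: ge_sup; [exists 0|move=> s [/andP[]]].
have below (r : R) : 0 <= r -> r < sg -> g 0 - q * r <= g r.
  move=> r0 rs; have [s [_ hs] rs'] := sup_gt (proj1 Aub) rs.
  by apply: hs; rewrite r0 ltW.
have at_sg : g 0 - q * sg <= g sg.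
  have [->|sgn0] := eqVneq sg 0; first by rewrite mulr0 subr0.
  have sgp : 0 < sg by rewrite lt_def sgn0.
  apply/ler_addgt0Pr => e e0.
  have gls : \forall h \near 0^'+, g (sg - h) - e <= g sg by apply: gl => //;
    rewrite sgp.
  have [h [h1 [hp hs]]] := filter_ex (filterI gls (filterI (nbhs_right_gt 0)
    (nbhs_right_lt sgp))).
  have := below (sg - h); rewrite subr_ge0 gtrBl => /(_ (ltW hs) hp).
  have := mulr_gt0 q0 hp; lra.
have [<-//|sgnt] := eqVneq sg t.
have sglt : sg < t by rewrite lt_neqAle sgnt.
exfalso.
have grs : \forall h \near 0^'+, g sg - q * h <= g (sg + h) by apply: gr => //;
  rewrite sg0.
have [h1 /= h10 hh] := grs.
(* Inside the neighbourhood where the right condition holds, and not beyond t. *)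
pose h2 := Num.min (h1 / 2) ((t - sg) / 2).
have h20 : 0 < h2 by rewrite lt_min !divr_gt0// subr_gt0.
have h2h1 : h2 < h1 by rewrite (@le_lt_trans _ _ (h1 / 2))// ?ge_min ?lexx//; lra.
have h2t : h2 <= (t - sg) / 2 by rewrite ge_min lexx orbT.
have : A (sg + h2).
  split; first by apply/andP; split; lra.
  move=> r /andP[r0 rs].
  have [rsg|rsg|->//] := ltgtP r sg; first exact: below.
  have := hh (r - sg); rewrite /= sub0r normrN gtr0_norm ?subr_gt0//.
  move=> /(_ _ rsg); rewrite subrKC => h3.
  have : g sg - q * (r - sg) <= g r by apply: h3; lra.
  lra.
move=> /(ub_le_sup (proj2 Aub)); rewrite -/sg; lra.
Unshelve. all: by end_near. Qed.

(** * The number form on the domain of the generator and along its semigroup *)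

Section admissible_generator.
Context {R : realType} {H : innerModType R}.
Variables (e : {fset nat} -> H) (D C : nat -> bop H) (w : nat -> nat -> R) (w0 c : R).
Hypotheses (eO : forall s t, inner (e s) (e t) = (s == t)%:R)
  (eD : dense (lspan e))
  (De : forall k s, D k (e s) = (k \in s)%:R *: e (s `\ k)%fset)
  (Ce : forall k s, C k (e s) = (k \notin s)%:R *: e (k |` s)%fset)
  (DC : forall k, is_adj (D k) (C k))
  (w_ge0 : forall j k, 0 <= w j k) (w0_gt0 : 0 < w0) (w0_le : forall j, w0 <= w j j)
  (w_le : forall n k, \sum_(j < n) w j k <= c).
Variables (G : operator H) (b : R).
Hypotheses (Glin : linear_operator G)
  (Gadm : forall u, dom G u -> exists v,
     (weighted_op D C w n u @[n --> \oo] --> v) /\ 2 * rdot u (G u) = - rdot u v)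
  (Gspan : lspan e `<=` dom G)
  (Gam : forall u, dom G u -> G (trunc e n u) @[n --> \oo] --> G u)
  (b_gt0 : 0 < b)
  (Gdis : forall x, lspan e x -> forall M m0 K, exists m, (K <= m)%N /\
     2 * rdot (number_op D C m x) (G x) + jump_sum D C w (number_form D m0) M x <=
       b * number_form D m x).
Implicit Types (u v x y : H) (m n M : nat).

Local Notation jump_energy := (jump_energy D C w).
Local Notation jump_sum := (jump_sum D C w).
Local Notation number_op := (number_op D C).
Local Notation number_form := (number_form D).
Local Notation number_sup := (number_sup D).

Lemma c_gt0 : 0 < c.
Proof.
have := w_le 1 0; rewrite big_ord_recl big_ord0 addr0.
have := w0_le 0; have := w0_gt0; simpl; lra.
Qed.

Lemma operatorB x y : dom G x -> dom G y -> dom G (x - y) /\ G (x - y) = G x - G y.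
Proof.
move=> dx dy; have [_ h] := Glin; have := h (-1) y x dy dx.
by rewrite !scaleN1r addrC (addrC (- G y)).
Qed.

(** On Dom G this is <u, S_w u>, by admissibility; in this form it is visibly at most 2 |u| |G
    u|. *)
Definition dissipation u : R := - (2 * rdot u (G u)).

Lemma jump_energy_cvg u : dom G u -> jump_energy n u @[n --> \oo] --> dissipation u.
Proof.
move=> /Gadm[v [Tv Gv]]; rewrite /dissipation Gv opprK.
by under eq_fun do rewrite (jump_energyE _ DC); apply: rdot_cvg => //; exact: cvg_cst.
Qed.

Lemma jump_energy_le n u : dom G u -> jump_energy n u <= dissipation u.
Proof.
move=> du; have := jump_energy_cvg du => h.
rewrite -(cvg_lim _ h)//; apply: nondecreasing_cvgn_le.
  by move=> i j ij; exact: jump_energy_mono.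
by apply/cvg_ex; exists (dissipation u).
Qed.

(** By regularity of w the number form is finite on Dom G, so that [number_sup] is a genuine
    supremum there. *)
Lemma number_form_le_dissipation m u : dom G u ->
  number_form m u <= w0^-1 * dissipation u.
Proof.
move=> du; rewrite ler_pdivlMl//; apply: le_trans (jump_energy_le m du).
apply: le_trans (jump_energy_lower eD De Ce DC w_ge0 w0_le m u).
by rewrite ler_pM2l//; exact: number_form_mono.
Qed.

Lemma dissipation_le_number_sup u : dom G u -> dissipation u <= c * number_sup u.
Proof.
move=> du; have h := jump_energy_cvg du; rewrite -(cvg_lim _ h)//.
apply: limr_le; first by apply/cvg_ex; exists (dissipation u).
apply: nearW => n; apply: le_trans (jump_energy_upper eO eD De Ce DC w_ge0 w_le n u) _.
by rewrite ler_pM2l ?c_gt0//; apply: number_form_le_sup => m;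
  exact: number_form_le_dissipation.
Qed.

Lemma dissipation_ge0 u : dom G u -> 0 <= dissipation u.
Proof.
move=> du; apply: le_trans (jump_energy_le 0 du).
by apply: jump_sum_ge0 => // y; exact: sqr_ge0.
Qed.

Lemma dissipation_le u : dissipation u <= 2 * (nr u * nr (G u)).
Proof.
rewrite /dissipation -mulrN ler_pM2l//; have := rdot_le u (G u).
by rewrite ler_norml; lra.
Qed.

Lemma number_form_le_graph m u : dom G u ->
  number_form m u <= w0^-1 * (2 * (nr u * nr (G u))).
Proof.
move=> du; apply: le_trans (number_form_le_dissipation m du) _.
by rewrite ler_pM2l ?invr_gt0//; exact: dissipation_le.
Qed.

(** The partial sums of S_w u converge, hence are bounded, and they dominate [number_op n.+1 u] in
    norm. The bound K does not depend on n. *)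
Lemma number_op_bounded u : dom G u -> exists2 K : R, 0 <= K &
  \forall n \near \oo, forall v, `|rdot (number_op n.+1 u) v| <= K * nr v.
Proof.
move=> /Gadm[v [Tv _]]; exists (w0^-1 * (nr v + 1)).
  by rewrite mulr_ge0 ?invr_ge0 ?(ltW w0_gt0) ?addr_ge0 ?nr_ge0.
have nTv : nr (weighted_op D C w n u) @[n --> \oo] --> nr v by exact: nr_cvg.
move/cvgrPdist_lt : nTv => /(_ 1 ltr01); apply: filterS => n nTv x.
apply: le_trans (rdot_le _ _) _; rewrite ler_wpM2r ?nr_ge0//.
rewrite ler_pdivlMl//; apply: le_trans (number_op_le_weighted_op eO eD De Ce w_ge0
  w0_gt0 w0_le n u) _.
by move: nTv; rewrite ltr_norml; lra.
Qed.

Lemma annihilate_notin k s : k \notin s -> D k (e s) = 0.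
Proof. by rewrite De => /negbTE ->; rewrite scale0r. Qed.

(** For k > n, D_k kills every e s with s inside {0, ..., n}, so on truncations all cutoffs above n
    agree. *)
Lemma number_op_trunc m n u : (n < m)%N ->
  number_op m (trunc e n u) = trunc e n (number_op n.+1 u).
Proof.
move=> nm; rewrite -(diag_trunc eO eD (number_op_basis De Ce n.+1)).
rewrite /number_op !bop_sumE -(big_mkord predT (fun k => (C k \ob D k) (trunc e n u))).
rewrite (big_cat_nat (leq0n n.+1) nm)//= big_mkord [X in _ + X]big_nat.
rewrite [X in _ + X]big1 ?addr0// => k /andP[nk _].
rewrite -[LHS]/(C k (D k (trunc e n u))) /trunc bop_sumr big_seq big1 ?bop0// => s sb.
rewrite bopZ annihilate_notin ?scaler0//; apply/negP => ks.
move: sb; rewrite fpowersetE => /fsubsetP /(_ _ ks) /imfsetP[i /=].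
by rewrite -[_ :: _]/(iota 0 n.+1) mem_iota add0n /= => + ki; rewrite -ki ltnNge nk.
Qed.

(* Hypothesis (3) is applied to the truncations x_n of u, for which N x_n is the
   truncation of N u and, by amenability, G x_n --> G u. *)
Lemma dissipative_partial u m0 M (r : R) : dom G u -> 0 < r ->
  \forall n \near \oo, 2 * rdot (number_op n.+1 u) (G u) +
    jump_sum (number_form m0) M u <= b * number_sup u + r.
Proof.
move=> du r0; have [K K0 NK] := number_op_bounded du.
have tc : trunc e n u @[n --> \oo] --> u by apply/nr_cvgP => ? ?; exact: trunc_cvg.
have jc : jump_sum (number_form m0) M (trunc e n u) @[n --> \oo] --> jump_sum
  (number_form m0) M u.
  apply: cvg_square_sum => j k; apply: cvgM; first exact: cvg_cst.
  apply: cvg_bigsum => i; rewrite expr2; under eq_fun do rewrite expr2.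
  have h : nr (D i (C j (D k (trunc e n u)))) @[n --> \oo] --> nr (D i (C j (D k u))).
    by apply: nr_cvg; do 3 apply: bop_cvg.
  exact: cvgM.
(* Passing from the truncation to u changes 2 <N u, G u> by two errors, each at most 2 K times a
   norm made small here; the last third of r is for the jump sum. *)
have K1 : 0 < 2 * (K + 1) by lra.
have r3 : 0 < r / 3 / (2 * (K + 1)) by rewrite !divr_gt0.
have Gc := Gam du.
have /nr_cvgP /(_ _ r3) G1 := Gc.
have G2 := trunc_cvg eO eD (G u) r3.
have /cvgrPdist_lt /(_ (r / 3)) J := jc; have {}J := J (divr_gt0 r0 (ltr0n _ 3)).
near=> n.
have Nn : forall v, `|rdot (number_op n.+1 u) v| <= K * nr v by near: n.
have g1 : nr (G (trunc e n u) - G u) < r / 3 / (2 * (K + 1)) by near: n.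
have g2 : nr (trunc e n (G u) - G u) < r / 3 / (2 * (K + 1)) by near: n.
have jn : `|jump_sum (number_form m0) M u - jump_sum (number_form m0) M (trunc e n
  u)| < r / 3 by near: n.
(* Asking for m > n makes [number_op m] of the truncation the truncation of [number_op n.+1 u]. *)
have [m [nm hm]] := Gdis (trunc_span e n u) M m0 n.+1.
move: hm; rewrite number_op_trunc// rtrunc_adj => hm.
have nmu : b * number_form m (trunc e n u) <= b * number_sup u.
  rewrite ler_pM2l//; apply: le_trans (number_form_trunc_le eO eD De Ce DC _ _ _) _.
  by apply: number_form_le_sup => i; exact: number_form_le_dissipation.
have e1 := Nn (G u - trunc e n (G u)).
have e2 := Nn (trunc e n (G u - G (trunc e n u))).
rewrite rdotBr in e1; rewrite truncB rdotBr in e2.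
have e3 := nr_trunc_le eO n (G u - G (trunc e n u)).
rewrite truncB in e3.
move: g1 g2; rewrite !ltr_pdivlMr// => g1 g2.
rewrite nrB in g1; rewrite nrB in g2.
set x1 := nr _ in g2 e1; set x2 := nr (G u - _) in g1 e3; set x3 := nr _ in e2 e3.
have x30 : 0 <= x3 by exact: nr_ge0.
have x10 : 0 <= x1 by exact: nr_ge0.
have h3 : K * x3 <= K * x2 by rewrite ler_wpM2l.
move: e1 e2; rewrite !ler_norml => /andP[e11 e12] /andP[e21 e22].
move: jn; rewrite ltr_norml => /andP[j1 j2].
have g1' : (2 * (K * x1) + 2 * x1) * 3 < r by apply: le_lt_trans g2; lra.
have g2' : (2 * (K * x2) + 2 * x2) * 3 < r by apply: le_lt_trans g1; lra.
have x20 : 0 <= x2 by exact: nr_ge0.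
lra.
Unshelve. all: by end_near. Qed.

(** L_jk u need not lie in Dom G: its number form is bounded because its weighted value is one term
    of a nonnegative sum controlled by hypothesis (3), uniformly in m. *)
Lemma jump_bounded u j k : dom G u ->
  exists B : R, forall m, w j k * number_form m (C j (D k u)) <= B.
Proof.
move=> du; have [K K0 NK] := number_op_bounded du.
exists (b * number_sup u + 1 + 2 * (K * nr (G u))) => m.
have h := dissipative_partial m (maxn j k) du ltr01.
have [n [h1 h2]] := @filter_ex _ _ _ _ (filterI h NK).
have := h2 (G u); rewrite ler_norml => /andP[h3 _].
have : w j k * number_form m (C j (D k u)) <= jump_sum (number_form m) (maxn j k) u.
  apply: (square_sum_term (F := fun j k => w j k * number_form m (C j (D k u)))).
  - by move=> ? ?; rewrite mulr_ge0// number_form_ge0.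
  - exact: leq_maxl.
  - exact: leq_maxr.
lra.
Qed.

Lemma jump_cvg u j k : dom G u ->
  w j k * number_form m (C j (D k u)) @[m --> \oo] --> w j k * number_sup (C j (D k u)).
Proof.
(* For w(j,k) = 0 nothing bounds the number form of L_jk u, but the term vanishes. *)
move=> du; have [w_0|wn0] := eqVneq (w j k) 0.
  by rewrite w_0 mul0r; under eq_fun do rewrite mul0r; exact: cvg_cst.
have wp : 0 < w j k by rewrite lt_def wn0 w_ge0.
have [B hB] := jump_bounded j k du.
apply: cvgM; first exact: cvg_cst.
by apply: (@number_form_cvg _ _ _ _ (B / w j k)) => m; rewrite ler_pdivlMr// mulrC.
Qed.

Lemma jump_bound u j k : dom G u -> 0 < w j k ->
  forall m, number_form m (C j (D k u)) <= number_sup (C j (D k u)).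
Proof.
move=> du wp m; have [B hB] := jump_bounded j k du.
by apply: (@number_form_le_sup _ _ _ _ (B / w j k)) => i; rewrite ler_pdivlMr// mulrC.
Qed.

Lemma dissipative_limit u M (r : R) : dom G u -> 0 < r ->
  \forall n \near \oo, 2 * rdot (number_op n.+1 u) (G u) + jump_sum number_sup M u <=
    b * number_sup u + r.
Proof.
move=> du r0; have r2 : 0 < r / 2 by rewrite divr_gt0.
have h : jump_sum (number_form m) M u @[m --> \oo] --> jump_sum number_sup M u.
  by apply: cvg_square_sum => j k; exact: jump_cvg.
have /cvgrPdist_lt /(_ _ r2)[m _ /(_ m (leqnn m))] := h.
rewrite ltr_norml => /andP[_ h1].
apply: filterS (dissipative_partial m M du r2) => n; lra.
Qed.

(* The remainder [number_form (v - u)] is controlled by [|v - u| |G (v - u)|], which is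
   o(h) along the semigroup, although the number operator is not known to be
   bounded relatively to [G]. *)
Lemma number_sup_expand u M (r : R) : dom G u -> 0 < r ->
  exists2 K : R, 0 <= K & forall v, dom G v -> forall h : R, 0 <= h ->
  number_sup v <= number_sup u + h * (b * number_sup u - jump_sum number_sup M u +
    r) + 2 * (K * nr (v - u - h%:C%C *: G u))
    + w0^-1 * (2 * (nr (v - u) * nr (G (v - u)))).
Proof.
move=> du r0; have [K K0 NK] := number_op_bounded du; exists K => // v dv h h0.
have [dvu _] := operatorB dv du.
apply: number_sup_le_near; near \oo => n0; exists n0.+1 => // -[//|n] /= n0n.
have nn : (n0 <= n)%N by [].
have Nn : forall v, `|rdot (number_op n.+1 u) v| <= K * nr v.
  by move: n nn {n0n}; near: n0; case: NK => N _ NK; exists N => // p /= Np q pq;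
    apply: NK; exact: leq_trans pq.
have dn : 2 * rdot (number_op n.+1 u) (G u) + jump_sum number_sup M u <=
  b * number_sup u + r.
  move: n nn {n0n Nn}; near: n0; case: (dissipative_limit M du r0) => N _ NK'.
  by exists N => // p /= Np q pq; apply: NK'; exact: leq_trans pq.
have vE : v = u + (v - u) by rewrite addrC subrK.
rewrite {1}vE (number_form_expand DC).
have n1 : number_form n.+1 u <= number_sup u by apply: number_form_le_sup => m;
  exact: number_form_le_dissipation.
have n2 := number_form_le_graph n.+1 dvu.
(* In the cross term, v - u is h G u plus a remainder: hypothesis (3) handles the first part and the
   bound K the second. *)
have := Nn (v - u - h%:C%C *: G u); rewrite rdotBr rdotZr ler_norml => /andP[_ n3].
have := ler_wpM2l h0 dn; set j := jump_sum _ _ _; lra.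
Unshelve. all: by end_near. Qed.

(** Along the semigroup |v - u| tends to 0 while |G (v - u)| stays bounded, so this is continuity of
    the number form there. *)
Lemma number_sup_dist u : dom G u -> exists2 K : R, 0 <= K & forall v, dom G v ->
  `|number_sup v - number_sup u| <=
    2 * (K * nr (v - u)) + w0^-1 * (2 * (nr (v - u) * nr (G (v - u)))).
Proof.
move=> du; have [K K0 NK] := number_op_bounded du; exists K => // v dv.
have [dvu _] := operatorB dv du.
have E n : number_form n.+1 v = number_form n.+1 u +
  2 * rdot (number_op n.+1 u) (v - u) + number_form n.+1 (v - u).
  by rewrite -(number_form_expand DC) addrC subrK.
rewrite ler_norml; apply/andP; split.
  rewrite -subr_ge0.
  suff : number_sup u <= number_sup v + 2 * (K * nr (v - u)) +
    w0^-1 * (2 * (nr (v - u) * nr (G (v - u)))) by lra.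
  apply: number_sup_le_near; case: NK => N _ NK; exists N.+1 => // -[//|n] /= Nn.
  have /(_ (v - u)) := NK n Nn; rewrite ler_norml => /andP[h1 _].
  have h2 : number_form n.+1 v <= number_sup v by apply: number_form_le_sup => m;
    exact: number_form_le_dissipation.
  have h3 := number_form_ge0 D n.+1 (v - u); have h4 := number_form_le_graph n.+1 dvu.
  rewrite E in h2; lra.
suff : number_sup v <= number_sup u + 2 * (K * nr (v - u)) +
  w0^-1 * (2 * (nr (v - u) * nr (G (v - u)))) by lra.
apply: number_sup_le_near; case: NK => N _ NK; exists N.+1 => // -[//|n] /= Nn.
have /(_ (v - u)) := NK n Nn; rewrite ler_norml => /andP[_ h1].
have h2 : number_form n.+1 u <= number_sup u by apply: number_form_le_sup => m;
  exact: number_form_le_dissipation.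
have h4 := number_form_le_graph n.+1 dvu.
rewrite E; lra.
Qed.

Variable (Pt : R -> bop H).
Hypotheses (Psg : contraction_semigroup Pt) (Pgen : generator Pt G)
  (Gdense : dense (dom G)).

Lemma nr_Pt t u : 0 <= t -> nr (Pt t u) <= nr u.
Proof. by move=> t0; have := semigroup_contraction Psg u t0; rewrite !normE lecR. Qed.

Lemma PtD s t u : 0 <= s -> 0 <= t -> Pt (s + t) u = Pt s (Pt t u).
Proof. by move=> s0 t0; rewrite (semigroupD Psg). Qed.

Lemma Pt_generator s u : 0 <= s -> dom G u -> dom G (Pt s u) /\ G (Pt s u) = Pt s (G u).
Proof.
move=> s0 du; apply/Pgen.
have /Pgen h : dom G u /\ G u = G u by [].
apply/nr_cvgP => r r0; move/nr_cvgP : h => /(_ r r0) h; near=> t.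
have t0 : 0 <= t by apply: ltW; near: t; exact: nbhs_right_gt.
have ht : nr ((t^-1)%:C%C *: (Pt t u - u) - G u) < r by near: t.
apply: le_lt_trans ht; have -> : Pt t (Pt s u) = Pt s (Pt t u) by rewrite -!PtD// addrC.
rewrite -bopB -bopZ -bopB.
exact: nr_Pt.
Unshelve. all: by end_near. Qed.

Lemma Pt_diff u (r : R) : dom G u -> 0 < r ->
  \forall h \near 0^'+, nr (Pt h u - u - h%:C%C *: G u) <= r * h.
Proof.
move=> du r0; have /Pgen /nr_cvgP /(_ r r0) h : dom G u /\ G u = G u by [].
near=> t.
have t0 : 0 < t by near: t; exact: nbhs_right_gt.
have ht : nr ((t^-1)%:C%C *: (Pt t u - u) - G u) < r by near: t.
have -> : Pt t u - u - t%:C%C *: G u = t%:C%C *: ((t^-1)%:C%C *: (Pt t u - u) - G u).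
  by rewrite scalerBr scalerA -rmorphM divff ?gt_eqF// scale1r.
by rewrite nrZr gtr0_norm// mulrC ler_pM2r// ltW.
Unshelve. all: by end_near. Qed.

Lemma Pt_cont u (r : R) : 0 < r -> \forall h \near 0^'+, nr (Pt h u - u) < r.
Proof. by have /nr_cvgP := @semigroup_strong_cvg _ _ _ Psg u; apply. Qed.

Lemma Pt_lip u : dom G u -> \forall h \near 0^'+, nr (Pt h u - u) <= (nr (G u) + 1) * h.
Proof.
move=> du; near=> h.
have h0 : 0 < h by near: h; exact: nbhs_right_gt.
have hd : nr (Pt h u - u - h%:C%C *: G u) <= 1 * h by near: h; exact: Pt_diff.
rewrite -(subrK (h%:C%C *: G u) (Pt h u - u)); apply: le_trans (nrD _ _) _.
by rewrite nrZr gtr0_norm//; lra.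
Unshelve. all: by end_near. Qed.

Lemma number_sup_right u M (r : R) : dom G u -> 0 < r ->
  \forall h \near 0^'+, number_sup (Pt h u) <=
    number_sup u + h * (b * number_sup u - jump_sum number_sup M u + r).
Proof.
move=> du r0; have r3 : 0 < r / 3 by lra.
have [K K0 HK] := number_sup_expand M du r3.
have K1 : 0 < 2 * K + 1 by lra.
have G1 : 0 < w0^-1 * 2 * (nr (G u) +
  1) by rewrite !mulr_gt0 ?invr_gt0// ltr_pwDr ?nr_ge0.
have q1 := divr_gt0 r3 K1; have q2 := divr_gt0 r3 G1.
near=> h.
have h0 : 0 < h by near: h; exact: nbhs_right_gt.
have [dh Gh] := Pt_generator (ltW h0) du.
have := HK _ dh _ (ltW h0).
have h1 : nr (Pt h u - u - h%:C%C *: G u) <= r / 3 / (2 * K + 1) * h.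
  by near: h; exact: Pt_diff.
have h2 : nr (Pt h u - u) <= (nr (G u) + 1) * h by near: h; exact: Pt_lip.
have h3 : nr (Pt h (G u) - G u) < r / 3 / (w0^-1 * 2 * (nr (G u) + 1)).
  by near: h; exact: Pt_cont.
(* G (P_h u - u) = P_h G u - G u tends to 0 and |P_h u - u| = O(h): their product is o(h). *)
have [_ GhB] := operatorB dh du; rewrite GhB Gh.
set x1 := nr _ in h1 *; set x2 := nr _ in h2 *; set x3 := nr _ in h3 *.
have x10 : 0 <= x1 by exact: nr_ge0.
have x30 : 0 <= x3 by exact: nr_ge0.
have a1 : 2 * (K * x1) <= r / 3 * h.
  have : (2 * K + 1) * x1 <= r / 3 * h.
    by rewrite mulrC -ler_pdivlMr// mulrAC.
  lra.
have a2 : w0^-1 * (2 * (x2 * x3)) <= r / 3 * h.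
  have w1 : 0 < w0^-1 by rewrite invr_gt0.
  apply: (@le_trans _ _ (w0^-1 * (2 * ((nr (G u) + 1) * h * x3)))).
    by rewrite !ler_pM2l// ler_wpM2r.
  rewrite ltr_pdivlMr// in h3.
  have -> : w0^-1 * (2 * ((nr (G u) + 1) * h * x3)) =
    x3 * (w0^-1 * 2 * (nr (G u) + 1)) * h by ring.
  by rewrite ler_pM2r// ltW.
move/le_trans; apply; lra.
Unshelve. all: by end_near. Qed.

Lemma nr_right u (r : R) : dom G u -> 0 < r ->
  \forall h \near 0^'+, nr (Pt h u) ^+ 2 <= nr u ^+ 2 + h * (r - dissipation u).
Proof.
move=> du r0; have r2 : 0 < r / 2 by lra.
have U1 : 0 < 2 * nr u + 1 by have := nr_ge0 u; lra.
have G1 : 0 < nr (G u) + 1 by have := nr_ge0 (G u); lra.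
have q1 := divr_gt0 r2 U1; have q2 := divr_gt0 r2 G1.
near=> h.
have h0 : 0 < h by near: h; exact: nbhs_right_gt.
have h1 : nr (Pt h u - u - h%:C%C *: G u) <= r / 2 / (2 * nr u + 1) * h.
  by near: h; exact: Pt_diff.
have h2 : nr (Pt h u - u) <= (nr (G u) + 1) * h by near: h; exact: Pt_lip.
have h3 : nr (Pt h u - u) < r / 2 / (nr (G u) + 1) by near: h; exact: Pt_cont.
rewrite -{1}(subrK u (Pt h u)) addrC nr_sq_expand.
have := rdot_le u (Pt h u - u - h%:C%C *: G u).
rewrite rdotBr rdotZr ler_norml => /andP[_ h4].
set x1 := nr _ in h1 h4; set x2 := nr _ in h2 h3 *.
have x10 : 0 <= x1 by exact: nr_ge0.
have x20 : 0 <= x2 by exact: nr_ge0.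
have a1 : 2 * (nr u * x1) <= r / 2 * h.
  have : (2 * nr u + 1) * x1 <= r / 2 * h.
    by rewrite mulrC -ler_pdivlMr// mulrAC.
  lra.
have a2 : x2 ^+ 2 <= r / 2 * h.
  rewrite expr2; apply: (@le_trans _ _ (x2 * ((nr (G u) + 1) * h))).
    by rewrite ler_wpM2l.
  by rewrite mulrA ler_pM2r// -ler_pdivlMr// ltW.
rewrite /dissipation; lra.
Unshelve. all: by end_near. Qed.

(** * Comparison of a family 0 <= X_r <= 1 with the number form *)

Section maximum_principle.
(** In [X_dec] the jump series is cut at M, and [dissipation u - jump_energy M u] pays for the
    missing terms, since X_r <= 1. *)
Variable (X : R -> bop H).
Hypotheses
  (X_sym : forall (r : R) u v, 0 <= r -> rdot u (X r v) = rdot (X r u) v)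
  (X_ge0 : forall (r : R) u, 0 <= r -> 0 <= rdot u (X r u))
  (X_le : forall (r : R) u, 0 <= r -> rdot u (X r u) <= nr u ^+ 2)
  (X_0 : forall u, X 0 u = 0)
  (X_cont : forall (r : R) u v (q : R), 0 <= r -> 0 < q -> exists2 h0 : R, 0 < h0 &
     forall s : R, 0 <= s -> `|s - r| < h0 -> `|rdot u (X s v) - rdot u (X r v)| < q)
  (X_dec : forall (r : R) u M (q : R), 0 < r -> dom G u -> 0 < q ->
     \forall h \near 0^'+, rdot u (X r u) - h * (2 * rdot (X r u) (G u) +
       (dissipation u - jump_energy M u) + jump_sum (fun y => rdot y (X r y)) M u +
         q) <=
       rdot u (X (r - h) u)).

Lemma psd_family_CS r u v : 0 <= r ->
  rdot u (X r v) ^+ 2 <= rdot u (X r u) * rdot v (X r v).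
Proof. by move=> r0; apply: psd_CS => [x y|x]; [exact: X_sym|exact: X_ge0]. Qed.

Lemma psd_family_bound r u v : 0 <= r -> `|rdot u (X r v)| <= nr u * nr v.
Proof.
move=> r0; rewrite -(@ler_pXn2r _ 2) ?nnegrE ?normr_ge0 ?mulr_ge0 ?nr_ge0//.
rewrite -normrX ger0_norm ?sqr_ge0// exprMn (le_trans (psd_family_CS _ _ r0))//.
by rewrite ler_pM ?X_ge0 ?X_le.
Qed.

(** Letting u move with the semigroup produces + 2 h <X_r u, G u> and cancels the corresponding term
    of [X_dec]. The second-order term is nonnegative and is dropped. *)
Lemma psd_family_right r u M (q : R) : 0 < r -> dom G u -> 0 < q ->
  \forall h \near 0^'+, rdot u (X r u) - h * ((dissipation u - jump_energy M u) +
      jump_sum (fun y => rdot y (X r y)) M u + q) <= rdot (Pt h u) (X (r - h) (Pt h u)).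
Proof.
(* A third of q goes to [X_dec], a third to the remainder of P_h u, and twice q / 6 to replacing
   X_(r-h) by X_r. *)
move=> r0 du q0; have q3 : 0 < q / 3 by lra.
have q6 : 0 < q / 6 by lra.
have U1 : 0 < 2 * nr u + 1 by have := nr_ge0 u; lra.
have q1 := divr_gt0 q3 U1.
have [h0 h00 Xc] := X_cont (G u) u (ltW r0) q6.
near=> h.
have hp : 0 < h by near: h; exact: nbhs_right_gt.
have hr : h < r by near: h; exact: nbhs_right_lt.
have hh0 : h < h0 by near: h; exact: nbhs_right_lt.
have h1 : nr (Pt h u - u - h%:C%C *: G u) <= q / 3 / (2 * nr u + 1) * h.
  by near: h; exact: Pt_diff.
have h2 : rdot u (X r u) - h * (2 * rdot (X r u) (G u) +
       (dissipation u - jump_energy M u) + jump_sum (fun y => rdot y (X r y)) M u +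
         q / 3) <=
       rdot u (X (r - h) u) by near: h; exact: X_dec.
have rh0 : 0 <= r - h by rewrite subr_ge0 ltW.
have h3 : `|rdot (G u) (X (r - h) u) - rdot (G u) (X r u)| < q / 6.
  by apply: Xc => //; rewrite addrC addKr normrN gtr0_norm.
set v := Pt h u in h1 *.
have vE : v = u + (v - u) by rewrite addrC subrK.
have -> : rdot v (X (r - h) v) = rdot u (X (r - h) u) + 2 * rdot (v - u) (X (r - h) u)
   + rdot (v - u) (X (r - h) (v - u)).
  rewrite {1 2}vE bopD rdotDl !rdotDr (X_sym u (v - u) rh0).
  by rewrite (rdotC (X (r - h) u)); ring.
have h4 := X_ge0 (v - u) rh0.
have := psd_family_bound (v - u - h%:C%C *: G u) u rh0.
rewrite rdotBl rdotZl ler_norml => /andP[h5 _].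
have a1 : 2 * (nr (v - u - h%:C%C *: G u) * nr u) <= q / 3 * h.
  have := nr_ge0 (v - u - h%:C%C *: G u).
  set x1 := nr _ in h1 *; move=> x10.
  have : (2 * nr u + 1) * x1 <= q / 3 * h.
    by rewrite mulrC -ler_pdivlMr// mulrAC.
  lra.
move: h3; rewrite ltr_norml => /andP[h3 _].
have h3' : h * (rdot (G u) (X r u) - q / 6) <= h * rdot (G u) (X (r - h) u).
  by rewrite ler_pM2l//; lra.
rewrite (rdotC (X r u)) in h2; lra.
Unshelve. all: by end_near. Qed.

Section fixed_slope.
Variables (eps t0 lam : R).
Hypotheses (eps_gt0 : 0 < eps) (lamE : lam = 2 * b + 1)
  (t0_le : lam * t0 <= 1).

(** The slope is eps lam = 2 eps b + eps. As a <= 2 eps on [0, t0], the part 2 eps b absorbs the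
    growth rate a b from hypothesis (3), and eps is left to pay for lowering mu. *)
Definition coef r : R := eps * (1 + lam * r).
Local Notation a := coef.

(** Quantifying over the bounds B asks nothing of vectors with infinite number form, where
    [number_sup] would misleadingly be 0. *)
Definition dominated (mu : R) := forall r, 0 <= r <= t0 -> forall v (B : R),
  (forall m, number_form m v <= B) -> rdot v (X r v) <= mu * nr v ^+ 2 + a r * B.

Lemma lam_gt0 : 0 < lam.
Proof. by rewrite lamE; have := b_gt0; lra. Qed.

Lemma coef_bounds r : 0 <= r <= t0 -> 0 <= a r <= 2 * eps.
Proof.
move=> /andP[r0 rt]; have l0 := lam_gt0.
have h1 : 0 <= lam * r by rewrite mulr_ge0// ltW.
have h2 : lam * r <= 1 by apply: le_trans t0_le; rewrite ler_pM2l.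
have h3 : 0 <= 1 + lam * r by lra.
rewrite mulr_ge0 ?(ltW eps_gt0)//=.
by rewrite /coef mulrC ler_pM2r//; lra.
Qed.

Section step.
Variables (mu mu' : R).
Hypotheses (mu'0 : 0 <= mu') (mu'mu : mu' <= mu) (mu_step : c * (mu - mu') <= eps)
  (dmu : dominated mu).

(** [dominated] is applied at the vectors L_jk u, whose number forms are bounded whenever w(j,k) >
    0. *)
Lemma jump_sum_dominated r u M : 0 <= r <= t0 -> dom G u ->
  jump_sum (fun y => rdot y (X r y)) M u <=
    mu * jump_energy M u + a r * jump_sum number_sup M u.
Proof.
move=> rt du; rewrite /jump_energy /jump_sum -!square_sumM -square_sumD.
apply: le_square_sum => j k.
have [w_0|wn0] := eqVneq (w j k) 0; first by rewrite w_0 !mul0r !mulr0 addr0.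
have wp : 0 < w j k by rewrite lt_def wn0 w_ge0.
have h := dmu rt (jump_bound du wp).
have := ler_wpM2l (ltW wp) h; lra.
Qed.

Variables (t : R) (xi : H).
Hypotheses (tt0 : 0 <= t <= t0) (dxi : dom G xi).

Local Notation uu s := (Pt s xi).
Definition gap s : R := rdot (uu s) (X (t - s) (uu s)) - mu' * nr (uu s) ^+ 2 - a (t
  - s) * number_sup (uu s).
Local Notation g := gap.

Lemma gap_right s (q : R) : 0 <= s < t -> 0 < q ->
  \forall h \near 0^'+, g s - q * h <= g (s + h).
Proof.
have H1 := mu'0; have H2 := mu'mu; have H3 := eps_gt0; have H4 := b_gt0; have H5 := tt0.
move=> /andP[s0 st] q0.
have [du Gu] := Pt_generator s0 dxi.
have l0 := lam_gt0.
pose r := t - s; have r0 : 0 < r by rewrite /r subr_gt0.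
have rt : 0 <= r <= t0 by move: tt0; rewrite /r; lra.
have [a0 a2] := andP (coef_bounds rt).
(* N collects the multiples of q1 lost below: two for the cut at M and [psd_family_right], mu' for
   [nr_right], at most 2 eps for [number_sup_right], eps lam for the number form at time h, and one
   to spare. *)
pose N := 3 + mu' + 2 * eps + eps * lam.
have el : 0 < eps * lam by rewrite mulr_gt0.
have N0 : 0 < N by rewrite /N; lra.
pose q1 := q / N; have q10 : 0 < q1 by rewrite divr_gt0.
have /cvgrPdist_lt /(_ _ q10)[M _ /(_ M (leqnn M))] := jump_energy_cvg du.
rewrite ltr_norml => /andP[_ PM].
have [K K0 Kd] := number_sup_dist du.
near=> h.
have hp : 0 < h by near: h; exact: nbhs_right_gt.
have [dv Gv] := Pt_generator (ltW hp) du.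
have uE : uu (s + h) = Pt h (uu s) by rewrite addrC PtD// ltW.
have h1 : rdot (uu s) (X r (uu s)) - h * ((dissipation (uu s) - jump_energy M (uu s)) +
      jump_sum (fun y => rdot y (X r y)) M (uu s) + q1) <=
      rdot (Pt h (uu s)) (X (r - h) (Pt h (uu s))) by near: h; exact: psd_family_right.
have h2 : nr (Pt h (uu s)) ^+ 2 <= nr (uu s) ^+ 2 + h * (q1 - dissipation (uu s)).
  by near: h; exact: nr_right.
have h3 : number_sup (Pt h (uu s)) <=
  number_sup (uu s) + h * (b * number_sup (uu s) - jump_sum number_sup M (uu s) + q1).
  by near: h; exact: number_sup_right.
have h4 : number_sup (uu s) - q1 <= number_sup (Pt h (uu s)).
  have k1 : nr (Pt h (uu s) - uu s) < Num.min 1 (q1 / (2 * K + w0^-1 * 2 + 1)).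
    near: h; apply: Pt_cont; rewrite lt_min ltr01 divr_gt0//.
    by rewrite ltr_pwDr// addr_ge0 ?mulr_ge0 ?invr_ge0// ltW.
  have k2 : nr (Pt h (G (uu s)) - G (uu s)) < 1 by near: h; exact: Pt_cont.
  have := Kd _ dv; rewrite ler_norml => /andP[k3 _].
  have [_ GvB] := operatorB dv du; rewrite GvB Gv in k3.
  move: k1; rewrite lt_min => /andP[_].
  set x1 := nr _ in k3 *; set x2 := nr _ in k2 k3.
  have x10 : 0 <= x1 by exact: nr_ge0.
  have x20 : 0 <= x2 by exact: nr_ge0.
  have w1 : 0 < w0^-1 by rewrite invr_gt0.
  rewrite ltr_pdivlMr; last by lra.
  move=> k1; have : w0^-1 * (2 * (x1 * x2)) <= w0^-1 * (2 * x1).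
    by rewrite !ler_pM2l// ler_piMr// ltW.
  lra.
have h5 := jump_sum_dominated M rt du.
have h6 := jump_energy_le M du.
have h7 := dissipation_le_number_sup du.
have ns0 : 0 <= number_sup (uu s) by apply: number_sup_ge0 => m;
  exact: number_form_le_dissipation.
have h8 : (mu - mu') * dissipation (uu s) <= eps * number_sup (uu s).
  apply: (@le_trans _ _ ((mu - mu') * (c * number_sup (uu s)))).
    by rewrite ler_wpM2l// subr_ge0.
  by rewrite mulrA (mulrC _ c) ler_wpM2r.
have h9 : a r * (b * number_sup (uu s)) <= 2 * eps * (b * number_sup (uu s)).
  by rewrite ler_wpM2r// mulr_ge0// ltW.
have h10 : mu * jump_energy M (uu s) <= mu * dissipation (uu s).
  by rewrite ler_wpM2l// (le_trans mu'0).
rewrite /gap uE opprD addrA -/r.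
have aE : a (r - h) = a r - eps * lam * h by rewrite /coef; ring.
have i2 := ler_wpM2l mu'0 h2.
have i3 := ler_wpM2l a0 h3.
have i4 := ler_wpM2l (ltW (mulr_gt0 el hp)) h4.
have qE : q = N * q1 by rewrite /q1 mulrC divfK// gt_eqF.
have i5 : a r * q1 <= 2 * eps * q1 by rewrite ler_pM2r.
(* The terms a(r) [jump_sum number_sup] cancel. What remains to be paid is (mu - mu') [dissipation]
   <= eps n and a(r) b n <= 2 eps b n, which the slope of a provides. *)
have key : - (N * q1) <= - (dissipation (uu s) - jump_energy M (uu s) +
  jump_sum (fun y => rdot y (X r y)) M (uu s) + q1)
  + mu' * (dissipation (uu s) - q1) - a r * (b * number_sup (uu s) - jump_sum
    number_sup M (uu s) + q1)
  + eps * lam * (number_sup (uu s) - q1).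
  have lamns : eps * lam * number_sup (uu s) = 2 * eps * (b * number_sup (uu s)) +
    eps * number_sup (uu s).
    by rewrite lamE; ring.
  rewrite /N; lra.
have := ler_wpM2l (ltW hp) key.
rewrite aE qE; lra.
Unshelve. all: by end_near. Qed.

Lemma gap_left s (q : R) : 0 < s <= t -> 0 < q ->
  \forall h \near 0^'+, g (s - h) - q <= g s.
Proof.
have H1 := mu'0; have H2 := mu'mu; have H3 := eps_gt0; have H4 := b_gt0; have H5 := tt0.
move=> /andP[s0 st] q0.
have [du Gu] := Pt_generator (ltW s0) dxi.
have l0 := lam_gt0.
pose r := t - s; have r0 : 0 <= r by rewrite /r subr_ge0.
have rt : 0 <= r <= t0 by move: tt0; rewrite /r; lra.
have [a0 a2] := andP (coef_bounds rt).
have [K K0 Kd] := number_sup_dist du.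
have q2 : 0 < q / 2 by lra.
have [h0 h00 Xc] := X_cont (uu s) (uu s) r0 q2.
have w1 : 0 < w0^-1 by rewrite invr_gt0.
(* N bounds the change of the three terms of [gap] per unit of |u(s-h) - u(s)|; the other half of q
   is for the continuity of X. *)
pose N := 2 * nr xi + mu' * (2 * nr xi) + a r * (2 * K + w0^-1 * 2) + 1.
have xi0 := nr_ge0 xi.
have m1 : 0 <= mu' * (2 * nr xi) by rewrite mulr_ge0// mulr_ge0.
have m2 : 0 <= a r * (2 * K + w0^-1 * 2) by rewrite mulr_ge0//; lra.
have N0 : 0 < N by rewrite /N; lra.
near=> h.
have hp : 0 < h by near: h; exact: nbhs_right_gt.
have hs : h < s by near: h; exact: nbhs_right_lt.
have hh0 : h < h0 by near: h; exact: nbhs_right_lt.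
have sh0 : 0 <= s - h by rewrite subr_ge0 ltW.
have [dv Gv] := Pt_generator sh0 dxi.
(* Contractivity of P_(s-h) reduces left increments at s to right increments at 0. *)
have uE : uu s = Pt (s - h) (Pt h xi) by rewrite -PtD ?subrK// ltW.
have [dh Gh] := Pt_generator (ltW hp) dxi.
have k1 : nr (uu s - uu (s - h)) < q / 2 / N.
  rewrite uE -bopB; apply: le_lt_trans (nr_Pt _ sh0) _.
  by near: h; apply: Pt_cont; rewrite divr_gt0.
have k2 : nr (G (uu (s - h) - uu s)) < 1.
  have [_ ->] := operatorB dv du; rewrite Gv Gu.
  have -> : Pt s (G xi) = Pt (s - h) (Pt h (G xi)) by rewrite -PtD ?subrK// ltW.
  rewrite -bopB; apply: le_lt_trans (nr_Pt _ sh0) _.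
  by rewrite nrB; near: h; exact: Pt_cont.
have nus : nr (uu s) <= nr xi by rewrite nr_Pt// ltW.
have nvs : nr (uu (s - h)) <= nr xi by rewrite nr_Pt.
have := Kd _ dv; rewrite ler_norml => /andP[k3 _].
rewrite nrB in k1.
set x1 := nr (uu (s - h) - uu s) in k1 k3; set x2 := nr (G _) in k2 k3.
have x10 : 0 <= x1 by exact: nr_ge0.
have x20 : 0 <= x2 by exact: nr_ge0.
have k4 : w0^-1 * (2 * (x1 * x2)) <= w0^-1 * (2 * x1).
  by rewrite !ler_pM2l// ler_piMr// ltW.
have rh0 : 0 <= r + h by rewrite addr_ge0// ltW.
have k5 : `|rdot (uu s) (X (r + h) (uu s)) - rdot (uu s) (X r (uu s))| < q / 2.
  by apply: Xc => //; rewrite addrC addKr gtr0_norm.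
set v := uu (s - h) in dv nvs k3 *.
have k6 : rdot v (X (r + h) v) - rdot (uu s) (X (r + h) (uu s)) <= x1 * (2 * nr xi).
  have -> : rdot v (X (r + h) v) - rdot (uu s) (X (r + h) (uu s)) =
     rdot (v - uu s) (X (r + h) (v + uu s)).
    rewrite bopD rdotBl !rdotDr (X_sym v (uu s) rh0) (rdotC (X (r + h) v)); ring.
  apply: le_trans (ler_norm _) _; apply: le_trans (psd_family_bound _ _ rh0) _.
  rewrite ler_wpM2l//; apply: le_trans (nrD _ _) _; lra.
have k7 : nr (uu s) ^+ 2 - nr v ^+ 2 <= x1 * (2 * nr xi).
  have := nr_dist (uu s) v; rewrite nrB -/x1 ler_norml => /andP[_ k7].
  rewrite subr_sqr; apply: (@le_trans _ _ (x1 * (nr (uu s) + nr v))).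
    by rewrite ler_wpM2r// addr_ge0// nr_ge0.
  by rewrite ler_wpM2l//; lra.
have ns0 : 0 <= number_sup v by apply: number_sup_ge0 => m;
  exact: number_form_le_dissipation.
(* The increase of a makes [gap] at s - h smaller, which is the favourable direction. *)
have aE : a (r + h) * number_sup v = a r * number_sup v +
  eps * lam * h * number_sup v by rewrite /coef; ring.
have al : 0 <= eps * lam * h * number_sup v by rewrite !mulr_ge0// ltW.
have tE : t - (s - h) = r + h by rewrite /r; ring.
rewrite /gap -/v tE aE -/r.
have i7 := ler_wpM2l mu'0 k7.
have i3 : a r * (number_sup (uu s) - number_sup v) <= a r * ((2 * K + w0^-1 * 2) * x1).
  by rewrite ler_wpM2l//; lra.
move: k5; rewrite ltr_norml => /andP[_ k5].
have k1' : x1 * N < q / 2 by rewrite -ltr_pdivlMr.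
rewrite /N in k1'; lra.
Unshelve. all: by end_near. Qed.

Lemma dominated_on_domain : rdot xi (X t xi) <= mu' * nr xi ^+ 2 + a t * number_sup xi.
Proof.
have H1 := mu'0; have H2 := mu'mu; have H3 := eps_gt0; have H4 := b_gt0; have H5 := tt0.
have [t00 _] := andP tt0.
have gt : g t <= 0.
  rewrite /gap subrr X_0 rdot0r sub0r.
  have a0 : 0 <= a 0 by rewrite /coef mulr0 addr0 mulr1 ltW.
  have [du _] := Pt_generator t00 dxi.
  have ns0 : 0 <= number_sup (uu t) by apply: number_sup_ge0 => m;
    exact: number_form_le_dissipation.
  have := mulr_ge0 a0 ns0; have := mulr_ge0 mu'0 (sqr_ge0 (nr (uu t))); lra.
have := dini_le t00 gap_right gap_left.
rewrite {1}/gap (semigroup0 Psg) subr0 => h.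
have := le_trans h gt; rewrite -[bop1 xi]/xi; lra.
Qed.

End step.

(** Truncations lie in Dom G and increase neither the norm nor the number form, so they carry the
    estimate from Dom G to the vectors that the next step needs. *)
Lemma dominated_step (mu mu' : R) : 0 <= mu' -> mu' <= mu -> c * (mu - mu') <= eps ->
  dominated mu -> dominated mu'.
Proof.
move=> h1 h2 h3 h4 r rt v B vB.
have tc : trunc e n v @[n --> \oo] --> v by apply/nr_cvgP => ? ?; exact: trunc_cvg.
have xc : rdot (trunc e n v) (X r (trunc e n v)) @[n --> \oo] --> rdot v (X r v).
  by apply: rdot_cvg => //; exact: bop_cvg.
rewrite -(cvg_lim _ xc)//; apply: limr_le; first by apply/cvg_ex;
  exists (rdot v (X r v)).
apply: nearW => n.
have dn : dom G (trunc e n v) by apply: Gspan; exact: trunc_span.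
apply: le_trans (dominated_on_domain h1 h2 h3 h4 rt dn) _.
have [a0 _] := andP (coef_bounds rt).
apply: lerD.
  by rewrite ler_wpM2l// ler_pXn2r ?nnegrE ?nr_ge0//; exact: nr_trunc_le.
rewrite ler_wpM2l//; apply: number_sup_le => m.
by apply: le_trans (vB m); exact: (number_form_trunc_le eO eD De Ce DC).
Qed.

Lemma dominated0 : dominated 0.
Proof.
have d1 : dominated 1.
  move=> r rt v B vB; have [r0 _] := andP rt; have [a0 _] := andP (coef_bounds rt).
  have B0 : 0 <= B by apply: le_trans (vB 0); exact: number_form_ge0.
  have := X_le v r0; have := mulr_ge0 a0 B0; lra.
(* The largest decrease of mu that one step allows. *)
pose kap := eps / c; have c0 := c_gt0; have kap0 : 0 < kap by rewrite divr_gt0.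
have h n : dominated (Num.max 0 (1 - n%:R * kap)).
  elim: n => [|n ih]; first by rewrite mul0r subr0 max_r.
  apply: (dominated_step _ _ _ ih).
  - by rewrite le_max lexx.
  - by rewrite ge_max !le_max lexx /= lerD2l lerN2 ler_pM2r// ler_nat leqnSn orbT.
  - rewrite -ler_pdivlMl// (_ : c^-1 * eps = kap); last by rewrite mulrC.
    rewrite lerBlDr.
    set mx := Num.max 0 (1 - n.+1%:R * kap).
    have m1 : 0 <= mx by rewrite le_max lexx.
    have m2 : 1 - n.+1%:R * kap <= mx by rewrite le_max lexx orbT.
    rewrite -natr1 mulrDl in m2.
    by rewrite ge_max; apply/andP; split; lra.
have [n hn] : exists n : nat, 1 <= n%:R * kap.
  by exists (Num.truncn kap^-1).+1; rewrite -ler_pdivrMr// div1r ltW// truncnS_gt.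
by have := h n; rewrite max_l// subr_le0.
Qed.

End fixed_slope.

Lemma psd_family_zero (r : R) : 0 <= r <= (2 * b + 1)^-1 -> X r = 0.
Proof.
move=> rt; have [r0 _] := andP rt.
have b1 : 0 < 2 * b + 1 by have := b_gt0; lra.
have x0 u : dom G u -> X r u = 0.
  move=> du; have x_le : rdot u (X r u) <= 0.
    apply/ler_addgt0Pr => q q0; rewrite add0r.
    have n0 : 0 <= number_sup u by apply: number_sup_ge0 => m;
      exact: number_form_le_dissipation.
    have n1 : 0 < 2 * (number_sup u + 1) by lra.
    (* Chosen so that 2 eps n(u) <= q; the added one keeps the denominator positive. *)
    pose eps := q / (2 * (number_sup u + 1)); have eps0 : 0 < eps by rewrite divr_gt0.
    have lt0 : (2 * b + 1) * (2 * b + 1)^-1 <= 1 by rewrite divff// gt_eqF.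
    have := dominated0 eps0 erefl lt0 rt (fun m => number_form_le_sup m (fun i =>
      number_form_le_dissipation i du)).
    rewrite mul0r add0r => /le_trans; apply.
    have /andP[_ a2] := coef_bounds eps0 erefl lt0 rt.
    apply: (@le_trans _ _ (2 * eps * number_sup u)); first by rewrite ler_wpM2r.
    have qE : eps * (2 * (number_sup u + 1)) = q by rewrite divfK ?gt_eqF.
    lra.
  (* By Cauchy-Schwarz for the positive form of X_r, <u, X_r u> = 0 forces X_r u = 0. *)
  apply: inner_ext => z; rewrite rdot0r; apply/eqP;
    rewrite -sqrf_eq0 eq_le sqr_ge0 andbT.
  apply: le_trans (psd_family_CS z u r0) _.
  by rewrite mulr_ge0_le0 ?X_ge0.
apply: bop_ext => v; apply: nr_eq0; apply/eqP; rewrite eq_le nr_ge0 andbT.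
suff h : forall y, dom G y -> nr (X r y) <= nr ((0 : bop H) y).
  by apply: le_trans (bop_dense_le Gdense h v) _; rewrite -[(0 : bop H) v]/(0 : H) nr0.
by move=> y /x0 ->; exact: lexx.
Qed.

End maximum_principle.

End admissible_generator.

Lemma cRe_cvg (R : realType) (U : Type) (F : set_system U) {FF : Filter F} (z : U ->
  R[i]) (l : R[i]) :
  (z x @[x --> F] --> l) -> cRe (z x) @[x --> F] --> cRe l.
Proof.
move=> /cvgrPdist_lt h; apply/cvgrPdist_lt => q q0.
have qC : (0 : R[i]) < q%:C%C by rewrite ltcR.
apply: filterS (h _ qC) => x hx; rewrite -cReB -ltcR.
by apply: le_lt_trans hx; exact: cRe_norm_le.
Qed.

(** * The defect 1 - T_r(1) *)

Section symmetric.
Context {R : realType} {H : innerModType R}.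
Variable A : bop H.
Hypothesis A_sym : forall x y, rdot x (A y) = rdot (A x) y.

Lemma sym_sq_diff x y : rdot x (A x) - rdot y (A y) = rdot (x - y) (A (x + y)).
Proof. by rewrite bopD rdotBl !rdotDr (A_sym x y) (rdotC (A x)); ring. Qed.

Lemma sym_polar x y : rdot x (A y) =
  4^-1 * (rdot (x + y) (A (x + y)) - rdot (x - y) (A (x - y))).
Proof.
rewrite sym_sq_diff.
have -> : x + y - (x - y) = y + y by rewrite opprB addrC addrA subrK.
have -> : x + y + (x - y) = x + x by rewrite addrACA subrr addr0.
by rewrite bopD rdotDr !rdotDl A_sym (rdotC y); field.
Qed.

End symmetric.

Section defect.
Context {R : realType} {H : innerModType R}.
Variables (D C : nat -> bop H) (w : nat -> nat -> R) (G : operator H).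
Hypotheses (DC : forall k, is_adj (D k) (C k)) (w_ge0 : forall j k, 0 <= w j k)
  (Gadm : forall u, dom G u -> exists v,
     (weighted_op D C w n u @[n --> \oo] --> v) /\ 2 * rdot u (G u) = - rdot u v)
  (Gdense : dense (dom G)).
Implicit Types (u v x y : H) (r s : R) (m n M : nat).

Local Notation jump_energy := (jump_energy D C w).
Local Notation jump_sum := (jump_sum D C w).

Variable (T : R -> bop H -> bop H).
Hypotheses (Tqds : qds T) (Teq : qds_equation w G (fun j k => C j \ob D k) T).

Definition defect (r : R) : bop H := bop1 - T r bop1.
Local Notation X := defect.

(** Complete positivity with a single pair X = Y = 1. *)
Lemma T1_ge0 r : 0 <= r -> bop_ge0 (T r bop1).
Proof.
move=> r0; have := qds_cp Tqds (fun _ : 'I_1 => bop1) (fun _ => bop1) r0.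
rewrite !big_ord1; have -> : bop_adj bop1 = bop1 :> bop H by apply: bop_adjP => x y.
have -> : bop1 \ob bop1 = bop1 :> bop H by exact: bop_ext.
by have -> : bop1 \ob T r bop1 \ob bop1 = T r bop1 by exact: bop_ext.
Qed.

Lemma ge0_rdot (A : bop H) u : bop_ge0 A -> 0 <= rdot u (A u).
Proof. by move=> /(_ u) /ge0C[_]. Qed.

Lemma defect_ge0 r : 0 <= r -> bop_ge0 (X r).
Proof. by move=> r0; exact: qds_le1. Qed.

Lemma defectE r u : X r u = u - T r bop1 u.
Proof. by []. Qed.

Lemma rdot_T1 r u v : rdot u (T r bop1 v) = rdot u v - rdot u (X r v).
Proof. by rewrite defectE rdotBr subKr. Qed.

Lemma defect_le r u : 0 <= r -> rdot u (X r u) <= nr u ^+ 2.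
Proof.
move=> r0; rewrite defectE rdotBr rdot_nr gerBl.
exact/ge0_rdot/T1_ge0.
Qed.

Lemma defect_bound r u v : 0 <= r -> `|rdot u (X r v)| <= nr u * nr v.
Proof.
move=> r0; apply: psd_family_bound => // [q x y q0|q x q0|q x q0].
- exact/ge0_rdot_sym/defect_ge0.
- exact/ge0_rdot/defect_ge0.
- exact: defect_le.
Qed.

(** By the equation at the identity, <u, X_r u> is minus the integral of [I u] over [0, r]. *)
Let I u (s : R) : R := cRe (qds_integrand w G (fun j k => C j \ob D k) T bop1 u u s).

Lemma jump_lim u s : dom G u -> 0 <= s ->
  jump_sum (fun y => rdot y (T s bop1 y)) n u @[n --> \oo] -->
  I u s - 2 * rdot (T s bop1 u) (G u).
Proof.
move=> du s0; have [/(_ s s0) cj _ _] := Teq bop1 du du s0.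
have -> : I u s - 2 * rdot (T s bop1 u) (G u) =
   cRe (limn (jump_form w (fun j k => C j \ob D k) (T s bop1) u u)).
  rewrite /I /qds_integrand !cReD -![cRe (inner _ _)]/(rdot _ _).
  rewrite (ge0_rdot_sym (T1_ge0 s0)) (rdotC (G u)); ring.
have -> : (fun n => jump_sum (fun y => rdot y (T s bop1 y)) n u) =
    (fun n => cRe (jump_form w (fun j k => C j \ob D k) (T s bop1) u u n)).
  apply/funext => n; rewrite /jump_form /square_sum cRe_sum; apply: eq_bigr => j _.
  by rewrite cRe_sum; apply: eq_bigr => k _; rewrite cRe_rM.
exact: cRe_cvg cj.
Qed.

Lemma jump_sum_T1 s u n : jump_sum (fun y => rdot y (T s bop1 y)) n u =
  jump_energy n u - jump_sum (fun y => rdot y (X s y)) n u.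
Proof.
apply/eqP; rewrite eq_sym subr_eq -square_sumD; apply/eqP; apply: eq_bigr => j _.
by apply: eq_bigr => k _; rewrite rdot_T1 -mulrDr subrK rdot_nr.
Qed.

(** The jump sums of T_s(1) are nondecreasing in M, so each bounds its limit from below; writing
    T_s(1) = 1 - X_s turns the cut into the deficit [dissipation G u - jump_energy M u]. *)
Lemma integrand_lower u s M : dom G u -> 0 <= s ->
  - I u s <= 2 * rdot (X s u) (G u) + (dissipation G u - jump_energy M u) +
    jump_sum (fun y => rdot y (X s y)) M u.
Proof.
move=> du s0; have h := jump_lim du s0.
have : jump_sum (fun y => rdot y (T s bop1 y)) M u <=
  I u s - 2 * rdot (T s bop1 u) (G u).
  rewrite -(cvg_lim _ h)//; apply: nondecreasing_cvgn_le.
    move=> i j ij; apply: square_sum_mono => // p q; rewrite mulr_ge0//.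
    exact/ge0_rdot/T1_ge0.
  by apply/cvg_ex; eexists; exact: h.
rewrite jump_sum_T1 rdotC rdot_T1 (rdotC (G u) (X s u)) (rdotC (G u) u) /dissipation;
  lra.
Qed.

(** As 0 <= T_s(1) <= 1, the jump part lies between 0 and the dissipation. The bound is uniform in
    s, so <u, X_s u> is Lipschitz in s. *)
Lemma integrand_bound u s : dom G u -> 0 <= s ->
  `|I u s| <= 2 * (nr u * nr (G u)) + dissipation G u.
Proof.
move=> du s0; have h := jump_lim du s0.
have h1 : 0 <= I u s - 2 * rdot (T s bop1 u) (G u).
  rewrite -(cvg_lim _ h)//; apply: limr_ge; first by apply/cvg_ex; eexists; exact: h.
  by apply: nearW => n; apply: jump_sum_ge0 => // y; exact/ge0_rdot/T1_ge0.
have h2 : I u s - 2 * rdot (T s bop1 u) (G u) <= dissipation G u.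
  rewrite -(cvg_lim _ h)//; apply: limr_le; first by apply/cvg_ex; eexists; exact: h.
  apply: nearW => n; rewrite jump_sum_T1;
    apply: le_trans (jump_energy_le DC w_ge0 Gadm n du).
  by rewrite gerBl; apply: jump_sum_ge0 => // y; exact/ge0_rdot/defect_ge0.
have h3 : `|rdot (G u) (T s bop1 u)| <= nr (G u) * nr u.
  rewrite -(@ler_pXn2r _ 2) ?nnegrE ?normr_ge0 ?mulr_ge0 ?nr_ge0//.
  rewrite -normrX ger0_norm ?sqr_ge0// exprMn.
  have := @psd_CS _ _ (T s bop1) (G u) u (ge0_rdot_sym (T1_ge0 s0))
     (fun x => ge0_rdot x (T1_ge0 s0)) => /le_trans; apply.
  have T1le x : rdot x (T s bop1 x) <= nr x ^+ 2.
    by rewrite rdot_T1 rdot_nr gerBl; exact/ge0_rdot/defect_ge0.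
  by rewrite ler_pM// ?T1le//; exact/ge0_rdot/T1_ge0.
rewrite (rdotC (T s bop1 u)) in h1 h2.
move: h3; rewrite ler_norml => /andP[h3 h4].
have := dissipation_ge0 DC w_ge0 Gadm du => P0.
by rewrite ler_norml; apply/andP; split; lra.
Qed.

Lemma defect_increment u s r (k1 k2 : R) : dom G u -> 0 <= s <= r ->
  (forall t, s <= t <= r -> k1 <= - I u t <= k2) ->
  k1 * (r - s) <= rdot u (X r u) - rdot u (X s u) <= k2 * (r - s).
Proof.
move=> du /andP[s0 sr] hI; have r0 := le_trans s0 sr.
have [_ [ir _] er] := Teq bop1 du du r0.
have [_ _ es] := Teq bop1 du du s0.
have xE t : 0 <= t -> rdot u (X t u) = - \int[lebesgue_measure]_(x in `[0, t]) I u x.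
  move=> t0; have [_ _ et] := Teq bop1 du du t0.
  by rewrite defectE rdotBr {2}/rdot et cReD -/(rdot u u) opprD addrA subrr sub0r.
rewrite !xE//.
have irs : lebesgue_measure.-integrable `]s, r]%classic (EFin \o I u).
  apply: integrableS ir => //.
  by apply: subset_itvr; rewrite bnd_simp.
have -> : - (\int[lebesgue_measure]_(x in `[0, r]) I u x) -
     - (\int[lebesgue_measure]_(x in `[0, s]) I u x) = \int[lebesgue_measure]_(x in
       `]s, r]) (-1 * I u x).
  by rewrite RintegralZl// mulN1r -(Rintegral_itvB ir) ?bnd_simp// opprB opprK addrC.
have cst_int (k : R) : lebesgue_measure.-integrable `]s, r]%classic (EFin \o cst k).
  apply/integrableP; split; first exact/measurable_EFinP.
  rewrite [ltLHS](_ : _ = \int[lebesgue_measure]_(x in `]s, r]) cst `|k|%:E x)%E//.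
  rewrite integral_cst//= lebesgue_measure_itv /=.
  by rewrite lte_fin; case: ifP => _; rewrite ?mule0// -EFinB -EFinM ltry.
have lm : fine (@lebesgue_measure R `]s, r]%classic) = r - s.
  rewrite lebesgue_measure_itv /= lte_fin; case: ltP => [_|rs].
    by rewrite -EFinB.
  have -> : r = s by apply/eqP; rewrite eq_le sr rs.
  by rewrite subrr.
have iN : lebesgue_measure.-integrable `]s, r]%classic (EFin \o (fun x : R => -1 * I
  u x)).
  by have := integrableZl _ (-1) irs; apply.
rewrite -lm -!Rintegral_cst//; apply/andP; split.
  apply: le_Rintegral; [by []|exact: cst_int|exact: iN|move=> x /=].
  rewrite in_itv /= => /andP[sx xr]; rewrite mulN1r.
  by have /andP[] := hI x (introT andP (conj (ltW sx) xr)).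
apply: le_Rintegral; [by []|exact: iN|exact: cst_int|move=> x /=].
rewrite in_itv /= => /andP[sx xr]; rewrite mulN1r.
by have /andP[] := hI x (introT andP (conj (ltW sx) xr)).
Qed.

(** [T s] is constrained for s >= 0 alone, so limits in s are taken within this set. *)
Local Notation half_line := (within [set s : R | 0 <= s]).

(** Lipschitz continuity on Dom G passes to every u by density, thanks to the uniform bound on
    X_s. *)
Lemma defect_cvg_diag r u : 0 <= r ->
  rdot u (X s u) @[s --> half_line (nbhs r)] --> rdot u (X r u).
Proof.
move=> r0.
have on_dom x : dom G x -> rdot x (X s x) @[s --> half_line (nbhs r)] --> rdot x (X r
  x).
  move=> dx; pose K := 2 * (nr x * nr (G x)) + dissipation G x.
  have K0 : 0 <= K.
    by rewrite addr_ge0 ?mulr_ge0 ?nr_ge0// (dissipation_ge0 DC w_ge0 Gadm).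
  have lip s t : 0 <= s <= t -> `|rdot x (X t x) - rdot x (X s x)| <= K * (t - s).
    move=> st; have [s0 _] := andP st.
    rewrite ler_norml -mulNr; apply: (defect_increment dx st) => q /andP[sq _].
    by have := integrand_bound dx (le_trans s0 sq); rewrite -normrN ler_norml.
  apply/cvgrPdist_lt => q q0; have K1 : 0 < K + 1 by lra.
  rewrite near_withinE; apply/nbhs_ballP; exists (q / (K + 1)); first exact: divr_gt0.
  move=> s /=; rewrite /ball /= ltr_pdivlMr// => rs s0.
  have sup (a : R) : a * (K + 1) < q -> 0 <= a -> K * a < q by lra.
  have [sr|rs'] := leP s r.
    apply: le_lt_trans (lip s r _) _; first by rewrite s0.
    by move: rs; rewrite ger0_norm ?subr_ge0// => /sup; apply; rewrite subr_ge0.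
  rewrite distrC; apply: le_lt_trans (lip r s _) _; first by rewrite r0 ltW.
  move: rs; rewrite distrC ger0_norm ?subr_ge0 ?(ltW rs')// => /sup; apply.
  by rewrite subr_ge0 ltW.
apply/cvgrPdist_lt => q q0.
pose N := 2 * nr u + 1; have N0 : 0 < N by rewrite /N; have := nr_ge0 u; lra.
have m0 : 0 < Num.min 1 (q / 3 / N) by rewrite lt_min ltr01 !divr_gt0.
have [x dx] := dense_nr Gdense u m0; rewrite lt_min => /andP[ux1 uxq].
have close s : 0 <= s -> `|rdot u (X s u) - rdot x (X s x)| <= q / 3.
  move=> s0; have -> : rdot u (X s u) - rdot x (X s x) = rdot (u - x) (X s (u + x)).
    exact/sym_sq_diff/ge0_rdot_sym/defect_ge0.
  apply: le_trans (defect_bound _ _ s0) _.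
  have xu : nr (u + x) <= N.
    have -> : u + x = u + u - (u - x) by rewrite opprB addrACA subrr addr0.
    apply: le_trans (nrD _ _) _; rewrite nrN; have := nrD u u; rewrite /N; lra.
  rewrite ltr_pdivlMr// in uxq.
  by apply: le_trans (ltW uxq); rewrite ler_wpM2l// nr_ge0.
have q3 : 0 < q / 3 by lra.
have /cvgrPdist_lt /(_ _ q3) := on_dom x dx; rewrite !near_withinE.
apply: filterS => s hs s0; have {}hs := hs s0.
have := close s s0; have := close r r0; move: hs.
rewrite !ler_norml !ltr_norml => /andP[? ?] /andP[? ?] /andP[? ?].
by apply/andP; split; lra.
Qed.

Lemma defect_cvg r u v : 0 <= r ->
  rdot u (X s v) @[s --> half_line (nbhs r)] --> rdot u (X r v).
Proof.
move=> r0.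
have polar s : 0 <= s -> rdot u (X s v) =
    4^-1 * (rdot (u + v) (X s (u + v)) - rdot (u - v) (X s (u - v))).
  by move=> s0; exact/sym_polar/ge0_rdot_sym/defect_ge0.
have h : 4^-1 * (rdot (u + v) (X s (u + v)) - rdot (u - v) (X s (u - v)))
    @[s --> half_line (nbhs r)] -->
    4^-1 * (rdot (u + v) (X r (u + v)) - rdot (u - v) (X r (u - v))).
  by apply: cvgM; [exact: cvg_cst|apply: cvgB; exact: defect_cvg_diag].
move/cvgrPdist_lt : h => h.
apply/cvgrPdist_lt => q q0; have := h q q0.
rewrite !near_withinE; apply: filterS => s hs s0.
by rewrite !polar//; exact: hs.
Qed.

Lemma defect_cont r u v (q : R) : 0 <= r -> 0 < q -> exists2 h0 : R, 0 < h0 &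
  forall s, 0 <= s -> `|s - r| < h0 -> `|rdot u (X s v) - rdot u (X r v)| < q.
Proof.
move=> r0 q0; have /cvgrPdist_lt /(_ _ q0) := @defect_cvg r u v r0.
rewrite near_withinE => /nbhs_ballP[h0 /= h00 h]; exists h0 => // s s0 sr.
by rewrite distrC; apply: h => //; rewrite /ball /= distrC.
Qed.

(** F, cut at M, is a finite sum and so continuous in s; hence F r + q bounds the integrand - [I u]
    on a whole interval [r - h, r]. *)
Lemma defect_decrease r u M (q : R) : 0 < r -> dom G u -> 0 < q ->
  \forall h \near 0^'+, rdot u (X r u) - h * (2 * rdot (X r u) (G u) +
    (dissipation G u - jump_energy M u) + jump_sum (fun y => rdot y (X r y)) M u + q) <=
    rdot u (X (r - h) u).
Proof.
move=> r0 du q0; have r0' := ltW r0.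
pose F s := 2 * rdot (G u) (X s u) + (dissipation G u - jump_energy M u) +
  jump_sum (fun y => rdot y (X s y)) M u.
have Fc : F s @[s --> half_line (nbhs r)] --> F r.
  apply: cvgD; last first.
    by apply: cvg_square_sum => j k; apply: cvgM; [exact: cvg_cst|exact: defect_cvg].
  by apply: cvgD; [apply: cvgM; [exact: cvg_cst|exact: defect_cvg]|exact: cvg_cst].
move/cvgrPdist_lt : Fc => /(_ _ q0); rewrite near_withinE => /nbhs_ballP[h0 /= h00 hF].
near=> h.
have hp : 0 < h by near: h; exact: nbhs_right_gt.
have hr : h < r by near: h; exact: nbhs_right_lt.
have hh0 : h < h0 by near: h; exact: nbhs_right_lt.
have st : 0 <= r - h <= r by rewrite subr_ge0 (ltW hr) gerBl ltW.
have bnd t : r - h <= t <= r ->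
    - (2 * (nr u * nr (G u)) + dissipation G u) <= - I u t <= F r + q.
  move=> /andP[ht tr]; have t0 : 0 <= t by apply: le_trans ht; rewrite subr_ge0 ltW.
  apply/andP; split.
    by have := integrand_bound du t0; rewrite ler_norml lerN2 => /andP[].
  have := integrand_lower M du t0.
  have : `|F r - F t| < q.
    by apply: hF => //; rewrite /ball /= ger0_norm ?subr_ge0//; lra.
  rewrite ltr_norml /F (rdotC (X t u)) => /andP[? ?] ?; lra.
have := defect_increment du st bnd => /andP[_].
rewrite subKr /F (rdotC (X r u)); lra.
Unshelve. all: by end_near. Qed.

End defect.

(** * Conservativity *)

Section kernel_bounds.
Context {R : realType}.
Variable w : nat -> nat -> R.
Hypothesis wr : regular_kernel w.

Lemma regular_kernel_bounds : exists w0 c : R, [/\ 0 < w0, forall j, w0 <= w j j &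
  forall n k, \sum_(j < n) w j k <= c].
Proof.
have [[w_ge0 wsup] winf] := wr.
exists (inf (range (fun j => w j j))), (fine (ereal_sup (range (fun k => \sum_(0 <=
  j <oo) (w j k)%:E)))%E).
split => // [j|n k].
  by apply: ge_inf; [exists 0 => _ [i _ <-]|exists j].
have le k' : (\sum_(0 <= j <oo) (w j k')%:E <= ereal_sup (range (fun k => \sum_(0 <=
  j <oo) (w j k)%:E)))%E.
  by apply: ereal_sup_ubound; exists k'.
rewrite -lee_fin fineK; last first.
  rewrite ge0_fin_numE//; apply: le_trans (le 0%N).
  by apply: nneseries_ge0 => j _ _; rewrite lee_fin.
apply: le_trans (le k); rewrite -sumEFin -(big_mkord predT (fun j => (w j k)%:E)).
by apply: nneseries_lim_ge => j _ _; rewrite lee_fin.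
Qed.

End kernel_bounds.

Section closable.
Context {R : realType} {H : innerModType R}.
Variable G : operator H.

Lemma adjointP x : dom (adjoint G) x -> adjoint_rel G x (adjoint G x).
Proof. by move=> [z hz]; apply: (xgetPex (0 : H)); exists z. Qed.

(** Amenability says that the images converge, not to what. Testing against the dense domain of the
    adjoint identifies the limit. *)
Lemma closable_lim (x : nat -> H) x0 : dense (dom (adjoint G)) -> dom G x0 ->
  (forall n, dom G (x n)) -> (x n @[n --> \oo] --> x0) -> cvgn (fun n => G (x n)) ->
  G (x n) @[n --> \oo] --> G x0.
Proof.
move=> Gd dx0 dx xx0 Gc.
have GL : G (x n) @[n --> \oo] --> lim (G (x n) @[n --> \oo]) by [].
suff -> : G x0 = lim (G (x n) @[n --> \oo]) by [].
apply: (dense_ext Gd) => z dz; have hz := adjointP dz.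
have h1 : rdot z (G (x n)) @[n --> \oo] --> rdot z (lim (G (x n) @[n --> \oo])).
  by apply: rdot_cvg => //; exact: cvg_cst.
have h2 : rdot z (G (x n)) @[n --> \oo] --> rdot z (G x0).
  have hr y' : dom G y' -> rdot z (G y') = rdot (adjoint G z) y'.
    by move=> dy; rewrite /rdot hz.
  rewrite hr//; under eq_fun do rewrite hr//.
  by apply: rdot_cvg => //; exact: cvg_cst.
by rewrite -(cvg_lim _ h1)// -(cvg_lim _ h2).
Qed.

End closable.

Section assembly.
Context {R : realType} {d : measure_display} {Omega : measurableType d}.
Variables (P : probability Omega R) (p : nat -> R) (Z : nat -> {RV P >-> R})
    (D : nat -> bop (L2 P)) (w : nat -> nat -> R) (G : operator (L2 P)).
Hypotheses (noise : bernoulli_noise p Z) (annD : annihilation_operators Z D).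

Local Notation C := (fun k => bop_adj (D k)).

(** Since u also lies in the domain of the adjoint, 2 Re <u, G u> is the form of the sum of G and
    its adjoint. *)
Lemma admissible_form : admissible w D G -> forall u, dom G u -> exists v,
  (weighted_op D C w n u @[n --> \oo] --> v) /\ 2 * rdot u (G u) = - rdot u v.
Proof.
move=> [_ GS AS GAS] u du;
  have dSu : dom (weighted_number_operator w D) u by rewrite -GS.
exists (weighted_number_operator w D u); split.
  have E : (fun n => weighted_op D C w n u) = weighted_number_series w D u.
    by apply/funext => n; rewrite weighted_opE.
  rewrite E; exact: dSu.
have dAu : dom (adjoint G) u by rewrite AS.
have h : rdot u (G u) = rdot (adjoint G u) u by rewrite /rdot (adjointP dAu du).
have := congr1 (rdot u) (GAS u dSu); rewrite rdotDr rdotNr => <-.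
by rewrite [rdot u (adjoint G u)]rdotC -h; ring.
Qed.

(** On the span the number operator is [number_op m] for all large m. The terms of the double series
    are nonnegative, so a finite square and a cutoff number form only lower the left side. The
    constant |b| + 1 is positive whatever the sign of b. *)
Lemma number_dissipative_form (b : R) : (forall j k, 0 <= w j k) ->
  number_dissipative Z w D G b ->
  forall x, lspan (chaos Z) x -> forall M m0 K, exists m, (K <= m)%N /\
     2 * rdot (number_op D C m x) (G x) + jump_sum D C w (number_form D m0) M x <=
     (`|b| + 1) * number_form D m x.
Proof.
move=> w_ge0 dis x sx M m0 K.
have eO := chaos_orthonormal noise; have eD := chaos_dense noise.
have De k s : D k (chaos Z s) = (k \in s)%:R *: chaos Z (s `\ k)%fset by exact: annD.
have Ce k s := creation_chaos noise k s annD.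
have DC k := annihilation_adjE noise k annD.
have [K0 hK0] := number_sum_span eO De Ce sx.
exists (maxn K K0); split; first exact: leq_maxl.
have Nx := hK0 _ (leq_maxr K K0); set m := maxn K K0 in Nx *.
have h := dis x sx.
have sL j k : lspan (chaos Z) (C j (D k x)).
  apply: lspan_bop; first by move=> s; rewrite Ce; exact/lspanZ/lspan_base.
  by apply: lspan_bop sx => s; rewrite De; exact/lspanZ/lspan_base.
have nL j k : number_form D m0 (C j (D k x)) <=
  rdot (C j (D k x)) (number_sum (chaos Z) (C j (D k x))).
  have [K1 /(_ _ (leq_maxr m0 K1)) ->] := number_sum_span eO De Ce (sL j k).
  by rewrite -(number_formE DC); exact/number_form_mono/leq_maxl.
have le_esum : ((jump_sum D C w (number_form D m0) M x)%:E <=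
  \esum_(jk in [set: nat * nat]) (w jk.1 jk.2 *
      cRe (inner (C jk.1 (D jk.2 x)) (number_sum (chaos Z) (C jk.1 (D jk.2 x)))))%:E)%E.
  apply: esum_ge.
  pose r := [seq (j, k) | j <- iota 0 M.+1, k <- iota 0 M.+1].
  have ur : uniq r by apply: allpairs_uniq; rewrite ?iota_uniq// => -[? ?] [? ?].
  exists [set` r]; first by split => //; exact: finite_seq.
  rewrite -fsbig_seq// big_allpairs /jump_sum /square_sum -sumEFin.
  rewrite -(big_mkord predT (fun j => (\sum_(k < M.+1) w j k * number_form D m0 (C j
    (D k x)))%:E)).
  rewrite /index_iota subn0; apply: lee_sum => j _.
  rewrite -sumEFin -(big_mkord predT (fun k => (w j k * number_form D m0 (C j (D k
    x)))%:E)).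
  rewrite /index_iota subn0; apply: lee_sum => k _ /=.
  by rewrite lee_fin ler_wpM2l.
have := le_trans (leeD2l _ le_esum) h.
rewrite -[number_operator Z x]/(number_sum (chaos Z) x) Nx -EFinD lee_fin.
rewrite -!/(rdot _ _) -(number_formE DC) => /le_trans; apply.
by rewrite ler_wpM2r ?number_form_ge0// ler_wpDr// ler_norm.
Qed.

Lemma conservative_of_short_time (T : R -> bop (L2 P) -> bop (L2 P)) (t0 : R) :
  0 < t0 -> qds T -> (forall r, 0 <= r <= t0 -> T r bop1 = bop1) -> conservative T.
Proof.
move=> t00 Tq h t tge0.
(* Enough equal steps for each to have length at most t0. *)
pose n := (Num.truncn (t / t0)).+1.
have n0 : 0 < n%:R :> R by rewrite ltr0n.
have tn : 0 <= t / n%:R <= t0.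
  apply/andP; split; first by apply: divr_ge0 => //; exact: ltW.
  by rewrite ler_pdivrMr// mulrC -ler_pdivrMr// ltW// truncnS_gt.
have hk k : T (k%:R * (t / n%:R)) bop1 = bop1.
  elim: k => [|k ih]; first by rewrite mul0r (qds0 Tq).
  have [tn0 _] := andP tn.
  by rewrite -natr1 mulrDl mul1r (qdsD Tq) ?mulr_ge0// h.
by have := hk n; rewrite mulrC divfK ?gt_eqF.
Qed.

End assembly.

Theorem theorem5p4 (R : realType) (d : measure_display) (Omega : measurableType d)
    (P : probability Omega R) (p : nat -> R) (Z : nat -> {RV P >-> R})
    (D : nat -> bop (L2 P)) (w : nat -> nat -> R) (G : operator (L2 P))
    (Pt : R -> bop (L2 P)) (T : R -> bop (L2 P) -> bop (L2 P)) :
  bernoulli_noise p Z ->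
  annihilation_operators Z D ->
  regular_kernel w ->
  linear_operator G ->
  densely_defined G ->
  contraction_semigroup Pt ->
  generator Pt G ->
  admissible w D G ->
  amenable Z G ->
  (exists b : R, number_dissipative Z w D G b) ->
  minimal_qds w G (fun j k => bop_adj (D j) \ob D k) T ->
  conservative T.
Proof.
move=> noise annD wr Glin Gdense Psg Pgen adm [Gspan Gam] [b dis] [Tqds Teq _].
have [w0 [c [w0_gt0 w0_le w_le]]] := regular_kernel_bounds wr.
have [[w_ge0 _] _] := wr.
have eO := chaos_orthonormal noise; have eD := chaos_dense noise.
have De k s : D k (chaos Z s) = (k \in s)%:R *: chaos Z (s `\ k)%fset by exact: annD.
have Ce k s := creation_chaos noise k s annD.
have DC k := annihilation_adjE noise k annD.
have Gadm := admissible_form adm.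
have Gdis := number_dissipative_form noise annD w_ge0 dis.
have b0 : 0 < `|b| + 1 by rewrite ltr_wpDl.
have Gtr u : dom G u -> G (trunc (chaos Z) n u) @[n --> \oo] --> G u.
  move=> du; apply: closable_lim => //.
  (* The adjoint has the domain of S_w, which is Dom G and hence dense. *)
  - by have [_ GS AS _] := adm; rewrite AS -GS.
  - by move=> n; apply: Gspan; exact: trunc_span.
  - by apply/nr_cvgP => q q0; exact: trunc_cvg.
  - exact: Gam.
(* This time is 1 / lam for the constant |b| + 1, the longest on which a stays below 2 eps. *)
apply: (@conservative_of_short_time _ _ _ _ T (2 * (`|b| + 1) + 1)^-1).
- by rewrite invr_gt0; lra.
- exact: Tqds.
move=> r rt.
have Xr : defect T r = 0.
  apply: (psd_family_zero eO eD De Ce DC w_ge0 w0_gt0 w0_le w_le Glin Gadm Gspan Gtr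
    b0 Gdis
    Psg Pgen Gdense _ _ _ _ _ _ rt).
  - by move=> q u v q0; exact/ge0_rdot_sym/defect_ge0.
  - by move=> q u q0; exact/ge0_rdot/defect_ge0.
  - by move=> q u q0; exact: defect_le.
  - by move=> u; rewrite defectE (qds0 Tqds) subrr.
  - by move=> q u v q1 q0 q10; exact: (defect_cont DC w_ge0 Gadm Gdense Tqds Teq).
  - by move=> q u M q1 q0 du q10;
    exact: (defect_decrease DC w_ge0 Gadm Gdense Tqds Teq).
by apply/eqP; rewrite eq_sym -subr_eq0; apply/eqP.
Qed.
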